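(* Let $\lambda_1,\lambda_2\in(0,1)$ with $\frac{\log\lambda_1}{\log\lambda_2}\notin\mathbb Q$, and let $\alpha_i=\frac{\lambda_i}{\lambda_i+1}$, $i=1,2$. Let $\mathbf h_{\alpha_1}$ and $\mathbf h_{\alpha_2}$ be the left (resp. right) Haar systems in $\mathcal R_{\alpha_1}$ and $\mathcal R_{\alpha_2}$. Then the system $\mathbf z=\mathbf h_{\alpha_1}\otimes\mathbf h_{\alpha_2}$, taken in the shell enumeration, is a Schauder basis of the predual of the hyperfinite factor of type $\mathrm{III}_1$, realized as $\mathcal R_{\alpha_1}\bar\otimes\mathcal R_{\alpha_2}$ and embedded in its predual by $x\mapsto\rho(\cdot\,x)$ (resp. $x\mapsto\rho(x\,\cdot)$), where $\rho=\rho_{\alpha_1}\otimes\rho_{\alpha_2}$.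
   Context: Fix $0<\alpha<\frac12$ and $\lambda=\frac\alpha{1-\alpha}$. For $\nu\ge1$ let $\mathcal N_\nu$ be the algebra of complex $2^\nu\times2^\nu$ matrices with unit $\mathbf 1_\nu$, with $\mathcal N_\nu\otimes\mathcal N_\mu=\mathcal N_{\nu+\mu}$ via the Kronecker product; $\rho_\nu(x)=\mathrm{Tr}(xA_\nu)$, where $A_\nu=\bigotimes_{k=1}^\nu\begin{pmatrix}\alpha&0\\0&1-\alpha\end{pmatrix}$; and $i_\nu:\mathcal N_\nu\to\mathcal N_{\nu+1}$, $i_\nu(x)=x\otimes\mathbf 1_1$. $\mathcal R_\alpha$ is the von Neumann algebra generated by the GNS representation of the $C^*$-inductive limit of $(\mathcal N_\nu,i_\nu)$ with respect to the state $\rho_\alpha$ induced by the $\rho_\nu$; it is the hyperfinite factor of type $\mathrm{III}_\lambda$, with faithful normal state $\rho_\alpha$ and canonical embeddings $\pi_\nu:\mathcal N_\nu\to\mathcal R_\alpha$. When $\frac{\log\lambda_1}{\log\lambda_2}\notin\mathbb Q$, the von Neumann tensor product $\mathcal R_{\alpha_1}\bar\otimes\mathcal R_{\alpha_2}$, taken with respect to the product state $\rho_{\alpha_1}\otimes\rho_{\alpha_2}$, is the hyperfinite factor of type $\mathrm{III}_1$ (known fact). Shell enumeration: a pair $(a,b)$, $a,b\ge1$, gets the number $s(a,b)=(b-1)^2+a$ if $a\le b$ and $s(a,b)=a^2-b+1$ if $a>b$. Matrix units in shell enumeration: $\{e^{(\nu)}_m\}_{0\le m<4^\nu}$, where the matrix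 unit with entry $1$ in row $a$, column $b$ ($1\le a,b\le2^\nu$) gets index $m=s(a,b)-1$. Haar system $\mathbf h_\alpha=\{h_j\}_{j\ge0}$: put $$r_0=\mathbf 1_1,\quad r_1=\begin{pmatrix}\frac1{\sqrt\lambda}&0\\0&-\sqrt\lambda\end{pmatrix},\quad r_2=\begin{pmatrix}0&1\\1&0\end{pmatrix},\quad r_3=\begin{pmatrix}0&-\sqrt\lambda\\\frac1{\sqrt\lambda}&0\end{pmatrix}$$ for the left system; for the right system $r_3$ is replaced by $r_3^*$. Let $\mathbf h_1=\{r_0,r_1,r_2,r_3\}$ and, inductively, for $j=4^\nu q+k$ with $0\le q\le3$, $0\le k<4^\nu$, $h^{(\nu+1)}_j=i_\nu(h^{(\nu)}_k)(\mathbf 1_\nu\otimes r_0)$ if $q=0$ and $h^{(\nu+1)}_j=i_\nu(e^{(\nu)}_k)(\mathbf 1_\nu\otimes r_q)$ if $q\ne0$. Since $r_0=\mathbf 1_1$, $h^{(\nu+1)}_j=i_\nu(h^{(\nu)}_j)$ for $j<4^\nu$, and $h_j:=\pi_\nu(h^{(\nu)}_j)$ for any $\nu$ with $j<4^\nu$. For two sequences $\{x_j\}_{j\ge1}$, $\{y_k\}_{k\ge1}$, the product system $\{x_j\otimes y_k\}$ in the shell enumeration is the sequence in which $x_j\otimes y_k$ has number $s(j,k)$ (Haar systems are re-indexed to start at $1$, preserving order). *)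

(* Defs.v *)
(* The scalars are the complex numbers R[i] over a realType R. *)
From HB Require Import structures.
From mathcomp Require Import all_boot all_order all_algebra.
From mathcomp Require Import all_classical all_reals all_analysis.
From mathcomp Require Import complex mxtens.
Set Implicit Arguments.
Unset Strict Implicit.
Unset Printing Implicit Defensive.
Import Order.TTheory GRing.Theory Num.Theory.
Import numFieldNormedType.Exports.

Local Open Scope classical_set_scope.
Local Open Scope ring_scope.
Local Open Scope complex_scope.

HB.mixin Record CompleteNormedModule_isHilbert (C : numClosedFieldType) H
    of CompleteNormedModule C H := {
  inner : {dot H for @Num.conj C};
  sqr_norm_inner : forall u : H, `|u| ^+ 2 = inner u u }.

#[short(type="hilbertType")]
HB.structure Definition Hilbert (C : numClosedFieldType) :=
  {H of CompleteNormedModule C H & CompleteNormedModule_isHilbert C H}.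

(* Unital C*-algebras. The product is a field of its own because the library has
   no join of its algebra and normed module structures. *)
HB.mixin Record isCstarAlgebra (C : numClosedFieldType) A
    of CompleteNormedModule C A := {
  cs_mul : A -> A -> A;
  cs_one : A;
  star : A -> A;
  cs_mulA : associative cs_mul;
  cs_mul1l : left_id cs_one cs_mul;
  cs_mul1r : right_id cs_one cs_mul;
  cs_mul_linear : forall a, linear (cs_mul a);
  cs_mulr_linear : forall a, linear (cs_mul ^~ a);
  starD : forall a b, star (a + b) = star a + star b;
  starZ : forall (c : C) a, star (c *: a) = Num.conj c *: star a;
  starM : forall a b, star (cs_mul a b) = cs_mul (star b) (star a);
  starK : involutive star;
  norm_cs_mul : forall a b, `|cs_mul a b| <= `|a| * `|b|;
  norm_star_mul : forall a, `|cs_mul (star a) a| = `|a| ^+ 2 }.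

#[short(type="cstarAlgType")]
HB.structure Definition CstarAlgebra (C : numClosedFieldType) :=
  {A of CompleteNormedModule C A & isCstarAlgebra C A}.

(* The norms of the library take their values in the scalar field R[i]; this is
   the same number as an element of R. *)
Definition rnorm (R : realType) (V : normedModType R[i]) (v : V) : R :=
  complex.Re `|v|.

(* Operators are functions H -> H, and sets of operators contain only bounded
   linear ones. *)
Definition bounded_op (R : realType) (H : hilbertType R[i]) (x : H -> H) : Prop :=
  linear x /\ exists c : R[i], forall u, `|x u| <= c * `|u|.

Definition commutant (R : realType) (H : hilbertType R[i]) (S : set (H -> H)) :
    set (H -> H) :=
  [set x | bounded_op x /\ forall y, S y -> x \o y = y \o x].

(* Used for S closed under adjoints only *)
Definition vN_generated (R : realType) (H : hilbertType R[i])
    (S : set (H -> H)) : set (H -> H) :=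
  commutant (commutant S).

Definition square_summable (R : realType) (H : hilbertType R[i])
    (u : nat -> H) : Prop :=
  (\sum_(0 <= i <oo) ((rnorm (u i)) ^+ 2)%:E < +oo)%E.

(* x |-> \sum_i <x u_i, v_i>, which converges for square summable u and v *)
Definition omega (R : realType) (H : hilbertType R[i]) (u v : nat -> H)
    (x : H -> H) : R[i] :=
  limn (series (fun i => inner (x (u i)) (v i) : R[i]^o)).

(* Functionals on M are functions of all x : H -> H; only the values on M matter
   in what follows. *)
Definition functional_on (R : realType) (H : hilbertType R[i])
    (M : set (H -> H)) (phi : (H -> H) -> R[i]^o) : Prop :=
  forall (c : R[i]) (x y : H -> H), M x -> M y ->
    phi (c *: x + y) = c *: phi x + phi y.

(* Continuity on M for the topology defined by the seminorms |omega u v|, u and v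
   square summable *)
Definition sigma_weakly_continuous (R : realType) (H : hilbertType R[i])
    (M : set (H -> H)) (phi : (H -> H) -> R[i]^o) : Prop :=
  forall x, M x -> forall e : R, 0 < e ->
    exists (n : nat) (u v : 'I_n -> nat -> H) (d : R),
      [/\ forall k, square_summable (u k) /\ square_summable (v k),
          0 < d &
          forall y, M y ->
            (forall k, rnorm (omega (u k) (v k) (y - x) : R[i]^o) < d) ->
            rnorm (phi y - phi x) < e].

Definition predual (R : realType) (H : hilbertType R[i]) (M : set (H -> H)) :
    set ((H -> H) -> R[i]^o) :=
  [set phi | functional_on M phi /\ sigma_weakly_continuous M phi].

Definition functional_norm (R : realType) (H : hilbertType R[i])
    (M : set (H -> H)) (phi : (H -> H) -> R[i]^o) : \bar R :=
  ereal_sup [set (rnorm (phi x))%:E |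
             x in [set x | M x /\ forall u, `|x u| <= `|u|]].

(* X is a linear subspace of V, and N restricts to a seminorm on X whose null
   vectors are identified with 0. *)
Definition schauder_basis (R : realType) (V : lmodType R[i]) (X : set V)
    (N : V -> \bar R) (e : nat -> V) : Prop :=
  (forall n, X (e n)) /\
  forall x, X x -> exists! c : nat -> R[i],
    N (x - \sum_(0 <= k < n) c k *: e k) @[n --> \oo] --> 0%E.

Definition kron2 (R : realType) n (x : 'M[R[i]]_(2 ^ n)) (y : 'M[R[i]]_2) :
    'M[R[i]]_(2 ^ n.+1) :=
  castmx (esym (expnSr 2 n), esym (expnSr 2 n)) (x *t y).

Definition adjmx (R : realType) n (x : 'M[R[i]]_n) : 'M[R[i]]_n :=
  map_mx (@Num.conj R[i]) x^T.

Definition mx2 (R : realType) (a b c d : R) : 'M[R[i]]_2 :=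
  \matrix_(i < 2, j < 2)
    (if i == 0 then if j == 0 then a else b else if j == 0 then c else d)%:C.

Fixpoint density (R : realType) (alpha : R) n : 'M[R[i]]_(2 ^ n) :=
  if n is n'.+1 then kron2 (density alpha n') (mx2 alpha 0 0 (1 - alpha))
  else 1%:M.

(* A is the C*-inductive limit of the matrix algebras along x |-> x (x) 1; the
   system starts at the scalars, n = 0, which does not change the limit. *)
Record is_cstar_limit (R : realType) (A : cstarAlgType R[i])
    (emb : forall n, 'M[R[i]]_(2 ^ n) -> A) : Prop := IsCstarLimit {
  emb_linear : forall n, linear (emb n);
  emb_mul : forall n x y, emb n (x *m y) = cs_mul (emb n x) (emb n y);
  emb_one : forall n, emb n 1%:M = cs_one;
  emb_star : forall n x, emb n (adjmx x) = star (emb n x);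
  emb_inj : forall n, injective (emb n);
  emb_compat : forall n x, emb n.+1 (kron2 x 1%:M) = emb n x;
  emb_dense : dense (\bigcup_n range (emb n)) }.

Record is_state (R : realType) (A : cstarAlgType R[i]) (rho : A -> R[i]) :
    Prop := IsState {
  state_linear : forall (c : R[i]) a b, rho (c *: a + b) = c * rho a + rho b;
  state_ge0 : forall a, 0 <= rho (cs_mul (star a) a);
  state_one : rho cs_one = 1 }.

(* rep_contractive holds for every *-representation of a C*-algebra. *)
Record is_GNS (R : realType) (A : cstarAlgType R[i]) (rho : A -> R[i])
    (H : hilbertType R[i]) (rep : A -> H -> H) (xi : H) : Prop := IsGNS {
  rep_op_linear : forall a, linear (rep a);
  rep_linear : linear rep;
  rep_mul : forall a b, rep (cs_mul a b) = rep a \o rep b;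
  rep_one : rep cs_one = id;
  rep_star : forall a u v, inner (rep (star a) u) v = inner u (rep a v);
  rep_contractive : forall a u, `|rep a u| <= `|a| * `|u|;
  rep_state : forall a, inner (rep a xi) xi = rho a;
  rep_cyclic : dense (range (fun a => rep a xi)) }.

(* The data defining R_alpha, unique up to isomorphism: the inductive limit, its
   state and the GNS representation of the state *)
Record powers_system (R : realType) (alpha : R) := PowersSystem {
  ps_alg : cstarAlgType R[i];
  ps_emb : forall n, 'M[R[i]]_(2 ^ n) -> ps_alg;
  ps_limit : is_cstar_limit ps_emb;
  ps_state : ps_alg -> R[i];
  ps_is_state : is_state ps_state;
  ps_state_emb : forall n (x : 'M[R[i]]_(2 ^ n)),
    ps_state (ps_emb x) = \tr (x *m density alpha n);
  ps_space : hilbertType R[i];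
  ps_rep : ps_alg -> ps_space -> ps_space;
  ps_vec : ps_space;
  ps_GNS : is_GNS ps_state ps_rep ps_vec }.

Definition powers_factor (R : realType) (alpha : R) (P : powers_system alpha) :
    set (ps_space P -> ps_space P) :=
  vN_generated (range (@ps_rep _ _ P)).
Arguments powers_factor {R alpha} P.

Definition shell (a b : nat) : nat :=
  if (a <= b)%N then (b.-1 ^ 2 + a)%N else (a ^ 2 - b + 1)%N.

(* Rows and columns are numbered from 0, hence the successors *)
Definition shell_unit (R : realType) n (m : nat) : 'M[R[i]]_n :=
  \matrix_(i < n, j < n) (shell i.+1 j.+1 == m.+1)%:R.

Inductive side := Left | Right.

Definition haar_gen (R : realType) (s : side) (alpha : R) (q : nat) :
    'M[R[i]]_2 :=
  let l := alpha / (1 - alpha) in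
  let r3 := mx2 0 (- Num.sqrt l) (Num.sqrt l)^-1 0 in
  match q with
  | 0 => 1%:M
  | 1 => mx2 (Num.sqrt l)^-1 0 0 (- Num.sqrt l)
  | 2 => mx2 0 1 1 0
  | _ => if s is Left then r3 else adjmx r3
  end.

(* Meaningful for j < 4 ^ n. The recursion starts at n = 0, where j = 0 is the
   only index, so that for n = 1 it returns haar_gen. *)
Fixpoint haar_mx (R : realType) (s : side) (alpha : R) (n : nat) (j : nat) :
    'M[R[i]]_(2 ^ n) :=
  if n is n'.+1 then
    let q := (j %/ 4 ^ n')%N in
    let k := (j %% 4 ^ n')%N in
    kron2 (if q == 0%N then haar_mx s alpha n' k else shell_unit R _ k) 1%:M
      *m kron2 1%:M (haar_gen s alpha q)
  else 1%:M.

(* Any n with j < 4 ^ n in place of the level j gives the same operator. *)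
Definition haar (R : realType) (alpha : R) (P : powers_system alpha) (s : side)
    (j : nat) : ps_space P -> ps_space P :=
  ps_rep (ps_emb P (haar_mx s alpha j j)).
Arguments haar {R alpha} P s j.

Record is_hilbert_tensor (R : realType) (H1 H2 K : hilbertType R[i])
    (t : {bilinear H1 -> H2 -> K}) : Prop := IsHilbertTensor {
  tensor_inner : forall u1 u2 v1 v2,
    inner (t u1 u2) (t v1 v2) = inner u1 v1 * inner u2 v2;
  tensor_dense : dense [set w | exists n (u : 'I_n -> H1) (v : 'I_n -> H2),
    w = \sum_k t (u k) (v k)] }.

(* w = x (x) y *)
Definition tensor_op (R : realType) (H1 H2 K : hilbertType R[i])
    (t : {bilinear H1 -> H2 -> K}) (x : H1 -> H1) (y : H2 -> H2) (w : K -> K) :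
    Prop :=
  bounded_op w /\ forall u v, w (t u v) = t (x u) (y v).

Definition vN_tensor (R : realType) (H1 H2 K : hilbertType R[i])
    (t : {bilinear H1 -> H2 -> K}) (M1 : set (H1 -> H1)) (M2 : set (H2 -> H2)) :
    set (K -> K) :=
  vN_generated [set w | exists x y, [/\ M1 x, M2 y & tensor_op t x y w]].

(* z enumerates from 0 the products of x and y, themselves enumerated from 0. *)
Definition shell_product (R : realType) (H1 H2 K : hilbertType R[i])
    (t : {bilinear H1 -> H2 -> K}) (x : nat -> H1 -> H1) (y : nat -> H2 -> H2)
    (z : nat -> K -> K) : Prop :=
  forall j k, tensor_op t (x j) (y k) (z (shell j.+1 k.+1).-1).

Definition vector_state (R : realType) (H : hilbertType R[i]) (xi : H)
    (x : H -> H) : R[i] :=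
  inner (x xi) xi.

Definition predual_embedding (R : realType) (H : hilbertType R[i]) (s : side)
    (rho : (H -> H) -> R[i]) (x : H -> H) : (H -> H) -> R[i]^o :=
  match s with
  | Left => fun y => rho (y \o x)
  | Right => fun y => rho (x \o y)
  end.

(* Main.v *)
Require Import Defs.
From HB Require Import structures.
From mathcomp Require Import all_boot all_order all_algebra.
From mathcomp Require Import all_classical all_reals all_analysis.
From mathcomp Require Import complex mxtens.
From mathcomp Require Import zify ring.
Import Order.TTheory GRing.Theory Num.Theory.
Import numFieldNormedType.Exports.
Set Implicit Arguments.
Unset Strict Implicit.
Unset Printing Implicit Defensive.

(** Let [K] be the tensor product of the two GNS spaces, [Om] the product of the
    cyclic vectors, [M] the von Neumann algebra, and [e n] the functional that
    embeds the [n]-th product of Haar operators. The finite-level matrix algebras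
    contain elements biorthogonal to the [e n]; the coefficients of a functional
    [phi] are therefore forced to be its values at these elements, and the
    partial sums of its expansion are [phi \o proj N], where [proj N y] is the
    combination of the first [N] dual elements with the coefficients [e k y]. As
    for every biorthogonal system, the expansions converge in norm as soon as the
    maps [proj N] are bounded uniformly in [N] ([proj_bound]) and the span of the
    [e n] is dense in the predual ([predual_approximable]).

    Both facts are brought down to matrices by the multiplications from the right.
    The density matrices being diagonal, right multiplication by a matrix unit is
    bounded on the GNS space ([right_mul_bound]), and it commutes with [M]. An
    element [y] of [M] hence acts on the vectors of a finite level, up to the
    orthogonal complement, as the left multiplication by a matrix, its compression
    ([compressionP]). Compressing does not increase norms, and [e n y] is the
    pairing of the compression of [y] with the matrix of the [n]-th element
    ([predual_embedding_pairing]).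

    Boundedness. For one factor, the truncation at level [n + 1] applies the
    truncation of the level [n] to the conditional expectation, and cuts the
    coefficient matrices of the three other generators to initial segments of the
    shell enumeration ([haar_truncS]). An initial segment of the shell enumeration
    is a signed sum of three rectangles ([shell0_lt_rect]), and cutting a matrix
    to a rectangle is a contraction. Conditional expectations are contractions as
    well, and once the truncation reaches beyond the level [n] the first summand
    is the conditional expectation itself, so the bounds do not accumulate with
    the level. The bounds are uniform over all amplifications by matrix algebras
    ([haar_trunc_cbounded]), hence pass to tensor products of truncations; as the
    product system is again enumerated by shells, its truncations are signed sums
    of three such tensor products ([prod_trunc_cbounded]).

    Density. By finite-dimensional linear algebra a sigma-weakly continuous
    functional is a finite combination of functionals [omega u v]. These are norm
    limits of finite sums of coefficients [<y u, v>], and those of coefficients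
    with [u] and [v] of finite level. The latter depend linearly on a compression
    of [y], so they are combinations of the [e n]. *)

(** * The shell enumeration *)

Definition shell0 (j k : nat) : nat := (shell j.+1 k.+1).-1.

Lemma shell0E j k :
  shell0 j k = if j <= k then k * k + j else j * j + j.*2 - k.
Proof.
rewrite /shell0 /shell ltnS; case: leqP => jk /=; rewrite -!mulnn; nia.
Qed.

Lemma shell_unitE j k m : (shell j.+1 k.+1 == m.+1) = (shell0 j k == m).
Proof.
suff: 0 < shell j.+1 k.+1 by rewrite /shell0; case: shell.
by rewrite /shell; case: ifP; rewrite ?addn1 // addnS.
Qed.

Lemma shell0_surj n : exists jk, shell0 jk.1 jk.2 == n.
Proof.
elim: n => [|n [[j k] /= /eqP <-]]; first by exists (0, 0); rewrite shell0E.
case: (ltngtP j k) => jk.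
- by exists (j.+1, k); apply/eqP; rewrite !shell0E /=; repeat (case: ifP => ?); nia.
- case: k jk => [|k] jk.
    by exists (0, j.+1); apply/eqP; rewrite !shell0E /=; repeat (case: ifP => ?); nia.
  by exists (j, k); apply/eqP; rewrite !shell0E /=; repeat (case: ifP => ?); nia.
- rewrite jk; case: k jk => [|k] _; first by exists (0, 1); rewrite !shell0E.
  by exists (k.+1, k); apply/eqP; rewrite !shell0E /=; repeat (case: ifP => ?); nia.
Qed.

Definition unshell n : nat * nat := xchoose (shell0_surj n).

Lemma unshellK n : shell0 (unshell n).1 (unshell n).2 = n.
Proof. exact/eqP/(xchooseP (shell0_surj n)). Qed.

Lemma shell0_inj j k j' k' : shell0 j k = shell0 j' k' -> (j, k) = (j', k').
Proof.
rewrite !shell0E => e; suff [-> ->] : j = j' /\ k = k' by [].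
have sq (a b : nat) : a < b -> a * a + a.*2 + 1 <= b * b by nia.
case: (leqP j k) e => jk; case: (leqP j' k') => jk' e.
- by move: jk jk' e; case: (ltngtP k k') => [/sq|/sq|->] *; lia.
- by move: jk jk' e; case: (ltngtP k j') => [/sq|/sq|->] *; lia.
- by move: jk jk' e; case: (ltngtP j k') => [/sq|/sq|->] *; lia.
- by move: jk jk' e; case: (ltngtP j j') => [/sq|/sq|->] *; lia.
Qed.

Lemma shell0K j k : unshell (shell0 j k) = (j, k).
Proof. by have /shell0_inj := unshellK (shell0 j k); case: unshell => ? ? ->. Qed.

Lemma shell0_lt_sq j k b : (shell0 j k < b * b) = (j < b) && (k < b).
Proof.
rewrite shell0E.
by case: ifP => h; (apply/idP/andP => [h'|[h1 h2]]; [split; nia|nia]).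
Qed.

(** The pairs numbered before [N = b^2 + a] form the square of side [b] and a
    part of the next shell. Reading the shell as a column followed by a row, the
    part is a rectangle when [a <= b], and otherwise the whole square of side
    [b + 1] is cut down by the remainder of its last row. *)
Lemma shell0_lt_rect N : exists p1 q1 p2 q2 p3 q3 : nat, forall j k,
  (shell0 j k < N) + (j < p3) && (k < q3)
  = (j < p1) && (k < q1) + (j < p2) && (k < q2).
Proof.
have [b [a [-> ab]]] : exists b a, N = b * b + a /\ a <= b.*2.
  elim: N => [|N [b [a [-> ab]]]]; first by exists 0, 0.
  case: (ltnP a b.*2) => h; first by exists b, a.+1; split; lia.
  exists b.+1, 0; split; nia.
have sq (x y : nat) : x < y -> x * x + x.*2 + 1 <= y * y by nia.
case: (leqP a b) => h.
  exists b, b, a, b.+1, a, b => j k; rewrite shell0E.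
  by case: (leqP j k) => jk; [have := sq k b; have := sq b k
                             |have := sq j b; have := sq b j] => sq1 sq2;
     repeat (case: ltnP => ? //=; try (exfalso; nia)); nia.
exists b.+1, b.+1, b, (b.*2.+1 - a), b.+1, (b.*2.+1 - a) => j k.
rewrite shell0E.
by case: (leqP j k) => jk; [have := sq k b; have := sq b k
                           |have := sq j b; have := sq b j] => sq1 sq2;
   repeat (case: ltnP => ? //=; try (exfalso; nia)); nia.
Qed.

Local Open Scope classical_set_scope.
Local Open Scope ring_scope.
Local Open Scope complex_scope.

Lemma shell0_lt_rectR (A : pzRingType) N :
  exists p1 q1 p2 q2 p3 q3 : nat, forall j k : nat,
  (shell0 j k < N)%N%:R = ((j < p1) && (k < q1))%N%:R + ((j < p2) && (k < q2))%N%:R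
                        - ((j < p3) && (k < q3))%N%:R :> A.
Proof.
have [p1 [q1 [p2 [q2 [p3 [q3 h]]]]]] := shell0_lt_rect N.
exists p1, q1, p2, q2, p3, q3 => j k.
by apply: (addIr ((j < p3) && (k < q3))%N%:R); rewrite subrK -!natrD h.
Qed.

Lemma sum_unshell (V : nmodType) (G : nat -> nat -> V) N m : (N <= m * m)%N ->
  \sum_(n < N) G (unshell n).1 (unshell n).2
  = \sum_(j < m) \sum_(k < m) (if (shell0 j k < N)%N then G j k else 0).
Proof.
move=> Nm.
have term (j k : nat) : (if (shell0 j k < N)%N then G j k else 0)
    = \sum_(n < N | n == shell0 j k :> nat) G (unshell n).1 (unshell n).2.
  case: ifP => h.
    rewrite (big_pred1 (Ordinal h)) //.
    by rewrite /= shell0K.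
  by rewrite big_pred0 // => n; apply: contraFF h => /eqP <-.
under [RHS]eq_bigr => j _.
  under eq_bigr => k _ do rewrite term big_mkcond.
  rewrite exchange_big; over.
rewrite exchange_big; apply: eq_bigr => n _.
have [un1 un2] : ((unshell n).1 < m /\ (unshell n).2 < m)%N.
  by apply/andP; rewrite -shell0_lt_sq unshellK (leq_trans (ltn_ord n)).
rewrite (bigD1 (Ordinal un1)) //= (bigD1 (Ordinal un2)) //= unshellK eqxx.
rewrite big1 => [|k /negbTE nk]; last first.
  case: eqP => // e; move: nk; rewrite -val_eqE /=.
  by rewrite e shell0K /= eqxx.
rewrite addr0 big1 ?addr0 // => j /negbTE nj; apply: big1 => k _.
case: eqP => // e; move: nj; rewrite -val_eqE /=.
by rewrite e shell0K /= eqxx.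
Qed.

(** * Operator bounds for matrices over finite index types *)

Section OpBound.
Variable C : numClosedFieldType.
Implicit Types I J L T : finType.

Definition sqnorm I (u : I -> C) : C := \sum_i `|u i| ^+ 2.

Definition bform I (y : I -> I -> C) (u v : I -> C) : C :=
  \sum_i \sum_j y i j * u j * v i.

(** The operator norm of [y] is at most [c]. By the inequality between the
    arithmetic and the geometric mean, and by rescaling [u] and [v], this is
    equivalent to [|<y u, v>| <= c |u| |v|]; in this form it is visibly additive
    in [y] and needs no square root. *)
Definition op_le I (c : C) (y : I -> I -> C) : Prop :=
  forall u v, `|bform y u v| *+ 2 <= c * (sqnorm u + sqnorm v).

Lemma sqnorm_ge0 I (u : I -> C) : 0 <= sqnorm u.
Proof. by apply: sumr_ge0 => i _; rewrite exprn_ge0. Qed.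

Lemma eq_op_le I c (y y' : I -> I -> C) :
  (forall i j, y i j = y' i j) -> op_le c y -> op_le c y'.
Proof.
move=> e h u v; rewrite (_ : bform y' u v = bform y u v); first exact: h.
by apply: eq_bigr => i _; apply: eq_bigr => j _; rewrite e.
Qed.

Lemma op_leW I c c' (y : I -> I -> C) : c <= c' -> op_le c y -> op_le c' y.
Proof.
move=> cc' h u v; apply: le_trans (h u v) _.
by apply: ler_wpM2r => //; rewrite addr_ge0 ?sqnorm_ge0.
Qed.

Lemma op_le0 I : op_le 0 (fun _ _ : I => 0).
Proof.
move=> u v; rewrite mul0r (_ : bform _ u v = 0) ?normr0 ?mul0rn //.
by apply: big1 => i _; apply: big1 => j _; rewrite !mul0r.
Qed.

Lemma op_leD I c c' (y y' : I -> I -> C) : op_le c y -> op_le c' y' ->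
  op_le (c + c') (fun i j => y i j + y' i j).
Proof.
move=> h h' u v; rewrite mulrDl.
have -> : bform (fun i j => y i j + y' i j) u v = bform y u v + bform y' u v.
  rewrite -big_split; apply: eq_bigr => i _ /=; rewrite -big_split.
  by apply: eq_bigr => j _ /=; rewrite !mulrDl.
apply: le_trans (lerD (h u v) (h' u v)).
by rewrite -mulrnDl lerMn2r ler_normD.
Qed.

Lemma op_leZ I c (a : C) (y : I -> I -> C) : op_le c y ->
  op_le (`|a| * c) (fun i j => a * y i j).
Proof.
move=> h u v; have -> : bform (fun i j => a * y i j) u v = a * bform y u v.
  rewrite mulr_sumr; apply: eq_bigr => i _; rewrite mulr_sumr.
  by apply: eq_bigr => j _; rewrite !mulrA.
by rewrite normrM -mulrnAr -mulrA ler_wpM2l.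
Qed.

Lemma op_le_sum I (X : Type) (s : seq X) (P : pred X) (c : X -> C)
    (y : X -> I -> I -> C) : (forall x, P x -> op_le (c x) (y x)) ->
  op_le (\sum_(x <- s | P x) c x) (fun i j => \sum_(x <- s | P x) y x i j).
Proof.
move=> h; elim: s => [|x s ih].
  rewrite big_nil; apply: eq_op_le (@op_le0 I) => i j.
  by rewrite big_nil.
rewrite big_cons; case: ifPn => Px.
  apply: eq_op_le (op_leD (h x Px) ih) => i j.
  by rewrite big_cons Px.
by apply: eq_op_le ih => i j; rewrite big_cons (negbTE Px).
Qed.

(** The vector [u], cut to [a] and transported along [f] *)
Definition pushf I J (a : pred I) (f : I -> J) (u : I -> C) (j : J) : C :=
  \sum_(i | a i && (f i == j)) u i.

Lemma sqnorm_pushf I J (a : pred I) (f : I -> J) u :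
  {in a &, injective f} -> sqnorm (pushf a f u) <= sqnorm u.
Proof.
move=> fI.
have -> : sqnorm (pushf a f u) = \sum_(i | a i) `|u i| ^+ 2.
  rewrite (partition_big f predT) //=; apply: eq_bigr => j _; rewrite /pushf.
  case: (pickP [pred i | a i && (f i == j)]) => [i0 /= /andP[ai0 /eqP fi0]|no].
    have e i : (a i && (f i == j)) = (i == i0).
      apply/andP/eqP => [[ai /eqP fi]|->]; last by rewrite fi0.
      by apply: fI => //; rewrite fi fi0.
    by rewrite !(big_pred1 i0).
  by rewrite !big_pred0 ?normr0 ?expr0n // => i; exact: no.
rewrite /sqnorm [leRHS](bigID a) /= lerDl.
by apply: sumr_ge0 => i _; rewrite exprn_ge0.
Qed.

(** Compressing a matrix along partial injections of the row and of the column
    indices does not increase its norm. *)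
Lemma op_le_compress I J c (a b : pred J) (f g : J -> I) (y : I -> I -> C) :
  0 <= c -> {in a &, injective f} -> {in b &, injective g} -> op_le c y ->
  op_le c (fun i j => if a i && b j then y (f i) (g j) else 0).
Proof.
move=> c0 fI gI h u v.
have -> : bform (fun i j => if a i && b j then y (f i) (g j) else 0) u v
    = bform y (pushf b g u) (pushf a f v).
  rewrite /bform.
  transitivity (\sum_(i | a i) \sum_(j | b j) y (f i) (g j) * u j * v i).
    rewrite [RHS]big_mkcond; apply: eq_bigr => i _; case: ifP => ai.
      rewrite [RHS]big_mkcond; apply: eq_bigr => j _.
      by rewrite /=; case: ifP; rewrite ?mul0r.
    by apply: big1 => j _; rewrite !mul0r.
  rewrite (partition_big f predT) //=; apply: eq_bigr => i _.
  under [RHS]eq_bigr => j _ do rewrite /pushf mulr_sumr.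
  rewrite [RHS]exchange_big /=; apply: eq_bigr => i' /andP[_ /eqP fi'].
  rewrite (partition_big g predT) //=; apply: eq_bigr => j _.
  rewrite mulr_sumr mulr_suml; apply: eq_bigr => j' /andP[_ /eqP gj'].
  by rewrite fi' gj'.
apply: le_trans (h _ _) _; apply: ler_wpM2l => //.
by apply: lerD; exact: sqnorm_pushf.
Qed.

Lemma op_le_reindex I J c (f : J -> I) (y : I -> I -> C) :
  0 <= c -> injective f -> op_le c y -> op_le c (fun i j => y (f i) (f j)).
Proof.
move=> c0 fI h; apply: (op_le_compress (a := predT) (b := predT) c0 _ _ h);
  by move=> i j _ _; apply: fI.
Qed.

(** * Completely bounded maps between matrix algebras *)

(** [c] bounds the maps [Phi (x) id] simultaneously for all matrix algebras in
    the second factor. The bounds of two such maps multiply to a bound of their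
    tensor product, which fails for the norms of the maps themselves. *)
Definition cbounded I J (c : C) (Phi : (I -> I -> C) -> (J -> J -> C)) : Prop :=
  forall T b (y : I * T -> I * T -> C), 0 <= b -> op_le b y ->
    op_le (c * b)
      (fun p q => Phi (fun i j => y (i, p.2) (j, q.2)) p.1 q.1).

Lemma eq_cbounded I J c (Phi Psi : (I -> I -> C) -> (J -> J -> C)) :
  (forall y i j, Phi y i j = Psi y i j) -> cbounded c Phi -> cbounded c Psi.
Proof. by move=> e h T b y b0 hy; apply: eq_op_le (h T b y b0 hy) => p q. Qed.

Lemma cboundedW I J c c' (Phi : (I -> I -> C) -> (J -> J -> C)) :
  c <= c' -> cbounded c Phi -> cbounded c' Phi.
Proof.
move=> cc' h T b y b0 hy; apply: op_leW (h T b y b0 hy).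
exact: ler_wpM2r.
Qed.

Lemma cboundedD I J c c' (Phi Psi : (I -> I -> C) -> (J -> J -> C)) :
  cbounded c Phi -> cbounded c' Psi ->
  cbounded (c + c') (fun y i j => Phi y i j + Psi y i j).
Proof.
move=> h h' T b y b0 hy; rewrite mulrDl.
exact: op_leD (h _ _ _ b0 hy) (h' _ _ _ b0 hy).
Qed.

Lemma cboundedZ I J c a (Phi : (I -> I -> C) -> (J -> J -> C)) :
  cbounded c Phi -> cbounded (`|a| * c) (fun y i j => a * Phi y i j).
Proof.
move=> h T b y b0 hy; rewrite -mulrA.
exact: op_leZ (h _ _ _ b0 hy).
Qed.

Lemma cbounded_comp I J L c c' (Phi : (I -> I -> C) -> (J -> J -> C))
    (Psi : (J -> J -> C) -> (L -> L -> C)) : 0 <= c ->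
  cbounded c Phi -> cbounded c' Psi -> cbounded (c' * c) (Psi \o Phi).
Proof.
move=> c0 h h' T b y b0 hy; rewrite -mulrA.
exact: (h' _ _ _ (mulr_ge0 c0 b0) (h _ _ _ b0 hy)).
Qed.

Lemma cbounded_sum I J (X : Type) (s : seq X) (P : pred X) (c : X -> C)
    (Phi : X -> (I -> I -> C) -> (J -> J -> C)) :
  (forall x, P x -> cbounded (c x) (Phi x)) ->
  cbounded (\sum_(x <- s | P x) c x)
    (fun y i j => \sum_(x <- s | P x) Phi x y i j).
Proof.
move=> h T b y b0 hy; rewrite mulr_suml.
by apply: op_le_sum => x Px; exact: h.
Qed.

Lemma cbounded_compress I J (a b : pred J) (f g : J -> I) :
  {in a &, injective f} -> {in b &, injective g} ->
  cbounded 1 (fun y i j => if a i && b j then y (f i) (g j) else 0).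
Proof.
move=> fI gI T c y c0 hy; rewrite mul1r.
pose F (f : J -> I) (p : J * T) := (f p.1, p.2).
apply: (op_le_compress (a := [pred p | a p.1]) (b := [pred p | b p.1])
  (f := F f) (g := F g) c0 _ _ hy) => [[i t] [j t']|[i t] [j t']] /=.
  by move=> ai aj [fij ->]; rewrite (fI i j ai aj fij).
by move=> ai aj [fij ->]; rewrite (gI i j ai aj fij).
Qed.

(** Cutting a matrix to one of the rectangles is a compression. *)
Lemma cbounded_three_rect I (S : I -> I -> bool)
    (a1 b1 a2 b2 a3 b3 : pred I) :
  (forall i j, (S i j)%:R = (a1 i && b1 j)%:R + (a2 i && b2 j)%:R
                            - (a3 i && b3 j)%:R :> C) ->
  cbounded 3 (fun y i j => if S i j then y i j else 0).
Proof.
move=> e.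
have rect (a b : pred I) : cbounded 1 (fun y i j => if a i && b j then y i j else 0).
  exact: (@cbounded_compress I I a b id id).
have := cboundedD (cboundedD (rect a1 b1) (rect a2 b2)) (cboundedZ (-1) (rect a3 b3)).
rewrite normrN normr1 mul1r (_ : 1 + 1 + 1 = 3%:R); last by rewrite -(natrD _ 1 1) -(natrD _ 2 1).
apply: eq_cbounded => y i j.
have ifE (x : bool) : (if x then y i j else 0) = x%:R * y i j.
  by case: x; rewrite ?mul1r ?mul0r.
by rewrite !ifE mulN1r e mulrBl mulrDl.
Qed.

Section OneStep.
Variables (A B J : finType) (sp : B -> A * J) (pt : A * J -> B).
Hypotheses (spK : cancel sp pt) (ptK : cancel pt sp).

Definition tensf (x : A -> A -> C) (s : J -> J -> C) (i j : B) : C :=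
  x (sp i).1 (sp j).1 * s (sp i).2 (sp j).2.

Definition slice (o : J -> J -> C) (y : B -> B -> C) (i j : A) : C :=
  \sum_r \sum_r' o r r' * y (pt (i, r)) (pt (j, r')).

Lemma sum_pt (F : B -> C) : \sum_i F i = \sum_i \sum_r F (pt (i, r)).
Proof.
rewrite pair_big /= (reindex pt) /=; last by exists sp => x _.
by apply: eq_bigr => -[].
Qed.

(** Each entry of the two small matrices contributes a compression that moves one
    block of [y] to another position. *)
Lemma cbounded_slice_tensf (o s : J -> J -> C) :
  cbounded ((\sum_r \sum_r' `|o r r'|) * (\sum_r \sum_r' `|s r r'|))
    (fun y => tensf (slice o y) s).
Proof.
set c := _ * _.
have [h cE] : cbounded (\sum_r \sum_r' \sum_p \sum_p' `|o r r' * s p p'| * 1)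
  (fun y i j => \sum_r \sum_r' \sum_p \sum_p' o r r' * s p p' *
     (if ((sp i).2 == p) && ((sp j).2 == p') then
        y (pt ((sp i).1, r)) (pt ((sp j).1, r')) else 0)) /\
  \sum_r \sum_r' \sum_p \sum_p' `|o r r' * s p p'| * 1 = c.
  split.
    do 4! [apply: cbounded_sum => ? _]; apply: cboundedZ.
    apply: (@cbounded_compress B B [pred i | (sp i).2 == _] [pred i | (sp i).2 == _]
       (fun i => pt ((sp i).1, _)) (fun j => pt ((sp j).1, _)));
      by move=> i j /eqP i2 /eqP j2 /(can_inj ptK)[e]; apply: (can_inj spK);
         case: (sp i) (sp j) e i2 j2 => [? ?] [? ?] /= -> -> ->.
  rewrite /c mulr_suml; apply: eq_bigr => r _; rewrite mulr_suml.
  apply: eq_bigr => r' _; rewrite mulr_sumr; apply: eq_bigr => p _.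
  by rewrite mulr_sumr; apply: eq_bigr => p' _; rewrite mulr1 normrM.
rewrite -cE; apply: eq_cbounded h => y i j.
rewrite /tensf /slice mulr_suml; apply: eq_bigr => r _.
rewrite mulr_suml; apply: eq_bigr => r' _.
rewrite (bigD1 (sp i).2) //= (bigD1 (sp j).2) //= !eqxx /= big1 ?addr0.
  rewrite big1 ?addr0; first by rewrite mulrAC.
  move=> p /negbTE np; apply: big1 => p' _.
  by rewrite eq_sym np /= mulr0.
by move=> p /negbTE np; rewrite eq_sym np ?andbF mulr0.
Qed.

(** The constant 1 matters here and in the next lemma: both maps are iterated
    once per level. A block diagonal matrix acts on each block separately. *)
Lemma cbounded_tens1 : cbounded 1 (fun x => tensf x (fun r r' => (r == r')%:R)).
Proof.
move=> T b y b0 hy u v; rewrite mul1r.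
pose cut r (u : B * T -> C) (p : A * T) := u (pt (p.1, r), p.2).
have sumBT (F : B * T -> C) :
    \sum_p F p = \sum_r \sum_(q : A * T) F (pt (q.1, r), q.2).
  transitivity (\sum_b \sum_t F (b, t)).
    by rewrite pair_big; apply: eq_bigr => -[].
  rewrite sum_pt exchange_big.
  by apply: eq_bigr => r _; rewrite pair_big.
have sqE w : sqnorm w = \sum_r sqnorm (cut r w) by rewrite /sqnorm sumBT.
rewrite !sqE -big_split mulr_sumr.
set f := bform _ _ _.
have -> : f = \sum_r bform y (cut r u) (cut r v).
  rewrite /f /bform sumBT; apply: eq_bigr => r _; apply: eq_bigr => p _.
  rewrite sumBT (bigD1 r) //= [X in _ + X]big1 ?addr0.
    by apply: eq_bigr => -[j t] _ /=; rewrite /tensf !ptK /= eqxx mulr1 -!surjective_pairing.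
  move=> r' /negbTE nr; apply: big1 => q _.
  by rewrite /tensf !ptK /= eq_sym nr mulr0 !mul0r.
apply: le_trans (_ : \sum_r `|bform y (cut r u) (cut r v)| *+ 2 <= _).
  by rewrite sumrMnl lerMn2r ler_norm_sum.
by apply: ler_sum => r _; exact: hy.
Qed.

(** A convex combination of compressions *)
Lemma cbounded_mean (w : J -> C) : (forall r, 0 <= w r) -> \sum_r w r = 1 ->
  cbounded 1 (slice (fun r r' => w r * (r == r')%:R)).
Proof.
move=> w0 w1.
have h : cbounded (\sum_r `|w r| * 1)
    (fun y (i j : A) => \sum_r w r * (if true && true then y (pt (i, r)) (pt (j, r)) else 0)).
  apply: cbounded_sum => r _; apply: cboundedZ.
  by apply: (@cbounded_compress B A predT predT (fun i => pt (i, r)) (fun i => pt (i, r)));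
    move=> i j _ _ /(can_inj ptK)[].
rewrite (eq_bigr w) ?w1 in h; last by move=> r _; rewrite mulr1 ger0_norm.
apply: eq_cbounded h => y i j; apply: eq_bigr => r _.
rewrite (bigD1 r) //= eqxx mulr1 big1 ?addr0 // => r' /negbTE nr.
by rewrite eq_sym nr mulr0 mul0r.
Qed.

End OneStep.
End OpBound.

(** * From one level to the next *)

Lemma sum_blocks (V : nmodType) (F : nat -> V) B Q N : (N <= Q * B)%N ->
  \sum_(0 <= j < N) F j =
  \sum_(0 <= q < Q) \sum_(0 <= k < minn B (N - B * q)) F (B * q + k)%N.
Proof.
elim: Q N => [|Q ih] N; first by rewrite mul0n leqn0 => /eqP ->; rewrite !big_nil.
rewrite big_nat_recr //= => NB; case: (leqP N (Q * B)) => h.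
  rewrite (_ : N - B * Q = 0)%N; last by rewrite mulnC; apply/eqP; rewrite subn_eq0.
  by rewrite minn0 [X in _ + X]big_nil addr0; exact: ih.
rewrite (big_cat_nat (n := (Q * B)%N)) //=; last exact: ltnW.
rewrite (ih (Q * B)%N) //; congr (_ + _).
  apply: eq_big_nat => q /andP[_ qQ].
  have : (B * q + B <= Q * B)%N by nia.
  move=> e; suff -> : minn B (Q * B - B * q) = minn B (N - B * q) by [].
  by lia.
have -> : minn B (N - B * Q) = (N - Q * B)%N by nia.
rewrite -{1}[(Q * B)%N]add0n big_addn; apply: eq_bigr => k _.
by rewrite addnC mulnC.
Qed.

Definition lev_split n (i : 'I_(2 ^ n.+1)) : 'I_(2 ^ n) * 'I_2 :=
  mxtens_unindex (cast_ord (expnSr 2 n) i).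

Definition lev_join n (p : 'I_(2 ^ n) * 'I_2) : 'I_(2 ^ n.+1) :=
  cast_ord (esym (expnSr 2 n)) (mxtens_index p).

Lemma lev_splitK n : cancel (@lev_split n) (@lev_join n).
Proof. by move=> i; rewrite /lev_split /lev_join mxtens_unindexK cast_ordK. Qed.

Lemma lev_joinK n : cancel (@lev_join n) (@lev_split n).
Proof. by move=> p; rewrite /lev_split /lev_join cast_ordKV mxtens_indexK. Qed.

Lemma kron2E (R : realType) n (x : 'M[R[i]]_(2 ^ n)) (y : 'M[R[i]]_2) i j :
  kron2 x y i j = tensf (@lev_split n) x y i j.
Proof. by rewrite /kron2 castmxE mxE !esymK. Qed.

(* From here on the index arithmetic is used only through these lemmas. *)
Opaque lev_split lev_join.

Lemma kron2_mul (R : realType) n (a c : 'M[R[i]]_(2 ^ n)) (b d : 'M[R[i]]_2) :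
  kron2 a b *m kron2 c d = kron2 (a *m c) (b *m d).
Proof.
apply/matrixP => i j; rewrite kron2E /tensf !mxE.
rewrite (sum_pt (@lev_splitK n) (@lev_joinK n)) mulr_suml; apply: eq_bigr => k _.
rewrite mulr_sumr; apply: eq_bigr => r _.
by rewrite !kron2E /tensf !lev_joinK /= mulrACA.
Qed.

Lemma conjC_realC (R : realType) (x : R) : Num.conj (x%:C) = x%:C :> R[i].
Proof. exact: conjc_real. Qed.

Section Factor.
Variables (R : realType) (s : side) (lam : R).
Hypothesis lam0 : 0 < lam.
Let alpha : R := lam / (lam + 1).
Local Notation C := R[i].

(** * Finite Haar systems and their dual systems *)

Definition wt1 (r : 'I_2) : C := (if r == 0 then alpha else 1 - alpha)%:C.

Fixpoint wt n : 'I_(2 ^ n) -> C :=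
  if n is n'.+1 then fun i => wt (lev_split i).1 * wt1 (lev_split i).2
  else fun=> 1.

(** The weights for which [rho (y x)] (left) or [rho (x y)] (right) is the sum of
    [y i j * x j i * swt w i j]. *)
Definition swt I (w : I -> C) (i j : I) : C :=
  match s with Left => w i | Right => w j end.

Definition pairing (I : finType) (w : I -> C) (y x : I -> I -> C) : C :=
  \sum_i \sum_j y i j * x j i * swt w i j.

Let alpha01 : 0 < alpha < 1.
Proof.
have l1 : 0 < lam + 1 by rewrite addr_gt0.
by rewrite /alpha divr_gt0 //= ltr_pdivrMr // mul1r ltrDl.
Qed.

Lemma wt1_gt0 r : 0 < wt1 r.
Proof.
by rewrite /wt1 ltcR; case: ifP => _; case/andP: alpha01 => ? ?; rewrite ?subr_gt0.
Qed.

Lemma sum_wt1 : \sum_r wt1 r = 1.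
Proof. by rewrite big_ord_recl big_ord1 /wt1 /= -rmorphD /= addrC subrK. Qed.

Lemma wt_gt0 n i : 0 < @wt n i.
Proof. by elim: n i => [|n ih] i /=; rewrite ?ltr01 ?mulr_gt0 ?wt1_gt0. Qed.

Lemma swt_gt0 (I : finType) (w : I -> C) i j : (forall i, 0 < w i) -> 0 < swt w i j.
Proof. by rewrite /swt; case: s. Qed.

Lemma swtS n i j : swt (@wt n.+1) i j =
  swt (@wt n) (lev_split i).1 (lev_split j).1
  * swt wt1 (lev_split i).2 (lev_split j).2.
Proof. by rewrite /swt /=; case: s. Qed.

Lemma densityE n i j : density alpha n i j = wt i * (i == j)%:R.
Proof.
elim: n i j => [|n ih] i j; first by rewrite mxE mul1r.
rewrite [density _ _]/= kron2E /tensf ih mxE /=.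
rewrite -(can_eq (@lev_splitK n) i j) /wt1.
case: (lev_split i) (lev_split j) => [i1 i2] [j1 j2] /=; rewrite xpair_eqE.
case: (i1 == j1) => /=; last by rewrite !mulr0 mul0r.
rewrite mulr1 -mulrA; congr (_ * _).
by case: i2 j2 => -[|[|[]]] //= ? [[|[|[]]]] //= ?; rewrite ?mulr1 ?mulr0.
Qed.

Let gen q : 'M[C]_2 := haar_gen s alpha q.

Let rt := Num.sqrt lam.

(* With real entries, the identities below are field identities over R. *)
Let genR (q : nat) (i j : 'I_2) : R :=
  match q with
  | 0 => (i == j)%:R
  | 1 => if i == 0 then (if j == 0 then rt^-1 else 0)
         else (if j == 0 then 0 else - rt)
  | 2 => (i != j)%:R
  | _ => let x := if s is Left then (i, j) else (j, i) in
         if x.1 == 0 then (if x.2 == 0 then 0 else - rt)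
         else (if x.2 == 0 then rt^-1 else 0)
  end.

Let genE q i j : gen q i j = (genR q i j)%:C.
Proof.
have l : alpha / (1 - alpha) = lam.
  rewrite /alpha; field.
  by rewrite addrAC subrr add0r oner_eq0 andbT gt_eqF ?addr_gt0.
rewrite /gen /haar_gen l; case: q => [|[|[|q]]]; rewrite ?mxE //=.
  by rewrite rmorph_nat.
- by case: i j => -[|[|[]]] //= ? [[|[|[]]]] //= ?.
by case: s; rewrite !mxE //= conjC_realC.
Qed.

Let rt0 : rt != 0. Proof. by rewrite sqrtr_eq0 -ltNge. Qed.
Let rt2 : rt ^+ 2 = lam. Proof. by rewrite sqr_sqrtr // ltW. Qed.

(** The generators are orthonormal for [rho (x^* y)] (left) or [rho (y x^* )]
    (right), so that their transposes are the dual basis: the next two lemmas are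
    the completeness and the orthogonality relations. *)
Lemma gen_complete r r' t t' :
  \sum_(0 <= q < 4) gen q r' r * gen q t' t * swt wt1 r r' = ((r == t) && (r' == t'))%:R.
Proof.
have h : rt ^+ 2 + 1 != 0 by rewrite rt2 gt_eqF ?addr_gt0.
pose w := if (if s is Left then r else r') == 0 then alpha else 1 - alpha.
have -> : swt wt1 r r' = w%:C by rewrite /w /swt /wt1; case: s.
under eq_bigr => q _ do rewrite !genE -!(rmorphM (real_complex R)).
rewrite -rmorph_sum -[RHS](rmorph_nat (real_complex R)); congr (_%:C).
rewrite 3?big_nat_recr // big_nat1 /= {}/w /genR /alpha -rt2.
by case: s; case: r => -[|[|[]]] //= ?; case: r' => -[|[|[]]] //= ?;
  case: t => -[|[|[]]] //= ?; case: t' => -[|[|[]]] //= ?; field; rewrite ?h ?rt0.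
Qed.

Lemma gen_orthonormal p q : (p < 4)%N -> (q < 4)%N ->
  pairing wt1 (fun i j => gen p j i) (gen q) = (p == q)%:R.
Proof.
move=> p4 q4; rewrite /pairing.
have h : rt ^+ 2 + 1 != 0 by rewrite rt2 gt_eqF ?addr_gt0.
pose w (r r' : 'I_2) := if (if s is Left then r else r') == 0 then alpha else 1 - alpha.
have wE r r' : swt wt1 r r' = (w r r')%:C by rewrite /w /swt /wt1; case: s.
under eq_bigr => i _.
  under eq_bigr => j _ do rewrite !genE wE -!(rmorphM (real_complex R)).
  rewrite -rmorph_sum; over.
rewrite -rmorph_sum -[RHS](rmorph_nat (real_complex R)); congr (_%:C).
rewrite !big_ord_recl !big_ord0 /= /w /genR /alpha -rt2.
by case: s; case: p p4 => [|[|[|[|p]]]] // _; case: q q4 => [|[|[|[|q]]]] //= _;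
  field; rewrite ?h ?rt0.
Qed.

(** The dual basis of the matrix units consists of their transposes, divided by
    the weights. *)
Definition dual_unit n (k : nat) (i j : 'I_(2 ^ n)) : C :=
  (shell0 j i == k)%:R / swt (@wt n) i j.

Fixpoint dual_haar n (j : nat) : 'I_(2 ^ n) -> 'I_(2 ^ n) -> C :=
  if n is n'.+1 then
    let q := (j %/ 4 ^ n')%N in
    let k := (j %% 4 ^ n')%N in
    tensf (@lev_split n') (if q == 0%N then @dual_haar n' k else @dual_unit n' k)
      (fun r r' => haar_gen s alpha q r' r)
  else fun _ _ => 1.

Arguments dual_haar : clear implicits.

Lemma haar_mxS n j : haar_mx s alpha n.+1 j =
  kron2 (if j %/ 4 ^ n == 0 then haar_mx s alpha n (j %% 4 ^ n)
         else shell_unit R _ (j %% 4 ^ n))%N (haar_gen s alpha (j %/ 4 ^ n)%N).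
Proof. by rewrite [LHS]/= kron2_mul mulmx1 mul1mx. Qed.

Lemma haar_mx_lift n j : (j < 4 ^ n)%N ->
  haar_mx s alpha n.+1 j = kron2 (haar_mx s alpha n j) 1%:M.
Proof. by move=> h; rewrite haar_mxS divn_small // modn_small. Qed.

Definition gen_slice n q (y : 'I_(2 ^ n.+1) -> 'I_(2 ^ n.+1) -> C) :=
  slice (@lev_join n)
    (fun r r' => haar_gen s alpha q r' r * swt wt1 r r') y.

Lemma pairing_tensf n (y : 'I_(2 ^ n.+1) -> 'I_(2 ^ n.+1) -> C)
    (x : 'I_(2 ^ n) -> 'I_(2 ^ n) -> C) (g : 'I_2 -> 'I_2 -> C) :
  pairing (@wt n.+1) y (tensf (@lev_split n) x g) =
  pairing (@wt n) (slice (@lev_join n) (fun r r' => g r' r * swt wt1 r r') y) x.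
Proof.
rewrite /pairing (sum_pt (@lev_splitK n) (@lev_joinK n)); apply: eq_bigr => i _.
under eq_bigr => r _ do rewrite (sum_pt (@lev_splitK n) (@lev_joinK n)).
rewrite exchange_big; apply: eq_bigr => j _.
rewrite /slice !mulr_suml; apply: eq_bigr => r _.
rewrite !mulr_suml; apply: eq_bigr => r' _.
rewrite swtS /tensf !lev_joinK /=; ring.
Qed.

Lemma slice_tensf n (o : 'I_2 -> 'I_2 -> C) (a : 'I_(2 ^ n) -> 'I_(2 ^ n) -> C)
    (b : 'I_2 -> 'I_2 -> C) i j :
  slice (@lev_join n) o (tensf (@lev_split n) a b) i j =
  a i j * \sum_r \sum_r' o r r' * b r r'.
Proof.
rewrite /slice mulr_sumr; apply: eq_bigr => r _; rewrite mulr_sumr.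
by apply: eq_bigr => r' _; rewrite /tensf !lev_joinK /= mulrCA.
Qed.

Lemma eq_pairing (I : finType) w (y y' x x' : I -> I -> C) :
  (forall i j, y i j = y' i j) -> (forall i j, x i j = x' i j) ->
  pairing w y x = pairing w y' x'.
Proof.
by move=> ey ex; apply: eq_bigr => i _; apply: eq_bigr => j _; rewrite ey ex.
Qed.

Lemma pairing_tensf2 n (a x : 'I_(2 ^ n) -> 'I_(2 ^ n) -> C)
    (b g : 'I_2 -> 'I_2 -> C) :
  pairing (@wt n.+1) (tensf (@lev_split n) a b) (tensf (@lev_split n) x g) =
  pairing (@wt n) a x * pairing wt1 b g.
Proof.
rewrite pairing_tensf /pairing mulr_suml; apply: eq_bigr => i _.
rewrite mulr_suml; apply: eq_bigr => j _; rewrite slice_tensf.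
rewrite -!mulrA; congr (_ * _); rewrite mulrC -!mulrA; congr (_ * (_ * _)).
by apply: eq_bigr => r _; apply: eq_bigr => r' _; ring.
Qed.

Lemma pairing_unit n (y : 'I_(2 ^ n) -> 'I_(2 ^ n) -> C) (i j : 'I_(2 ^ n)) :
  pairing (@wt n) y (shell_unit R _ (shell0 j i)) = y i j * swt (@wt n) i j.
Proof.
rewrite /pairing (bigD1 i) //= (bigD1 j) //= mxE shell_unitE eqxx mulr1.
rewrite big1 ?addr0 => [|j' /negbTE nj]; last first.
  rewrite mxE shell_unitE; case: eqP => [/shell0_inj[/val_inj e]|_].
    by rewrite e eqxx in nj.
  by rewrite mulr0 mul0r.
rewrite big1 ?addr0 // => i' /negbTE ni; rewrite big1 // => j' _.
rewrite mxE shell_unitE; case: eqP => [/shell0_inj[_ /val_inj e]|_].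
  by rewrite e eqxx in ni.
by rewrite mulr0 mul0r.
Qed.

Lemma swt_neq0 n i j : swt (@wt n) i j != 0.
Proof. by rewrite gt_eqF // swt_gt0 //; exact: wt_gt0. Qed.

Lemma unit_expansion n N (y : 'I_(2 ^ n) -> 'I_(2 ^ n) -> C)
    (i j : 'I_(2 ^ n)) :
  \sum_(0 <= k < N) pairing (@wt n) y (shell_unit R _ k) * dual_unit k i j =
  if (shell0 j i < N)%N then y i j else 0.
Proof.
rewrite big_mkord; case: ifPn => [h|]; last first.
  rewrite -leqNgt => h; apply: big1 => k _; rewrite /dual_unit.
  by rewrite gtn_eqF ?mul0r ?mulr0 // (leq_trans (ltn_ord k)).
rewrite (bigD1 (Ordinal h)) //= pairing_unit /dual_unit eqxx mul1r.
rewrite mulfK ?swt_neq0 // big1 ?addr0 // => k.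
by rewrite -val_eqE /= eq_sym => /negbTE ->; rewrite mul0r mulr0.
Qed.

Definition haar_trunc n N (y : 'I_(2 ^ n) -> 'I_(2 ^ n) -> C) i j : C :=
  \sum_(0 <= k < N) pairing (@wt n) y (haar_mx s alpha n k) * dual_haar n k i j.

Lemma pairing_haar_block n q k (y : 'I_(2 ^ n.+1) -> 'I_(2 ^ n.+1) -> C) :
  (k < 4 ^ n)%N ->
  pairing (@wt n.+1) y (haar_mx s alpha n.+1 (4 ^ n * q + k)) =
  pairing (@wt n) (gen_slice q y)
    (if q == 0 then haar_mx s alpha n k else shell_unit R _ k)%N.
Proof.
move=> k4; rewrite haar_mxS mulnC divnMDl ?expn_gt0 // modnMDl divn_small //.
rewrite modn_small // addn0 /gen_slice -pairing_tensf; apply: eq_pairing => // i j.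
exact: kron2E.
Qed.

Lemma dual_haar_block n q k : (k < 4 ^ n)%N ->
  dual_haar n.+1 (4 ^ n * q + k) =
  tensf (@lev_split n) (if q == 0 then dual_haar n k else @dual_unit n k)%N
    (fun r r' => haar_gen s alpha q r' r).
Proof.
move=> k4; rewrite /= mulnC divnMDl ?expn_gt0 // modnMDl divn_small //.
by rewrite modn_small // addn0.
Qed.

Lemma shell0_lt4 n (i j : 'I_(2 ^ n)) : (shell0 i j < 4 ^ n)%N.
Proof. by rewrite -[4%N]/(2 * 2)%N expnMn shell0_lt_sq !ltn_ord. Qed.

(** The truncation at level [n + 1] treats the four generators separately: it
    truncates the Haar expansion of the conditional expectation to the level
    [n], and cuts the coefficients of the other generators to initial segments
    of the shell enumeration. *)
Lemma haar_truncS n N (y : 'I_(2 ^ n.+1) -> 'I_(2 ^ n.+1) -> C) i j :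
  (N <= 4 * 4 ^ n)%N ->
  haar_trunc N y i j =
  tensf (@lev_split n) (haar_trunc (minn (4 ^ n) N) (gen_slice 0 y))
    (fun r r' => (r == r')%:R) i j +
  \sum_(1 <= q < 4) tensf (@lev_split n)
    (fun i j => if (shell0 j i < N - 4 ^ n * q)%N then gen_slice q y i j else 0)
    (fun r r' => haar_gen s alpha q r' r) i j.
Proof.
move=> N4; rewrite {1}/haar_trunc (sum_blocks _ N4) big_ltn //; congr (_ + _).
  rewrite (_ : N - 4 ^ n * 0 = N)%N; last by rewrite muln0 subn0.
  rewrite /tensf /haar_trunc mulr_suml.
  apply: eq_big_nat => k /andP[_]; rewrite leq_min => /andP[k4 _].
  rewrite pairing_haar_block // dual_haar_block // /tensf mulrA !mxE.
  by rewrite [_ == (lev_split i).2]eq_sym.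
apply: eq_big_nat => q /andP[q1 _].
have q0 : (q == 0)%N = false by case: q q1.
rewrite /tensf (_ : (shell0 _ _ < _)%N =
  (shell0 (lev_split j).1 (lev_split i).1 < minn (4 ^ n) (N - 4 ^ n * q))%N).
  rewrite -unit_expansion mulr_suml.
  apply: eq_big_nat => k /andP[_]; rewrite leq_min => /andP[k4 _].
  by rewrite pairing_haar_block // dual_haar_block // /tensf mulrA q0.
by rewrite leq_min shell0_lt4.
Qed.

(** At each level this is the completeness of the four generators. *)
Lemma haar_trunc_full n (y : 'I_(2 ^ n) -> 'I_(2 ^ n) -> C) i j :
  haar_trunc (4 ^ n) y i j = y i j.
Proof.
elim: n y i j => [|n ih] y i j.
  have one (a b : 'I_(2 ^ 0)) : a = b.
    by apply/val_inj; case: a b => -[|[]] // ? [[|[]]].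
  have sum1 (F : 'I_(2 ^ 0) -> C) (a : 'I_(2 ^ 0)) : \sum_b F b = F a.
    by rewrite (bigD1 a) //= big1 ?addr0 // => b; rewrite (one b a) eqxx.
  rewrite /haar_trunc big_nat1 mulr1 /pairing (sum1 _ i) (sum1 _ j) mxE.
  by rewrite (one j i) eqxx mulr1 /swt; case: s; rewrite mulr1.
have e4 : minn (4 ^ n) (4 * 4 ^ n) = (4 ^ n)%N by apply/minn_idPl; rewrite leq_pmull.
rewrite [(4 ^ n.+1)%N]expnS haar_truncS // e4 {1}/tensf ih.
have -> : \sum_(1 <= q < 4) tensf (@lev_split n)
    (fun i j => if (shell0 j i < 4 * 4 ^ n - 4 ^ n * q)%N
                then gen_slice q y i j else 0)
    (fun r r' => haar_gen s alpha q r' r) i j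
  = \sum_(1 <= q < 4) tensf (@lev_split n) (gen_slice q y)
    (fun r r' => haar_gen s alpha q r' r) i j.
  apply: eq_big_nat => q /andP[_ q4]; rewrite /tensf ifT //.
  by apply: leq_trans (shell0_lt4 _ _) _; nia.
transitivity (\sum_(0 <= q < 4) tensf (@lev_split n) (gen_slice q y)
    (fun r r' => haar_gen s alpha q r' r) i j).
  rewrite [RHS]big_ltn // /tensf; congr (_ * _ + _).
  by rewrite mxE eq_sym.
rewrite /tensf /gen_slice /slice.
under eq_bigr => q _.
  rewrite mulr_suml; under eq_bigr => r _ do rewrite mulr_suml.
  over.
rewrite exchange_big (bigD1 (lev_split i).2) //= [X in _ + X]big1 ?addr0.
  rewrite exchange_big (bigD1 (lev_split j).2) //= [X in _ + X]big1 ?addr0.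
    transitivity ((\sum_(0 <= q < 4) gen q (lev_split j).2 (lev_split i).2
        * gen q (lev_split j).2 (lev_split i).2 *
        swt wt1 (lev_split i).2 (lev_split j).2) * y i j).
      rewrite mulr_suml; apply: eq_bigr => q _.
      by rewrite -!surjective_pairing !lev_splitK /gen; ring.
    by rewrite gen_complete !eqxx mul1r.
  move=> r' /negbTE nr.
  transitivity ((\sum_(0 <= q < 4) gen q r' (lev_split i).2
        * gen q (lev_split j).2 (lev_split i).2 *
        swt wt1 (lev_split i).2 r')
      * y (lev_join ((lev_split i).1, (lev_split i).2)) (lev_join ((lev_split j).1, r'))).
    by rewrite mulr_suml; apply: eq_bigr => q _; rewrite /gen; ring.
  by rewrite gen_complete nr andbF mul0r.
move=> r /negbTE nr; rewrite exchange_big big1 // => r' _.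
transitivity ((\sum_(0 <= q < 4) gen q r' r
        * gen q (lev_split j).2 (lev_split i).2 * swt wt1 r r')
      * y (lev_join ((lev_split i).1, r)) (lev_join ((lev_split j).1, r'))).
  by rewrite mulr_suml; apply: eq_bigr => q _; rewrite /gen; ring.
by rewrite gen_complete nr mul0r.
Qed.

Lemma dual_haar_pairing n j k : (j < 4 ^ n)%N -> (k < 4 ^ n)%N ->
  pairing (@wt n) (dual_haar n j) (haar_mx s alpha n k) = (j == k)%:R.
Proof.
elim: n j k => [|n ih] j k.
  rewrite expn0 !ltnS !leqn0 => /eqP-> /eqP->.
  have := @haar_trunc_full 0 (fun _ _ => 1) ord0 ord0.
  by rewrite /haar_trunc expn0 big_nat1 mulr1.
have split4 m : (m < 4 ^ n.+1)%N -> exists q l, [/\ m = 4 ^ n * q + l, q < 4 & l < 4 ^ n]%N.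
  move=> h; exists (m %/ 4 ^ n)%N, (m %% 4 ^ n)%N.
  by rewrite mulnC -divn_eq ltn_divLR ?expn_gt0 // -expnS ltn_mod ?expn_gt0.
move=> /split4[q [l [-> q4 l4]]] /split4[q' [l' [-> q4' l4']]].
rewrite dual_haar_block // haar_mxS [(4 ^ n * q')%N]mulnC divnMDl ?expn_gt0 //.
rewrite modnMDl divn_small // modn_small // addn0 
  (@eq_pairing _ _ _ _ _ _ (fun _ _ => erefl _) (kron2E _ _)).
rewrite pairing_tensf2 gen_orthonormal //.
have -> : (4 ^ n * q + l == q' * 4 ^ n + l')%N = (q == q') && (l == l').
  apply/eqP/andP => [e|[/eqP -> /eqP ->]]; last by rewrite mulnC.
  have := congr1 (divn^~ (4 ^ n)%N) e; rewrite mulnC !divnMDl ?expn_gt0 //.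
  rewrite !divn_small // !addn0 => eq; split; first exact/eqP.
  by move: e; rewrite eq mulnC => /addnI ->.
case: (q =P q') => [<-|_]; last by rewrite mulr0.
rewrite mulr1 /=; case: (q == 0)%N; first exact: ih.
have [ab abE] := shell0_surj l'; move/eqP: abE l4' => <-.
rewrite -[4%N]/(2 * 2)%N expnMn shell0_lt_sq => /andP[a2 b2].
rewrite (@pairing_unit n _ (Ordinal b2) (Ordinal a2)) /dual_unit /=.
by rewrite divfK ?swt_neq0 // eq_sym.
Qed.

(** As long as [N] is at most [4 ^ n], the recursion reduces to the first summand,
    which has the bound of the previous level. As soon as [N] exceeds [4 ^ n], the
    first summand is a conditional expectation, and the bound is that of the four
    summands, whatever the level. *)
Lemma haar_trunc_cbounded : exists2 c : C, 0 <= c &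
  forall n N, (N <= 4 ^ n)%N -> cbounded c (@haar_trunc n N).
Proof.
pose k q : C := (\sum_r \sum_r' `|haar_gen s alpha q r' r * swt wt1 r r'|) *
  (\sum_r \sum_r' `|haar_gen s alpha q r' r|).
exists (1 + \sum_(1 <= q < 4) 3 * k q).
  rewrite addr_ge0 // sumr_ge0 // => q _; rewrite mulr_ge0 //.
  by rewrite mulr_ge0 //; apply: sumr_ge0 => r _; apply: sumr_ge0.
have s0 : 0 <= \sum_(1 <= q < 4) 3 * k q.
  rewrite sumr_ge0 // => q _; rewrite mulr_ge0 //.
  by rewrite mulr_ge0 //; apply: sumr_ge0 => r _; apply: sumr_ge0.
elim=> [|n ih] N.
  rewrite expn0 leq_eqVlt ltnS leqn0 => /orP[]/eqP ->.
    apply: (cboundedW (c := 1)); first by rewrite lerDl.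
    move=> T b y b0; rewrite mul1r; apply: eq_op_le => -[i t] [j t'] /=.
    by rewrite (@haar_trunc_full 0).
  apply: (cboundedW (c := 0)); first by rewrite addr_ge0.
  move=> T b y b0 _; rewrite mul0r; apply: eq_op_le (@op_le0 _ _) => p q.
  by rewrite /haar_trunc big_nil.
rewrite expnS => N4.
have mean : cbounded 1 (@gen_slice n 0).
  have := cbounded_mean (@lev_joinK n) (fun r => ltW (wt1_gt0 r)) sum_wt1.
  apply: eq_cbounded => y i j; rewrite /gen_slice /slice.
  apply: eq_bigr => r _; apply: eq_bigr => r' _; congr (_ * _).
  rewrite mxE [r' == r]eq_sym [LHS]mulrC; case: eqP => [->|_]; last by rewrite !mul0r.
  by rewrite /swt; case: s.
have tens1 := cbounded_tens1 (C := C) (@lev_splitK n) (@lev_joinK n).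
case: (leqP N (4 ^ n)) => h.
  have := cbounded_comp _ (cbounded_comp _ mean (ih N h)) tens1.
  rewrite mulr1 mul1r; move/(_ _ ler01); rewrite !addr_ge0 // => /(_ isT).
  apply: eq_cbounded => y i j; rewrite haar_truncS //.
  rewrite (minn_idPr _) // big1_seq ?addr0 // => q /andP[_].
  rewrite mem_index_iota => /andP[q1 _]; rewrite /tensf.
  by rewrite (_ : N - 4 ^ n * q = 0)%N ?mul0r //; nia.
have h1 := cbounded_comp ler01 mean tens1; rewrite mulr1 in h1.
have : cbounded (1 + \sum_(1 <= q < 4) 3 * k q) (fun y i j =>
   tensf (@lev_split n) (gen_slice 0 y) (fun r r' => (r == r')%:R) i j +
   \sum_(1 <= q < 4)
     (if (shell0 (lev_split j).1 (lev_split i).1 < N - 4 ^ n * q)%N then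
     tensf (@lev_split n) (gen_slice q y) (fun r r' => haar_gen s alpha q r' r) i j else 0)).
  apply: cboundedD h1 _; apply: cbounded_sum => q _.
  have [p1 [q1 [p2 [q2 [p3 [q3 e]]]]]] := shell0_lt_rectR C (N - 4 ^ n * q).
  have cut := cbounded_three_rect (C := C)
    (S := fun i j : 'I_(2 ^ n.+1) => (shell0 (lev_split j).1 (lev_split i).1 < N - 4 ^ n * q)%N)
    (a1 := fun i => ((lev_split i).1 < q1)%N) (b1 := fun i => ((lev_split i).1 < p1)%N)
    (a2 := fun i => ((lev_split i).1 < q2)%N) (b2 := fun i => ((lev_split i).1 < p2)%N)
    (a3 := fun i => ((lev_split i).1 < q3)%N) (b3 := fun i => ((lev_split i).1 < p3)%N).
  have sl := cbounded_slice_tensf (@lev_splitK n) (@lev_joinK n)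
    (fun r r' => haar_gen s alpha q r' r * swt wt1 r r') (fun r r' => haar_gen s alpha q r' r).
  apply: (cbounded_comp _ sl (cut _)).
    by rewrite mulr_ge0 //; apply: sumr_ge0 => r _; apply: sumr_ge0.
  by move=> i j; rewrite e ![(_ && (_ < q1))%N]andbC ![(_ && (_ < q2))%N]andbC ![(_ && (_ < q3))%N]andbC.
apply: eq_cbounded => y i j; rewrite haar_truncS // (minn_idPl _) 1?ltnW //.
congr (_ + _); first by rewrite /tensf haar_trunc_full.
by apply: eq_bigr => q _; rewrite {2}/tensf; case: ifP => // _; rewrite mul0r.
Qed.

End Factor.
Arguments dual_haar {R} s lam n j.

(** * Haar systems on tensor products *)

Section Product.
Variables (R : realType) (s : side).
Local Notation C := R[i].

Definition prodf (I1 I2 : finType) (a : I1 -> I1 -> C) (b : I2 -> I2 -> C)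
  (p q : I1 * I2) : C := a p.1 q.1 * b p.2 q.2.

Definition prodw (I1 I2 : finType) (w1 : I1 -> C) (w2 : I2 -> C) (p : I1 * I2) : C :=
  w1 p.1 * w2 p.2.

Lemma swt_prodw (I1 I2 : finType) (w1 : I1 -> C) (w2 : I2 -> C) p q :
  swt s (prodw w1 w2) p q = swt s w1 p.1 q.1 * swt s w2 p.2 q.2.
Proof. by rewrite /swt /prodw; case: s. Qed.

Lemma pairing_prodf (I1 I2 : finType) (w1 : I1 -> C) (w2 : I2 -> C) y x1 x2 :
  pairing s (prodw w1 w2) y (prodf x1 x2) =
  pairing s w1 (fun i j => pairing s w2 (fun a b => y (i, a) (j, b)) x2) x1.
Proof.
rewrite /pairing; transitivity (\sum_i \sum_a \sum_j \sum_b
  y (i, a) (j, b) * (x1 j i * x2 b a) * (swt s w1 i j * swt s w2 a b)).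
  rewrite [RHS]pair_bigA; apply: eq_bigr => -[i a] _ /=; rewrite [RHS]pair_bigA.
  by apply: eq_bigr => -[j b] _; rewrite swt_prodw.
apply: eq_bigr => i _; rewrite exchange_big; apply: eq_bigr => j _.
rewrite !mulr_suml; apply: eq_bigr => a _; rewrite !mulr_suml.
by apply: eq_bigr => b _; ring.
Qed.

Lemma pairing_prodf2 (I1 I2 : finType) (w1 : I1 -> C) (w2 : I2 -> C) a b x1 x2 :
  pairing s (prodw w1 w2) (prodf a b) (prodf x1 x2) =
  pairing s w1 a x1 * pairing s w2 b x2.
Proof.
rewrite pairing_prodf /pairing mulr_suml; apply: eq_bigr => i _.
rewrite mulr_suml; apply: eq_bigr => j _; rewrite /prodf /=.
rewrite -!mulrA; rewrite mulr_suml mulr_sumr mulr_sumr mulr_sumr.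
apply: eq_bigr => k _; rewrite mulr_suml mulr_sumr mulr_sumr mulr_sumr.
by apply: eq_bigr => l _; ring.
Qed.

Lemma pairing_sum (I : finType) (w : I -> C) (X : Type) (r : seq X) (F : X -> I -> I -> C)
    (c : X -> C) x :
  pairing s w (fun i j => \sum_(k <- r) c k * F k i j) x =
  \sum_(k <- r) c k * pairing s w (F k) x.
Proof.
under [RHS]eq_bigr => k _ do rewrite mulr_sumr.
rewrite exchange_big; apply: eq_bigr => i _.
under [RHS]eq_bigr => k _ do rewrite mulr_sumr.
rewrite exchange_big; apply: eq_bigr => j _.
by rewrite !mulr_suml; apply: eq_bigr => k _; rewrite !mulrA.
Qed.

(** The pairing with a matrix unit [y] reads off an entry of [x]; the assumption
    expands [y]. *)
Lemma expansion_transpose (I : finType) (w : I -> C) (N : nat)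
    (h d : nat -> I -> I -> C) : (forall i, 0 < w i) ->
  (forall y i j, \sum_(0 <= k < N) pairing s w y (h k) * d k i j = y i j) ->
  forall x i j, \sum_(0 <= k < N) pairing s w (d k) x * h k i j = x i j.
Proof.
move=> w0 e x b a; pose y i j : C := ((i == a) && (j == b))%:R.
have yE x' : pairing s w y x' = x' b a * swt s w a b.
  rewrite /pairing (bigD1 a) //= (bigD1 b) //= /y !eqxx mul1r.
  rewrite [X in _ + X + _]big1 => [|j /negbTE ->]; last by rewrite andbF !mul0r.
  rewrite big1 ?addr0 // => i /negbTE ni; rewrite big1 // => j _.
  by rewrite ni !mul0r.
have sw0 : swt s w a b != 0 by rewrite gt_eqF // swt_gt0.
apply: (mulIf sw0); rewrite -yE -(eq_pairing _ _ (e y) (fun _ _ => erefl)).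
rewrite pairing_sum mulr_suml; apply: eq_bigr => k _.
by rewrite yE; ring.
Qed.

Variables (lam1 lam2 : R).
Hypotheses (lam10 : 0 < lam1) (lam20 : 0 < lam2).
Let alpha1 := lam1 / (lam1 + 1).
Let alpha2 := lam2 / (lam2 + 1).
Local Notation K n := ('I_(2 ^ n) * 'I_(2 ^ n))%type.

Definition wtK n : K n -> C := prodw (@wt R lam1 n) (@wt R lam2 n).

Definition zmx n (N : nat) : K n -> K n -> C :=
  prodf (haar_mx s alpha1 n (unshell N).1) (haar_mx s alpha2 n (unshell N).2).

Definition dual_zmx n (N : nat) : K n -> K n -> C :=
  prodf (dual_haar s lam1 n (unshell N).1) (dual_haar s lam2 n (unshell N).2).

Arguments zmx : clear implicits.
Arguments dual_zmx : clear implicits.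

Definition prod_trunc n N (y : K n -> K n -> C) p q : C :=
  \sum_(0 <= k < N) pairing s (@wtK n) y (zmx n k) * dual_zmx n k p q.

Lemma wtK_gt0 n p : 0 < @wtK n p.
Proof. by rewrite mulr_gt0 ?wt_gt0. Qed.

Lemma unshell_lt n N : (N < 4 ^ n * 4 ^ n)%N ->
  ((unshell N).1 < 4 ^ n /\ (unshell N).2 < 4 ^ n)%N.
Proof. by move=> h; apply/andP; rewrite -shell0_lt_sq unshellK. Qed.

Lemma dual_zmx_pairing n j k : (j < 4 ^ n * 4 ^ n)%N -> (k < 4 ^ n * 4 ^ n)%N ->
  pairing s (@wtK n) (dual_zmx n j) (zmx n k) = (j == k)%:R.
Proof.
move=> /unshell_lt[j1 j2] /unshell_lt[k1 k2].
rewrite pairing_prodf2 !dual_haar_pairing // -natrM mulnb; congr (_%:R : C).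
rewrite -[in RHS](unshellK j) -[in RHS](unshellK k).
case: (unshell j) (unshell k) => a b [a' b'] /=.
by apply: congr1; apply/andP/eqP => [[/eqP -> /eqP ->] //|/shell0_inj[-> ->]].
Qed.

Let trunc1 n p (y : K n -> K n -> C) (i j : K n) : C :=
  haar_trunc s lam1 p (fun a b => y (a, i.2) (b, j.2)) i.1 j.1.

Let trunc2 n q (y : K n -> K n -> C) (i j : K n) : C :=
  haar_trunc s lam2 q (fun a b => y (i.1, a) (j.1, b)) i.2 j.2.

Let trunc12E n p q (y : K n -> K n -> C) i j :
  trunc1 p (trunc2 q y) i j =
  \sum_(0 <= k < p) \sum_(0 <= l < q)
    pairing s (@wtK n) y (prodf (haar_mx s alpha1 n k) (haar_mx s alpha2 n l))
    * prodf (dual_haar s lam1 n k) (dual_haar s lam2 n l) i j.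
Proof.
apply: eq_bigr => k _.
transitivity (pairing s (@wt R lam1 n) (fun a b => \sum_(0 <= l < q)
    dual_haar s lam2 n l i.2 j.2 *
    pairing s (@wt R lam2 n) (fun a' b' => y (a, a') (b, b')) (haar_mx s alpha2 n l))
  (haar_mx s alpha1 n k) * dual_haar s lam1 n k i.1 j.1).
  congr (_ * _); apply: eq_pairing => // a b.
  by apply: eq_bigr => l _; rewrite mulrC.
rewrite pairing_sum mulr_suml; apply: eq_bigr => l _.
by rewrite pairing_prodf /prodf; ring.
Qed.

(** The index set of the truncation is a signed sum of three rectangles, and on a
    rectangle it is the tensor product of two truncations, bounded because these
    are completely bounded. *)
Lemma prod_trunc_cbounded : exists2 c : C, 0 <= c & forall n N b y,
  (N <= 4 ^ n * 4 ^ n)%N -> 0 <= b -> op_le b y -> op_le (c * b) (@prod_trunc n N y).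
Proof.
have [c1 c10 h1] := haar_trunc_cbounded s lam10.
have [c2 c20 h2] := haar_trunc_cbounded s lam20.
exists (c1 * c2 + c1 * c2 + c1 * c2); first by rewrite !addr_ge0 ?mulr_ge0.
move=> n N b y N4 b0 hy.
have bnd p q : (p <= 4 ^ n)%N -> (q <= 4 ^ n)%N -> op_le (c1 * c2 * b) (trunc1 p (trunc2 q y)).
  move=> p4 q4; rewrite -mulrA; apply: h1 => //; first by rewrite mulr_ge0.
  have swI : injective (fun p : K n => (p.2, p.1)) by move=> [? ?] [? ?] [-> ->].
  have := h2 n q q4 _ _ _ b0 (op_le_reindex b0 swI hy).
  by move/(op_le_reindex (mulr_ge0 c20 b0) swI); apply: eq_op_le => -[i i'] [j j'].
have [p1 [q1 [p2 [q2 [p3 [q3 e]]]]]] := shell0_lt_rectR C N.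
pose m p := minn p (4 ^ n).
have m4 p : (m p <= 4 ^ n)%N by exact: geq_minr.
have := op_leD (op_leD (bnd _ _ (m4 p1) (m4 q1)) (bnd _ _ (m4 p2) (m4 q2)))
  (op_leZ (-1) (bnd _ _ (m4 p3) (m4 q3))).
rewrite normrN normr1 mul1r -!mulrDl; apply: eq_op_le => i j.
pose G k l := pairing s (@wtK n) y (prodf (haar_mx s alpha1 n k) (haar_mx s alpha2 n l))
   * prodf (dual_haar s lam1 n k) (dual_haar s lam2 n l) i j.
have GE p q : trunc1 p (trunc2 q y) i j = \sum_(0 <= k < p) \sum_(0 <= l < q) G k l.
  exact: trunc12E.
transitivity (\sum_(k < N) G (unshell k).1 (unshell k).2); last first.
  by rewrite /prod_trunc big_mkord.
rewrite (sum_unshell G N4) !GE.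
have rect p q : \sum_(0 <= k < m p) \sum_(0 <= l < m q) G k l =
   \sum_(k < 4 ^ n) \sum_(l < 4 ^ n) ((k < p) && (l < q))%N%:R * G k l.
  have cut (F : nat -> C) a : \sum_(0 <= k < m a) F k = \sum_(k < 4 ^ n) (k < a)%N%:R * F k.
    rewrite big_mkord (big_ord_widen _ _ (m4 a)) big_mkcond; apply: eq_bigr => k _.
    by rewrite leq_min ltn_ord andbT; case: ltnP; rewrite ?mul1r ?mul0r.
  rewrite cut; apply: eq_bigr => k _; rewrite cut mulr_sumr.
  by apply: eq_bigr => l _; rewrite mulrA -natrM mulnb.
rewrite !rect mulN1r -big_split -sumrB; apply: eq_bigr => k _.
rewrite -big_split -sumrB; apply: eq_bigr => l _ /=.
by rewrite -mulrDl -mulrBl -e; case: ltnP; rewrite ?mul1r ?mul0r.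
Qed.

Lemma prod_trunc_full n (y : K n -> K n -> C) i j :
  prod_trunc (4 ^ n * 4 ^ n) y i j = y i j.
Proof.
transitivity (trunc1 (4 ^ n) (trunc2 (4 ^ n) y) i j); last first.
  by rewrite /trunc1 haar_trunc_full // /trunc2 haar_trunc_full //; case: i j => ? ? [].
pose G k l := pairing s (@wtK n) y (prodf (haar_mx s alpha1 n k) (haar_mx s alpha2 n l))
   * prodf (dual_haar s lam1 n k) (dual_haar s lam2 n l) i j.
rewrite trunc12E big_mkord.
transitivity (\sum_(k < 4 ^ n * 4 ^ n) G (unshell k).1 (unshell k).2).
  by rewrite /prod_trunc big_mkord.
rewrite (sum_unshell G (leqnn _)).
apply: eq_bigr => k _; rewrite big_mkord; apply: eq_bigr => l _.
by rewrite shell0_lt_sq !ltn_ord.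
Qed.

Lemma zmx_expansion n (x : K n -> K n -> C) i j :
  \sum_(0 <= k < 4 ^ n * 4 ^ n) pairing s (@wtK n) (dual_zmx n k) x * zmx n k i j = x i j.
Proof.
apply: (@expansion_transpose _ _ (4 ^ n * 4 ^ n)) => [p|y a b]; first exact: wtK_gt0.
exact: prod_trunc_full.
Qed.

End Product.
Arguments zmx {R} s lam1 lam2 n N.
Arguments dual_zmx {R} s lam1 lam2 n N.

(** * Bounded operators on Hilbert spaces *)

Section LinearFunctions.
Variables (A : nzRingType) (U V : lmodType A) (F : U -> V).
Hypothesis F_lin : linear F.

Lemma lin0 : F 0 = 0.
Proof.
have := F_lin 1 0 0; rewrite !scale1r addr0 => h.
by apply: (addrI (F 0)); rewrite -h addr0.
Qed.

Lemma linD u v : F (u + v) = F u + F v.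
Proof. by have := F_lin 1 u v; rewrite !scale1r. Qed.

Lemma linZ a u : F (a *: u) = a *: F u.
Proof. by have := F_lin a u 0; rewrite lin0 !addr0. Qed.

Lemma linB u v : F (u - v) = F u - F v.
Proof. by rewrite linD -scaleN1r linZ scaleN1r. Qed.

Lemma lin_sum (X : Type) (r : seq X) (P : pred X) (f : X -> U) :
  F (\sum_(x <- r | P x) f x) = \sum_(x <- r | P x) F (f x).
Proof.
elim: r => [|x r ih]; first by rewrite !big_nil lin0.
by rewrite !big_cons; case: ifP => // _; rewrite linD ih.
Qed.
End LinearFunctions.

Section HilbertBasics.
Variable R : realType.
Local Notation C := R[i].

Lemma conjCM (x y : C) : Num.conj (x * y) = Num.conj x * Num.conj y.
Proof. exact: rmorphM. Qed.

Lemma conjCn n : Num.conj (n%:R : C) = n%:R.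
Proof. exact: rmorph_nat. Qed.

Lemma small_eq0 (x M : C) : 0 <= x -> 0 <= M ->
  (forall e, 0 < e -> x <= M * e) -> x = 0.
Proof.
move=> x0 M0 h; apply/eqP/contraT => xN0.
have xp : 0 < x by rewrite lt_def xN0.
have M1 : 0 < M + 1 by rewrite ltr_wpDl.
have := h (x / (M + 1)); rewrite divr_gt0 // => /(_ isT).
rewrite mulrA ler_pdivlMr // [M * x]mulrC ler_pM2l // gerDl.
by rewrite ler10.
Qed.

Lemma dense_near (V : normedModType C) (D : set V) : dense D ->
  forall u (e : C), 0 < e -> exists2 v, D v & `|u - v| < e.
Proof.
move=> dD u e e0; have [|v [uv Dv]] := dD (ball u e) _ (ball_open _ _).
  by exists u; exact: ballxx.
by exists v => //; move: uv; rewrite -ball_normE.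
Qed.

Lemma near_dense (V : normedModType C) (D : set V) :
  (forall u (e : C), 0 < e -> exists2 v, D v & `|u - v| < e) -> dense D.
Proof.
move=> h O [u Ou] oO.
have /nbhs_ballP[e /= e0 eO] : nbhs u O by exact: open_nbhs_nbhs.
have [v Dv uv] := h u e e0; exists v; split => //; apply: eO.
by rewrite -ball_normE.
Qed.

Variable H : hilbertType C.
Implicit Types u v w : H.

Lemma innerC u v : inner u v = Num.conj (inner v u) :> C.
Proof. by rewrite hermC expr0 mul1r. Qed.

Lemma innerDl u v w : inner (u + v) w = inner u w + inner v w :> C.
Proof. by rewrite linearDl. Qed.

Lemma innerZl a u w : inner (a *: u) w = a * inner u w :> C.
Proof. by rewrite linearZl_LR. Qed.

Lemma innerBl u v w : inner (u - v) w = inner u w - inner v w :> C.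
Proof. by rewrite linearBl. Qed.

Lemma inner0l w : inner 0 w = 0 :> C.
Proof. by rewrite linear0l. Qed.

Lemma innerZr a u w : inner u (a *: w) = Num.conj a * inner u w :> C.
Proof. by rewrite linearZr. Qed.

Lemma innerBr u v w : inner u (v - w) = inner u v - inner u w :> C.
Proof. by rewrite linearBr. Qed.

Lemma inner_suml (X : Type) (r : seq X) (f : X -> H) w :
  inner (\sum_(x <- r) f x) w = \sum_(x <- r) inner (f x) w :> C.
Proof.
elim: r => [|x r ih]; first by rewrite !big_nil inner0l.
by rewrite !big_cons innerDl ih.
Qed.

Lemma inner_amgm u v : `|inner u v : C| *+ 2 <= `|u| ^+ 2 + `|v| ^+ 2.
Proof.
set z := inner u v : C.
have [->|z0] := eqVneq z 0.
  by rewrite normr0 mul0rn addr_ge0 // exprn_ge0.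
have nz : `|z| != 0 by rewrite normr_eq0.
(* the phase that makes <u, a v> nonnegative *)
pose a := z / `|z|.
have na : `|a| = 1 by rewrite normrM normfV normr_id divff.
have : 0 <= `|u - a *: v| ^+ 2 by rewrite exprn_ge0.
rewrite sqr_norm_inner innerBl !innerBr !innerZl !innerZr -!sqr_norm_inner.
rewrite (innerC v u) -/z [a * (_ * _)]mulrA -normCK na expr1n mul1r.
have e1 : Num.conj a * z = `|z|.
  by rewrite /a rmorphM fmorphV /= (conj_Creal (normr_real _)) mulrAC -normCKC expr2 mulfK.
have e2 : a * Num.conj z = `|z|.
  by rewrite /a mulrAC -normCK expr2 mulfK.
rewrite e1 e2 => h; rewrite -subr_ge0; apply: le_trans h _; rewrite le_eqVlt.
by apply/orP; left; apply/eqP; ring.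
Qed.

Lemma cauchy_schwarz u v : `|inner u v : C| <= `|u| * `|v|.
Proof.
have [->|u0] := eqVneq u 0; first by rewrite inner0l normr0 mulr_ge0.
have [->|v0] := eqVneq v 0.
  by rewrite innerC inner0l rmorph0 normr0 mulr_ge0.
have nu : 0 < `|u| by rewrite normr_gt0.
have nv : 0 < `|v| by rewrite normr_gt0.
have := inner_amgm (`|u|^-1 *: u) (`|v|^-1 *: v).
rewrite innerZl innerZr !normrZ !normrM norm_conjC !normfV !normr_id.
rewrite !mulVf ?gt_eqF // expr1n -mulr2n lerMn2r /= mulrA -invfM.
by rewrite ler_pdivrMl ?mulr1 // mulr_gt0.
Qed.

Lemma dense_approx (D : set H) : dense D ->
  forall u (e : C), 0 < e -> exists2 v, D v & `|u - v| < e.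
Proof. exact: dense_near. Qed.

(** A bound [c] of [bounded_op] need not be real, if the space is trivial. *)
Lemma bounded_op_pos (F : H -> H) : bounded_op F ->
  exists2 c : C, 0 < c & forall u, `|F u| <= c * `|u|.
Proof.
case=> _ [c hc]; exists (`|c| + 1); first by rewrite ltr_wpDl.
move=> u; have h := hc u; have := le_trans (normr_ge0 _) h => h0.
apply: le_trans h _; rewrite -(ger0_norm h0) normrM normr_id.
by rewrite ler_wpM2r // lerDl.
Qed.

Lemma inner_approx (D : set H) (f : H -> C) (c : C) w : dense D ->
  (forall u v, f (u - v) = f u - f v) -> 0 <= c ->
  (forall u, `|f u| <= c * `|u|) -> (forall u, D u -> f u = inner u w) ->
  forall u, f u = inner u w.
Proof.
move=> dD fB c0 fc fD u; apply/eqP; rewrite -subr_eq0 -normr_eq0; apply/eqP.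
apply: (@small_eq0 _ (c + `|w|)); rewrite ?addr_ge0 // => e e0.
have [v Dv uv] := dense_approx dD u e0.
have -> : f u - inner u w = f (u - v) - inner (u - v) w.
  by rewrite fB innerBl (fD _ Dv) opprB addrA subrK.
apply: le_trans (ler_normB _ _) _; rewrite mulrDl; apply: lerD.
  by apply: le_trans (fc _) _; rewrite ler_wpM2l // ltW.
apply: le_trans (cauchy_schwarz _ _) _; rewrite mulrC.
by rewrite ler_wpM2l // ltW.
Qed.

Lemma bounded_op_eq (D : set H) (F G : H -> H) : dense D ->
  bounded_op F -> bounded_op G -> (forall u, D u -> F u = G u) -> F = G.
Proof.
move=> dD bF bG e; apply/funext => u; apply/eqP; rewrite -subr_eq0 -normr_eq0.
have [c c0 hF] := bounded_op_pos bF; have [c' c0' hG] := bounded_op_pos bG.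
apply/eqP/(@small_eq0 _ (c + c')); rewrite ?normr_ge0 ?addr_ge0 ?(ltW c0) ?(ltW c0') // => x x0.
have [v Dv uv] := dense_approx dD u x0.
have -> : F u - G u = F (u - v) - G (u - v).
  by rewrite (linB bF.1) (linB bG.1) (e _ Dv) opprB addrA subrK.
apply: le_trans (ler_normB _ _) _; rewrite mulrDl; apply: lerD.
  by apply: le_trans (hF _) _; rewrite ler_pM2l // ltW.
by apply: le_trans (hG _) _; rewrite ler_pM2l // ltW.
Qed.

Lemma bounded_op_le (D : set H) (F : H -> H) (c : C) : dense D ->
  bounded_op F -> 0 <= c -> (forall u, D u -> `|F u| <= c * `|u|) ->
  forall u, `|F u| <= c * `|u|.
Proof.
move=> dD bF c0 h u; have [k k0 hF] := bounded_op_pos bF.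
rewrite -subr_ge0; set x := _ - _.
have xr : x \is Num.real by rewrite rpredB ?rpredM ?normr_real ?ger0_real.
case/real_ge0P: xr => // xn.
have : - x = 0; last by move/eqP; rewrite oppr_eq0 lt_eqF.
apply: (@small_eq0 _ (k + c)); rewrite ?addr_ge0 ?oppr_ge0 ?(ltW xn) ?(ltW k0) // => e e0.
have [v Dv uv] := dense_approx dD u e0.
rewrite /x opprB lerBlDr.
have -> : F u = F (u - v) + F v by rewrite -(linD bF.1) subrK.
apply: le_trans (ler_normD _ _) _; rewrite mulrDl -addrA; apply: lerD.
  by apply: le_trans (hF _) _; rewrite ler_pM2l // ltW.
apply: le_trans (h _ Dv) _; rewrite -mulrDr ler_wpM2l //.
rewrite -{1}[v](subrK u); apply: le_trans (ler_normD _ _) _.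
by rewrite lerD2r distrC ltW.
Qed.

Lemma bounded_op_comp (F G : H -> H) : bounded_op F -> bounded_op G ->
  bounded_op (F \o G).
Proof.
move=> bF bG; split; first by move=> a u v /=; rewrite bG.1 bF.1.
have [c c0 hF] := bounded_op_pos bF; have [c' c0' hG] := bounded_op_pos bG.
exists (c * c') => u; apply: le_trans (hF _) _; rewrite -mulrA ler_pM2l //.
Qed.

Lemma bounded_op_lincomb (X : Type) (r : seq X) (a : X -> C) (F : X -> H -> H) :
  (forall x, bounded_op (F x)) ->
  bounded_op (fun u => \sum_(x <- r) a x *: F x u).
Proof.
move=> bF; split.
  move=> k u v; rewrite scaler_sumr -big_split; apply: eq_bigr => x _.
  by rewrite (bF x).1 scalerDr !scalerA [a x * k]mulrC.
elim: r => [|x r [c hc]]; first by exists 0 => u; rewrite big_nil normr0 mul0r.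
have [c' c0' hF] := bounded_op_pos (bF x); exists (`|a x| * c' + c) => u.
rewrite big_cons mulrDl; apply: le_trans (ler_normD _ _) _.
by apply: lerD => //; rewrite normrZ -mulrA ler_wpM2l.
Qed.

(** The images under [G] of the points of its domain near [u] form a Cauchy
    filter. A relation is more convenient than a function on the domain, whose
    vectors come from matrices of many levels; the bound makes it
    single-valued. *)
Lemma bounded_extension (G : H -> H -> Prop) (c : C) : 0 <= c ->
  (forall a u v u' v', G u v -> G u' v' -> G (a *: u + u') (a *: v + v')) ->
  (forall u v, G u v -> `|v| <= c * `|u|) ->
  dense [set u | exists v, G u v] ->
  exists2 F : H -> H, bounded_op F & forall u v, G u v -> F u = v.
Proof.
move=> c0 Glin Gb Gd.
have GB u v u' v' : G u v -> G u' v' -> G (u - u') (v - v').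
  move=> g g'; have := Glin (-1) _ _ _ _ g' g; rewrite !scaleN1r.
  by rewrite ![- _ + _]addrC.
have lim u : exists w, forall u' v', G u' v' -> `|w - v'| <= c * `|u - u'|.
  pose B (e : R) := [set v | exists2 u', G u' v & `|u - u'| < e%:C].
  pose Fl := filter_from [set e : R | 0 < e] B.
  have FF : Filter Fl.
    apply: filter_from_filter; first by exists 1; exact: ltr01.
    move=> e e' /= e0 e0'; exists (Num.min e e'); first by rewrite /= lt_min e0.
    move=> v [u' g h]; split; exists u' => //; apply: lt_le_trans h _;
      by rewrite lecR ge_min lexx ?orbT.
  have PF : ProperFilter Fl.
    apply: filter_from_proper => e /= e0.
    have [u' [v g] h] : exists2 u', (exists v, G u' v) & `|u - u'| < e%:C.
      by apply: (dense_approx Gd); rewrite ltcR.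
    by exists v; exists u'.
  have : cvg Fl.
    apply: cauchy_cvg; apply: cauchy_exP => e e0.
    have e2 : 0 < e / (c + 1) / 2 by rewrite !divr_gt0 // ltr_wpDl.
    have [u' [v' g'] h'] : exists2 u', (exists v, G u' v) & `|u - u'| < e / (c + 1) / 2.
      exact: (dense_approx Gd).
    exists v'; exists (complex.Re (e / (c + 1) / 2)).
      by move: e2; rewrite ltcE /= => /andP[].
    move=> v [u1 g1 h1]; rewrite -ball_normE /=.
    rewrite RRe_real ?gtr0_real // in h1.
    apply: le_lt_trans (Gb _ _ (GB _ _ _ _ g' g1)) _.
    have : `|u' - u1| < e / (c + 1).
      have -> : u' - u1 = (u - u1) - (u - u') by rewrite opprB [RHS]addrC addrA subrK.
      apply: le_lt_trans (ler_normB _ _) _.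
      by rewrite [X in _ < X](splitr (e / (c + 1))) ltrD.
    move=> h; apply: le_lt_trans (ler_wpM2l c0 (ltW h)) _.
    rewrite mulrA ltr_pdivrMr ?ltr_wpDl // mulrC ltr_pM2l //.
    by rewrite ltrDl.
  set w := lim Fl => cF; exists w => u' v' g'.
  rewrite -subr_ge0; set x := _ - _.
  have xr : x \is Num.real by rewrite rpredB ?rpredM ?normr_real ?ger0_real.
  case/real_ge0P: xr => // xn.
  have : - x = 0; last by move/eqP; rewrite oppr_eq0 lt_eqF.
  apply: (@small_eq0 _ (c + 1)); rewrite ?addr_ge0 ?oppr_ge0 ?(ltW xn) // => e e0.
  have [v [wv [u1 g1 h1]]] : exists v, `|w - v| < e /\ B (complex.Re e) v.
    have n1 : Fl (ball w e) by apply: cF; exact: nbhsx_ballx.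
    have n2 : Fl (B (complex.Re e)).
      by exists (complex.Re e) => //=; move: e0; rewrite ltcE /= => /andP[].
    have [v [h1 h2]] := filter_ex (filterI n1 n2).
    by exists v; split => //; move: h1; rewrite -ball_normE.
  rewrite RRe_real ?gtr0_real // in h1.
  rewrite /x opprB lerBlDr.
  have -> : w - v' = (w - v) + (v - v') by rewrite addrA subrK.
  apply: le_trans (ler_normD _ _) _; rewrite mulrDl mul1r addrAC [X in _ <= X]addrC.
  apply: lerD; first exact: ltW.
  apply: le_trans (Gb _ _ (GB _ _ _ _ g1 g')) _; rewrite -mulrDr ler_wpM2l //.
  have -> : u1 - u' = (u - u') - (u - u1) by rewrite opprB [RHS]addrC addrA subrK.
  by apply: le_trans (ler_normB _ _) _; rewrite addrC lerD2r ltW.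
have [F hF] := choice lim.
have FG u v : G u v -> F u = v.
  move=> g; apply/eqP; rewrite -subr_eq0 -normr_le0.
  by have := hF u u v g; rewrite subrr normr0 mulr0.
have Fle u : `|F u| <= c * `|u|.
  have g0 : G 0 0.
    have [u0 [v0 g]] : [set u | exists v, G u v] !=set0.
      have [u' h _] := dense_approx Gd 0 ltr01.
      by exists u'.
    by have := GB _ _ _ _ g g; rewrite !subrr.
  by have := hF u 0 0 g0; rewrite !subr0.
exists F => //; split; last by exists c.
move=> a u v; apply/eqP; rewrite -subr_eq0 -normr_eq0; apply/eqP.
apply: (@small_eq0 _ (c * (`|a| + 1) + (`|a| * c + c))).
- by [].
- by rewrite !(addr_ge0, mulr_ge0).
move=> e e0.
have [u' [x gx] hu] := dense_approx Gd u e0.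
have [v' [y gy] hv] := dense_approx Gd v e0.
have -> : F (a *: u + v) - (a *: F u + F v) =
  (F (a *: u + v) - (a *: x + y)) - (a *: (F u - x) + (F v - y)).
  by rewrite scalerBr [a *: F u - _ + _]addrACA -opprD opprB addrA subrK.
apply: le_trans (ler_normB _ _) _; rewrite mulrDl; apply: lerD.
  apply: le_trans (hF _ _ _ (Glin a _ _ _ _ gx gy)) _.
  rewrite -mulrA ler_wpM2l //.
  have -> : a *: u + v - (a *: u' + v') = a *: (u - u') + (v - v').
    by rewrite scalerBr addrACA opprD.
  apply: le_trans (ler_normD _ _) _; rewrite normrZ mulrDl mul1r.
  by apply: lerD; rewrite ?ler_wpM2l // ltW.
apply: le_trans (ler_normD _ _) _; rewrite normrZ mulrDl.
apply: lerD.
  rewrite -mulrA ler_wpM2l //; apply: le_trans (hF _ _ _ gx) _.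
  by rewrite ler_wpM2l // ltW.
by apply: le_trans (hF _ _ _ gy) _; rewrite ler_wpM2l // ltW.
Qed.

End HilbertBasics.

(** * Towers of matrix algebras acting on a Hilbert space *)

Definition fmul (R : realType) (I : finType) (a b : I -> I -> R[i]) (i j : I) : R[i] :=
  \sum_k a i k * b k j.

Definition unitf (R : realType) (I : finType) (f g : I) (i j : I) : R[i] :=
  ((i == f) && (j == g))%:R.

Definition lift1 (R : realType) (A B J : finType) (sp : B -> A * J)
    (a : A -> A -> R[i]) : B -> B -> R[i] :=
  tensf sp a (fun r r' => (r == r')%:R).

(** The GNS space of a product state, described through the dense family of the
    vectors [t_vec a] of the matrices [a] of all finite levels. *)
Record tower (R : realType) (H : hilbertType R[i]) := Tower {
  t_idx : nat -> finType;
  t_br : finType;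
  t_split : forall n, t_idx n.+1 -> t_idx n * t_br;
  t_join : forall n, t_idx n * t_br -> t_idx n.+1;
  t_splitK : forall n, cancel (@t_split n) (@t_join n);
  t_joinK : forall n, cancel (@t_join n) (@t_split n);
  t_wt : forall n, t_idx n -> R[i];
  t_bwt : t_br -> R[i];
  t_wt_gt0 : forall n i, 0 < @t_wt n i;
  t_bwt_gt0 : forall r, 0 < t_bwt r;
  t_wtS : forall n i, @t_wt n.+1 i = t_wt (t_split i).1 * t_bwt (t_split i).2;
  t_vec : forall n, (t_idx n -> t_idx n -> R[i]) -> H;
  t_vecP : forall n c a b,
    @t_vec n (fun i j => c * a i j + b i j) = c *: t_vec a + t_vec b;
  t_vec_inner : forall n (a b : t_idx n -> t_idx n -> R[i]),
    inner (t_vec a) (t_vec b) =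
      \sum_i \sum_j a i j * Num.conj (b i j) * t_wt j :> R[i];
  t_vec_lift : forall n (a : t_idx n -> t_idx n -> R[i]),
    t_vec (lift1 (@t_split n) a) = t_vec a;
  t_vec_dense : dense (\bigcup_n range (@t_vec n)) }.

Section Tower.
Variables (R : realType) (H : hilbertType R[i]) (P : tower H).
Local Notation C := R[i].
Local Notation I := (t_idx P).
Local Notation T := (@t_vec R H P _).
Local Notation M n := (I n -> I n -> C).

Let lift n (a : M n) : M n.+1 := lift1 (@t_split _ _ P n) a.

(** The addition computes on its first argument: written as [k + n], the levels
    above [n] can be reached without transport along equations. *)
Fixpoint liftk k n (a : M n) : M (k + n) :=
  if k is k'.+1 then lift (@liftk k' n a) else a.
Arguments liftk k {n} a.

Lemma fmul_lift n (a b : M n) : fmul (lift a) (lift b) = lift (fmul a b).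
Proof.
apply/funext => i; apply/funext => j.
have -> : lift (fmul a b) i j = (\sum_k a (t_split i).1 k * b k (t_split j).1)
  * ((t_split i).2 == (t_split j).2)%:R by [].
rewrite /fmul (sum_pt (@t_splitK _ _ P n) (@t_joinK _ _ P n)) mulr_suml.
apply: eq_bigr => k _; rewrite (bigD1 (t_split i).2) //= big1 ?addr0.
  by rewrite /lift /lift1 /tensf !t_joinK /= eqxx mulr1 mulrA.
move=> r /negbTE nr.
by rewrite /lift /lift1 /tensf !t_joinK /= eq_sym nr mulr0 mul0r.
Qed.

Lemma t_vec_liftk k n (a : M n) : T (liftk k a) = T a.
Proof. by elim: k => [//|k ih] /=; rewrite t_vec_lift. Qed.

Lemma t_vecD n (a b : M n) : T (fun i j => a i j + b i j) = T a + T b.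
Proof.
rewrite -[T a]scale1r -t_vecP; congr (T _).
by apply/funext => i; apply/funext => j; rewrite mul1r.
Qed.

Lemma t_vec0 n : T (fun _ _ : I n => 0) = 0.
Proof.
have := t_vecD (fun _ _ : I n => 0) (fun _ _ => 0).
rewrite (_ : (fun _ _ : I n => 0 + 0) = fun _ _ => 0 :> C); last first.
  by apply/funext => i; apply/funext => j; rewrite addr0.
by move=> h; apply: (addrI (T (fun _ _ : I n => 0))); rewrite addr0.
Qed.

Lemma t_vecZ n c (a : M n) : T (fun i j => c * a i j) = c *: T a.
Proof.
rewrite -[RHS]addr0 -(@t_vec0 n) -t_vecP; congr (T _).
by apply/funext => i; apply/funext => j; rewrite addr0.
Qed.

Lemma t_vec_sum n (X : Type) (r : seq X) (F : X -> M n) :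
  T (fun i j => \sum_(x <- r) F x i j) = \sum_(x <- r) T (F x).
Proof.
elim: r => [|x r ih].
  rewrite big_nil -(@t_vec0 n); congr (T _).
  by apply/funext => i; apply/funext => j; rewrite big_nil.
rewrite big_cons -ih -t_vecD; congr (T _).
by apply/funext => i; apply/funext => j; rewrite big_cons.
Qed.

Lemma range_t_vec_mono k n : range (@t_vec _ _ P n) `<=` range (@t_vec _ _ P (k + n)).
Proof. by move=> _ [a _ <-]; exists (liftk k a) => //; exact: t_vec_liftk. Qed.

Lemma t_vec_dense_from n : dense (\bigcup_k range (@t_vec _ _ P (k + n))).
Proof.
move=> O O0 oO; have [u [Ou [m _ mu]]] := t_vec_dense P O0 oO.
exists u; split => //; exists m => //; rewrite addnC.
exact: range_t_vec_mono mu.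
Qed.

Lemma sqr_norm_t_vec n (a : M n) :
  `|T a| ^+ 2 = \sum_i \sum_j `|a i j| ^+ 2 * t_wt j.
Proof.
rewrite sqr_norm_inner t_vec_inner; apply: eq_bigr => i _.
by apply: eq_bigr => j _; rewrite normCK.
Qed.

Lemma t_vec_expand n (x : M n) :
  T x = \sum_i \sum_j x i j *: T (unitf R i j).
Proof.
under eq_bigr => i _.
  under eq_bigr => j _ do rewrite -t_vecZ.
  rewrite -t_vec_sum; over.
rewrite -t_vec_sum; congr (T _); apply/funext => i; apply/funext => j.
rewrite (bigD1 i) //= (bigD1 j) //= /unitf !eqxx mulr1 big1 ?addr0.
  rewrite big1 ?addr0 // => i' ni; rewrite big1 // => j' _.
  by rewrite [i == i']eq_sym (negbTE ni) mulr0.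
by move=> j' nj; rewrite [j == j']eq_sym (negbTE nj) andbF mulr0.
Qed.

(** ** Multiplication from the right *)

Let rowbound n (K : C) (c : M n) := forall u : I n -> C,
  \sum_j `|\sum_k u k * c k j| ^+ 2 * t_wt j <= K * \sum_j `|u j| ^+ 2 * t_wt j.

Let rowbound_unit n (f g : I n) : rowbound (t_wt g / t_wt f) (unitf R f g).
Proof.
move=> u.
have -> : \sum_j `|\sum_k u k * unitf R f g k j| ^+ 2 * t_wt j = `|u f| ^+ 2 * t_wt g.
  rewrite (bigD1 g) //= [X in _ + X]big1 ?addr0 => [|j /negbTE nj]; last first.
    rewrite big1 ?normr0 ?expr0n ?mul0r // => k _.
    by rewrite /unitf nj andbF mulr0.
  rewrite (bigD1 f) //= big1 ?addr0 /unitf ?eqxx ?mulr1 // => k /negbTE ->.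
  by rewrite mulr0.
rewrite mulrC -mulrA ler_pM2l ?t_wt_gt0 // ler_pdivlMl ?t_wt_gt0 // mulrC.
rewrite (bigD1 f) //= lerDl; apply: sumr_ge0 => j _.
by rewrite mulr_ge0 ?exprn_ge0 // ltW ?t_wt_gt0.
Qed.

Let rowbound_lift n K (c : M n) : rowbound K c -> rowbound K (lift c).
Proof.
move=> h u; set sK := @t_splitK _ _ P n; set jK := @t_joinK _ _ P n.
have sumE (F : I n.+1 -> C) : \sum_i F i = \sum_r \sum_j F (t_join (j, r)).
  by rewrite (sum_pt sK jK) exchange_big.
rewrite [leLHS]sumE (sumE (fun j => `|u j| ^+ 2 * t_wt j)).
rewrite mulr_sumr; apply: ler_sum => r _.
have -> : \sum_j `|u (t_join (j, r))| ^+ 2 * t_wt (t_join (j, r)) =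
  t_bwt r * \sum_j `|u (t_join (j, r))| ^+ 2 * t_wt j.
  by rewrite mulr_sumr; apply: eq_bigr => j _; rewrite t_wtS jK /=; ring.
rewrite mulrCA.
apply: le_trans (ler_wpM2l (ltW (t_bwt_gt0 r)) (h (fun j => u (t_join (j, r))))).
rewrite mulr_sumr le_eqVlt; apply/orP; left; apply/eqP; apply: eq_bigr => j _.
have -> : \sum_k u k * lift c k (t_join (j, r)) =
  \sum_k u (t_join (k, r)) * c k j.
  rewrite (sum_pt sK jK); apply: eq_bigr => k _.
  rewrite (bigD1 r) //= big1 ?addr0.
    by rewrite /lift /lift1 /tensf !jK /= eqxx mulr1.
  by move=> r' /negbTE nr; rewrite /lift /lift1 /tensf !jK /= nr !mulr0.
by rewrite t_wtS jK /=; ring.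
Qed.

(** Moving the column [f] to the column [g] changes its weight by a factor that
    does not depend on the level at which the column is refined. *)
Lemma right_mul_bound n (f g : I n) k (b : M (k + n)) :
  `|T (fmul b (liftk k (unitf R f g)))| ^+ 2 <= t_wt g / t_wt f * `|T b| ^+ 2.
Proof.
have h : rowbound (t_wt g / t_wt f) (liftk k (unitf R f g)).
  by elim: k {b} => [|k ih] /=; [exact: rowbound_unit|exact: rowbound_lift].
rewrite !sqr_norm_t_vec mulr_sumr; apply: ler_sum => i _; exact: h.
Qed.

(** Defined by its values on the vectors of the levels above [n], which are dense.
    These operators provide enough elements of the commutant of the algebra to
    reduce its elements to matrices. *)
Definition right_mul n (f g : I n) (F : H -> H) : Prop := bounded_op F /\
  forall k (b : M (k + n)), F (T b) = T (fmul b (liftk k (unitf R f g))).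

Lemma right_mul_exists n (f g : I n) : exists F, right_mul f g F.
Proof.
set c := unitf R f g.
pose Gk k u v := exists b : M (k + n), u = T b /\ v = T (fmul b (liftk k c)).
have GS k u v : Gk k u v -> Gk k.+1 u v.
  move=> [b [-> ->]]; exists (lift b); split; first by rewrite t_vec_lift.
  by rewrite fmul_lift t_vec_lift.
have Gle k k' u v : (k <= k')%N -> Gk k u v -> Gk k' u v.
  move=> /subnK <-; elim: (k' - k)%N => [//|m ih] h; exact/GS/ih.
pose q : C := t_wt g / t_wt f.
have q0 : 0 <= q by rewrite divr_ge0 // ltW ?t_wt_gt0.
have [F bF hF] : exists2 F : H -> H, bounded_op F &
    forall u v, (exists k, Gk k u v) -> F u = v.
  apply: (bounded_extension (c := sqrtC q)); rewrite ?sqrtC_ge0 //.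
  - move=> a u v u' v' [k h] [k' h']; exists (maxn k k').
    have [b [-> ->]] := Gle _ _ _ _ (leq_maxl k k') h.
    have [b' [-> ->]] := Gle _ _ _ _ (leq_maxr k k') h'.
    exists (fun i j => a * b i j + b' i j); rewrite !t_vecP; split => //.
    rewrite -t_vecP; congr (T _); apply/funext => i; apply/funext => j.
    rewrite /fmul mulr_sumr -big_split; apply: eq_bigr => l _ /=.
    by rewrite mulrDl mulrA.
  - move=> u v [k [b [-> ->]]].
    rewrite -(@ler_pXn2r _ 2) ?nnegrE ?mulr_ge0 ?sqrtC_ge0 //.
    by rewrite exprMn sqrtCK; exact: right_mul_bound.
  - move=> O O0 oO; have [u [Ou [k _ [b _ bu]]]] := @t_vec_dense_from n O O0 oO.
    exists u; split => //; exists (T (fmul b (liftk k c))), k, b.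
    by rewrite bu.
exists F; split => // k b; apply: hF; exists k, b => //.
Qed.

(* Entrywise, the adjoint of the right multiplication by c maps a to a'; this
   form passes from one level to the next. *)
Let adj_rel n (c a a' : M n) := forall i k,
  \sum_j c k j * Num.conj (a i j) * t_wt j = Num.conj (a' i k) * t_wt k.

Let adj_rel_inner n (c a a' b : M n) : adj_rel c a a' ->
  inner (T (fmul b c)) (T a) = inner (T b) (T a') :> C.
Proof.
move=> h; rewrite !t_vec_inner; apply: eq_bigr => i _.
under eq_bigr => j _ do rewrite /fmul !mulr_suml.
rewrite exchange_big; apply: eq_bigr => k _ /=.
by rewrite -mulrA -h mulr_sumr; apply: eq_bigr => j _; rewrite !mulrA.
Qed.

Let adj_rel_lift n (c a a' : M n) : adj_rel c a a' -> adj_rel (lift c) (lift a) (lift a').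
Proof.
move=> h i k; rewrite (sum_pt (@t_splitK _ _ P n) (@t_joinK _ _ P n)).
transitivity (((t_split i).2 == (t_split k).2)%:R * t_bwt (t_split k).2 *
  \sum_j c (t_split k).1 j * Num.conj (a (t_split i).1 j) * t_wt j).
  rewrite mulr_sumr; apply: eq_bigr => j _; rewrite (bigD1 (t_split k).2) //= big1 ?addr0.
    rewrite t_wtS /lift /lift1 /tensf !t_joinK /= eqxx mulr1 conjCM conjCn; ring.
  move=> r /negbTE nr; rewrite /lift /lift1 /tensf !t_joinK /= eq_sym nr.
  by rewrite mulr0 !mul0r.
rewrite h t_wtS /lift /lift1 /tensf conjCM conjCn; ring.
Qed.

Let adj_rel_unit n (f g i h : I n) : adj_rel (unitf R f g) (unitf R i h)
  (fun a b => (g == h)%:R * (t_wt g / t_wt f) * unitf R i f a b).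
Proof.
move=> a k; rewrite (bigD1 g) //= big1 ?addr0; last first.
  by move=> j /negbTE nj; rewrite /unitf nj andbF !mul0r.
rewrite /unitf eqxx andbT !conjCM !conjCn.
have f0 : t_wt f != 0 by rewrite gt_eqF ?t_wt_gt0.
have real_wt (l : I n) : Num.conj (t_wt l) = t_wt l.
  by rewrite conj_Creal // gtr0_real ?t_wt_gt0.
rewrite fmorphV /= !real_wt.
have [->|] := eqVneq k f; last by rewrite andbF !(mul0r, mulr0).
rewrite andbT; case: (a == i); rewrite /= ?(mulr0, mul0r, mul1r, mulr1) //.
by rewrite -mulrA divfK.
Qed.

Lemma right_mul_adjoint n (f g i h : I n) F u : right_mul f g F ->
  inner (F u) (T (unitf R i h)) =
  (g == h)%:R * (t_wt g / t_wt f) * inner u (T (unitf R i f)) :> C.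
Proof.
move=> [bF hF]; set x := (g == h)%:R * _.
have [c c0 hc] := bounded_op_pos bF.
have xr : Num.conj x = x.
  by rewrite /x conjCM conjCn conj_Creal // realM ?realV ?gtr0_real ?t_wt_gt0.
rewrite -{1}xr -innerZr -t_vecZ.
apply: (inner_approx (f := fun u => inner (F u) (T (unitf R i h)) : C)
  (c := c * `|T (unitf R i h)|) (@t_vec_dense_from n)).
- by move=> v v'; rewrite (linB bF.1) innerBl.
- by rewrite mulr_ge0 // ltW.
- move=> v; apply: le_trans (cauchy_schwarz _ _) _.
  by rewrite mulrAC ler_wpM2r.
move=> _ [k _ [b _ <-]]; rewrite hF.
rewrite -(t_vec_liftk k (unitf R i h)).
rewrite -(t_vec_liftk k (fun a b => x * unitf R i f a b)).
apply: adj_rel_inner; elim: k {b} => [|k ih] /=; first exact: adj_rel_unit.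
exact: adj_rel_lift.
Qed.

(** ** Compression to a finite level *)

(** The matrix by which [y] acts on the vectors of the level [n], up to the
    orthogonal complement. It is read off in the column [k], which is as good as
    any other when [y] commutes with the right multiplications. *)
Definition compression (y : H -> H) n (i k : I n) : C :=
  inner (y (T (unitf R k k))) (T (unitf R i k)) / t_wt k.

(** Right multiplications carry all columns to one column, where the entries are
    those of the compression; their adjoints show that different columns stay
    orthogonal. *)
Lemma compressionP (y : H -> H) n (a b : M n) : linear y ->
  (forall (f g : I n) F, right_mul f g F -> y \o F = F \o y) ->
  inner (y (T a)) (T b) = inner (T (fmul (compression y (n := n)) a)) (T b) :> C.
Proof.
move=> ylin yF.
have unitE (k g i h : I n) : inner (y (T (unitf R k g))) (T (unitf R i h)) =
    (g == h)%:R * t_wt g * compression y i k :> C.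
  have [F hF] := right_mul_exists k g.
  have -> : T (unitf R k g) = F (T (unitf R k k)).
    rewrite (hF.2 0%N) /=; congr (T _); apply/funext => a'; apply/funext => b'.
    rewrite /fmul (bigD1 k) //= big1 ?addr0; last first.
      by move=> j /negbTE nj; rewrite /unitf nj andbF mul0r.
    by rewrite /unitf !eqxx !andbT -natrM mulnb.
  have := yF _ _ _ hF; move/(congr1 (@^~ (T (unitf R k k)))) => /= ->.
  rewrite (right_mul_adjoint i h _ hF) /compression.
  by rewrite !mulrA; ring.
have Tr (x : M n) u : inner u (T x) = \sum_i \sum_j Num.conj (x i j) * inner u (T (unitf R i j)) :> C.
  rewrite innerC t_vec_expand inner_suml rmorph_sum; apply: eq_bigr => i _.
  rewrite inner_suml rmorph_sum; apply: eq_bigr => j _.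
  by rewrite innerZl rmorphM /= -innerC.
rewrite t_vec_inner Tr; apply: eq_bigr => i _; apply: eq_bigr => h _.
rewrite {1}t_vec_expand (lin_sum ylin) inner_suml mulr_sumr /fmul !mulr_suml.
apply: eq_bigr => k _; rewrite (lin_sum ylin) inner_suml mulr_sumr.
rewrite (bigD1 h) //= big1 ?addr0.
  by rewrite (linZ ylin) innerZl unitE eqxx mul1r; ring.
by move=> g /negbTE ng; rewrite (linZ ylin) innerZl unitE ng !(mul0r, mulr0).
Qed.

(** A single column [f] is an isometric copy, up to the scalar [t_wt f], of the
    vectors on which the compression acts. *)
Lemma compression_op_le (y : H -> H) n : linear y ->
  (forall (f g : I n) F, right_mul f g F -> y \o F = F \o y) ->
  (forall u, `|y u| <= `|u|) -> op_le 1 (compression y (n := n)).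
Proof.
move=> ylin yF y1 u v; rewrite mul1r.
case: (pickP (fun _ : I n => true)) => [f _|no]; last first.
  rewrite /bform big1 ?normr0 ?mul0rn ?addr_ge0 ?sqnorm_ge0 // => i.
  by have := no i.
pose col (x : I n -> C) : M n := fun i j => x i * (j == f)%:R.
have nc x : `|T (col x)| ^+ 2 = t_wt f * sqnorm x.
  rewrite sqr_norm_t_vec mulr_sumr; apply: eq_bigr => i _.
  rewrite (bigD1 f) //= big1 ?addr0 /col ?eqxx ?mulr1 1?mulrC // => j /negbTE ->.
  by rewrite mulr0 normr0 expr0n mul0r.
pose v' i := Num.conj (v i).
have sv : sqnorm v' = sqnorm v by apply: eq_bigr => i _; rewrite norm_conjC.
have e : inner (y (T (col u))) (T (col v')) = t_wt f * bform (compression y (n := n)) u v :> C.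
  rewrite (compressionP _ _ ylin yF) t_vec_inner mulr_sumr; apply: eq_bigr => i _.
  rewrite (bigD1 f) //= [X in _ + X]big1 ?addr0.
    rewrite /col /fmul eqxx mulr1 /v' conjCK !mulr_suml mulr_sumr.
    by apply: eq_bigr => k _; rewrite mulr1; ring.
  by move=> j /negbTE nj; rewrite /col nj mulr0 rmorph0 mulr0 mul0r.
have f0 := t_wt_gt0 (t := P) f.
rewrite -(ler_pM2l f0) [leRHS]mulrDr -sv -!nc.
rewrite -{1}(ger0_norm (ltW f0)) mulrnAr -normrM -e.
apply: le_trans (inner_amgm _ _) _; rewrite lerD2r.
by rewrite ler_pXn2r ?nnegrE.
Qed.

(** ** Multiplication from the left *)

(** [F] is the multiplication from the left by an element of the level [n0]. The
    matrices of this element at all later levels are needed: the values on the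
    vectors of the level [n0] alone do not determine [F]. *)
Record left_mul (n0 : nat) (a : forall n, M n) (F : H -> H) : Prop := LeftMul {
  left_mul_bounded : bounded_op F;
  left_mul_lift : forall n, (n0 <= n)%N -> lift (a n) = a n.+1;
  left_mulE : forall n (b : M n), (n0 <= n)%N -> F (T b) = T (fmul (a n) b) }.

Lemma fmul_bform_col n (a x b : M n) :
  inner (T (fmul a x)) (T b) =
  \sum_j t_wt j * bform a (fun k => x k j) (fun i => Num.conj (b i j)) :> C.
Proof.
rewrite t_vec_inner exchange_big; apply: eq_bigr => j _ /=.
rewrite mulr_sumr; apply: eq_bigr => i _; rewrite /fmul !mulr_suml mulr_sumr.
by apply: eq_bigr => k _; ring.
Qed.

(** On the vectors of a level the quadratic bound holds column by column. Tested
    against the image of the vector, divided by [c], it gives the operator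
    norm. *)
Lemma left_mul_le n0 (a : forall n, M n) (F : H -> H) (c : C) :
  left_mul n0 a F -> 0 < c -> (forall n, (n0 <= n)%N -> op_le c (a n)) ->
  forall u, `|F u| <= c * `|u|.
Proof.
move=> LF c0 ac.
apply: (bounded_op_le (@t_vec_dense_from n0) (left_mul_bounded LF) (ltW c0)).
move=> _ [k _ [b _ <-]]; set n := (k + n0)%N in b *.
have n0n : (n0 <= n)%N by exact: leq_addl.
have form_le (x : M n) : `|inner (F (T b)) (T x) : C| *+ 2 <= c * (`|T b| ^+ 2 + `|T x| ^+ 2).
  rewrite (left_mulE LF) // fmul_bform_col !sqr_norm_t_vec.
  rewrite [X in c * (X + _)]exchange_big [X in c * (_ + X)]exchange_big.
  rewrite -big_split mulr_sumr /=.
  apply: le_trans (_ : \sum_j t_wt j * (`|bform (a n) (fun k => b k j) (fun i => Num.conj (x i j))| *+ 2) <= _).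
    under [leRHS]eq_bigr => j _ do rewrite mulrnAr.
    rewrite sumrMnl lerMn2r; apply/orP; right.
    apply: le_trans (ler_norm_sum _ _ _) _; apply: ler_sum => j _.
    by rewrite normrM ger0_norm // ltW ?t_wt_gt0.
  apply: ler_sum => j _.
  have sqE (y : M n) : \sum_i `|y i j| ^+ 2 * t_wt j = t_wt j * sqnorm (fun i => y i j).
    by rewrite mulrC mulr_suml.
  rewrite !sqE -mulrDr mulrCA ler_pM2l ?t_wt_gt0 //.
  apply: le_trans (ac n n0n _ _) _; rewrite (_ : sqnorm (fun i => Num.conj _) = sqnorm (fun i => x i j)) //.
  by apply: eq_bigr => i _; rewrite norm_conjC.
have := form_le (fun i j => c^-1 * fmul (a n) b i j).
rewrite t_vecZ -(left_mulE LF) // innerZr -sqr_norm_inner !normrM normrZ norm_conjC.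
have ci : `|c^-1| = c^-1 by rewrite ger0_norm ?invr_ge0 // ltW.
rewrite ci normr_id exprMn mulrDr => h.
have {h} : `|F (T b)| ^+ 2 <= (c * `|T b|) ^+ 2.
  have cN : c != 0 by rewrite gt_eqF.
  have e : c * (c^-1 ^+ 2 * `|F (T b)| ^+ 2) = c^-1 * `|F (T b)| ^+ 2 by field.
  move: h; rewrite e -expr2 mulr2n lerD2r ler_pdivrMl //.
  by rewrite exprMn mulrA -expr2.
by rewrite ler_pXn2r ?nnegrE ?mulr_ge0 // ltW.
Qed.

Definition idf n : M n := fun i j => (i == j)%:R.

Definition t_one : H := T (@idf 0).

Lemma lift_idf n : lift (@idf n) = @idf n.+1.
Proof.
apply/funext => i; apply/funext => j; rewrite /lift /lift1 /tensf /idf -natrM mulnb.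
rewrite -(can_eq (@t_splitK _ _ P n) i j).
by case: (t_split i) (t_split j) => ? ? [? ?].
Qed.

Lemma t_oneE n : T (@idf n) = t_one.
Proof. by elim: n => [//|n <-]; rewrite -lift_idf t_vec_lift. Qed.

Definition adjf n (a : M n) : M n := fun i j => Num.conj (a j i).

Lemma fmul_idr n (a : M n) : fmul a (@idf n) = a.
Proof.
apply/funext => i; apply/funext => j; rewrite /fmul (bigD1 j) //= /idf eqxx mulr1.
by rewrite big1 ?addr0 // => k /negbTE ->; rewrite mulr0.
Qed.

Lemma inner_one n (a b : M n) :
  inner (T (fmul a b)) t_one = inner (T b) (T (adjf a)) :> C.
Proof.
rewrite -(t_oneE n) !t_vec_inner.
transitivity (\sum_i \sum_k a i k * b k i * t_wt i).
  apply: eq_bigr => i _; rewrite (bigD1 i) //= big1 ?addr0.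
    by rewrite /idf eqxx conjCn mulr1 /fmul mulr_suml.
  by move=> j /negbTE nj; rewrite /idf eq_sym nj conjCn mulr0 mul0r.
rewrite exchange_big; apply: eq_bigr => i _; apply: eq_bigr => k _.
by rewrite /adjf conjCK; ring.
Qed.

Lemma adjf_lift n (a : M n) : adjf (lift a) = lift (adjf a).
Proof.
apply/funext => i; apply/funext => j; rewrite /adjf /lift /lift1 /tensf.
by rewrite conjCM conjCn eq_sym.
Qed.

Lemma left_mul_adjoint n0 (a : forall n, M n) F u : left_mul n0 a F ->
  inner (F u) t_one = inner u (T (adjf (a n0))) :> C.
Proof.
move=> LF; have bF := left_mul_bounded LF; have [c c0 hc] := bounded_op_pos bF.
apply: (inner_approx (f := fun u => inner (F u) t_one : C)
  (c := c * `|t_one|) (@t_vec_dense_from n0)).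
- by move=> v v'; rewrite (linB bF.1) innerBl.
- by rewrite mulr_ge0 // ltW.
- move=> v; apply: le_trans (cauchy_schwarz _ _) _.
  by rewrite mulrAC ler_wpM2r.
move=> _ [k _ [b _ <-]]; rewrite (left_mulE LF) ?leq_addl // inner_one.
congr (inner _ _); elim: k {b} => [//|k <-].
by rewrite addSn -(left_mul_lift LF) ?leq_addl // adjf_lift t_vec_lift.
Qed.

(** In the left case [F] itself is applied to the cyclic vector, in the right case
    its adjoint. Both vectors belong to the level [n0], so that only the
    compression of [y] to this level enters. *)
Lemma predual_embedding_pairing s n0 (a : forall n, M n) (F y : H -> H) :
  left_mul n0 a F -> linear y ->
  (forall (f g : I n0) E, right_mul f g E -> y \o E = E \o y) ->
  predual_embedding s (vector_state t_one) F y =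
  pairing s (@t_wt _ _ P n0) (compression y (n := n0)) (a n0).
Proof.
move=> LF ylin yR; rewrite /predual_embedding /vector_state; case: s => /=.
  rewrite -{1}(t_oneE n0) (left_mulE LF) // fmul_idr -(t_oneE n0) compressionP //.
  rewrite t_oneE inner_one t_vec_inner exchange_big.
  apply: eq_bigr => i _; apply: eq_bigr => k _.
  by rewrite /adjf conjCK /swt; ring.
rewrite (left_mul_adjoint _ LF) -(t_oneE n0) compressionP // fmul_idr t_vec_inner.
apply: eq_bigr => i _; apply: eq_bigr => k _.
by rewrite /adjf conjCK /swt.
Qed.

Lemma compression_left_mul n0 (a : forall n, M n) F : left_mul n0 a F ->
  compression F (n := n0) = a n0.
Proof.
move=> LF; apply/funext => i; apply/funext => k; rewrite /compression.
rewrite (left_mulE LF) // t_vec_inner (bigD1 i) //= (bigD1 k) //=.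
rewrite [X in _ + X + _]big1 ?addr0; last first.
  by move=> j /negbTE nj; rewrite /unitf nj andbF conjCn mulr0 mul0r.
rewrite [X in _ + X]big1 ?addr0; last first.
  move=> j /negbTE nj; rewrite big1 // => l _.
  by rewrite /unitf nj conjCn mulr0 mul0r.
rewrite /unitf !eqxx conjCn mulr1 mulfK ?gt_eqF ?t_wt_gt0 //.
rewrite /fmul (bigD1 k) //= !eqxx mulr1 big1 ?addr0 // => j /negbTE nj.
by rewrite nj mulr0.
Qed.

End Tower.
Arguments liftk {R H P} k {n} a.

Section LeftMulClosure.
Variables (R : realType) (H : hilbertType R[i]) (P : tower H).
Local Notation C := R[i].

Lemma left_mul_mono n0 n1 a F : (n0 <= n1)%N ->
  left_mul (P := P) n0 a F -> left_mul n1 a F.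
Proof.
move=> le [bF aL aE]; split => // [n nn|n b nn]; [apply: aL|apply: aE];
  exact: leq_trans nn.
Qed.

Lemma left_mul_ext n0 a b F : (forall n, (n0 <= n)%N -> a n = b n) ->
  left_mul (P := P) n0 a F -> left_mul n0 b F.
Proof.
move=> e [bF aL aE]; split => // [n nn|n x nn].
  by rewrite -!e ?aL // leqW.
by rewrite -e ?aE.
Qed.

Lemma left_mul_lincomb (X : Type) (r : seq X) n0 (c : X -> C)
    (a : X -> forall n, t_idx P n -> t_idx P n -> C) (F : X -> H -> H) :
  (forall x, left_mul n0 (a x) (F x)) ->
  left_mul (P := P) n0 (fun n i j => \sum_(x <- r) c x * a x n i j)
    (fun u => \sum_(x <- r) c x *: F x u).
Proof.
move=> h; split.
- by apply: bounded_op_lincomb => x; exact: left_mul_bounded (h x).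
- move=> n nn; apply/funext => i; apply/funext => j; rewrite /lift1 /tensf mulr_suml.
  apply: eq_bigr => x _; rewrite -(left_mul_lift (h x)) //.
  by rewrite /lift1 /tensf mulrA.
move=> n b nn; under eq_bigr => x _ do rewrite (left_mulE (h x)) // -t_vecZ.
rewrite -t_vec_sum; congr (t_vec _); apply/funext => i; apply/funext => j.
rewrite /fmul; under [RHS]eq_bigr => k _ do rewrite mulr_suml.
rewrite exchange_big; apply: eq_bigr => x _ /=; rewrite mulr_sumr.
by apply: eq_bigr => k _; rewrite mulrA.
Qed.

End LeftMulClosure.

(** * The tower of a Powers factor *)

Section FactorTower.
Variables (R : realType) (lam : R).
Hypothesis lam0 : 0 < lam.
Variable P : powers_system (lam / (lam + 1)).
Local Notation C := R[i].
Local Notation H := (ps_space P).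
Local Notation M n := ('I_(2 ^ n) -> 'I_(2 ^ n) -> C).

Let mat n (a : M n) : 'M[C]_(2 ^ n) := \matrix_(i, j) a i j.
Let emb n (a : M n) := ps_emb P (mat a).

Definition gns_vec n (a : M n) : H := ps_rep (emb a) (ps_vec P).

Let gns := ps_GNS P.
Let lim := ps_limit P.

Lemma repP c a b u : ps_rep (c *: a + b) u = c *: ps_rep a u + ps_rep b u :> H.
Proof. by rewrite (rep_linear gns). Qed.

Lemma gns_vecP n c (a b : M n) :
  gns_vec (fun i j => c * a i j + b i j) = c *: gns_vec a + gns_vec b.
Proof.
rewrite /gns_vec -repP -(emb_linear lim); congr (ps_rep (ps_emb P _) _).
by apply/matrixP => i j; rewrite !mxE.
Qed.

Lemma rep_gns_vec n (a b : M n) : ps_rep (emb a) (gns_vec b) = gns_vec (fmul a b).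
Proof.
rewrite [RHS]/gns_vec; have -> : emb (fmul a b) = cs_mul (emb a) (emb b).
  rewrite -(emb_mul lim); congr (ps_emb P _); apply/matrixP => i j.
  by rewrite !mxE; apply: eq_bigr => k _; rewrite !mxE.
by rewrite (rep_mul gns).
Qed.

Lemma gns_vec_inner n (a b : M n) : inner (gns_vec a) (gns_vec b) =
  \sum_i \sum_j a i j * Num.conj (b i j) * @wt R lam n j :> C.
Proof.
rewrite /gns_vec -(rep_star gns) -(emb_star lim).
have <- : ps_rep (ps_emb P (adjmx (mat b) *m mat a)) (ps_vec P) =
  ps_rep (ps_emb P (adjmx (mat b))) (ps_rep (emb a) (ps_vec P)).
  by rewrite (emb_mul lim) (rep_mul gns).
rewrite (rep_state gns) ps_state_emb /mxtrace exchange_big.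
apply: eq_bigr => j _; rewrite mxE (bigD1 j) //= big1 ?addr0; last first.
  by move=> k /negbTE nk; rewrite densityE nk mulr0 mulr0.
rewrite densityE eqxx mulr1 mxE mulr_suml; apply: eq_bigr => i _.
by rewrite !mxE [a i j * _]mulrC.
Qed.

Let emb_lift1 n (a : M n) : emb (lift1 (@lev_split n) a) = emb a.
Proof.
rewrite /emb -[RHS](emb_compat lim); congr (ps_emb P _).
by apply/matrixP => i j; rewrite mxE kron2E /lift1 /tensf !mxE.
Qed.

Lemma gns_vec_lift n (a : M n) : gns_vec (lift1 (@lev_split n) a) = gns_vec a.
Proof.
by rewrite /gns_vec emb_lift1.
Qed.

(** The cyclic vectors are approximated by approximating the algebra elements. *)
Lemma gns_vec_dense : dense (\bigcup_n range (@gns_vec n)).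
Proof.
apply: near_dense => u e e0.
have e2 : 0 < e / 2 by rewrite divr_gt0.
have [_ [a _ <-] ua] := dense_near (rep_cyclic gns) u e2.
have x0 : 0 < `|ps_vec P| + 1 by rewrite ltr_wpDl.
have [_ [n _ [B _ <-]] aB] : exists2 b, (\bigcup_n range (@ps_emb _ _ P n)) b &
    `|a - b| < e / 2 / (`|ps_vec P| + 1).
  by apply: dense_near; [exact: emb_dense lim|rewrite divr_gt0].
exists (gns_vec (fun i j => B i j)); first by exists n.
have -> : gns_vec (fun i j => B i j) = ps_rep (ps_emb P B) (ps_vec P).
  by congr (ps_rep (ps_emb P _) _); apply/matrixP => i j; rewrite mxE.
rewrite -(subrKA (ps_rep a (ps_vec P))) (splitr e).
apply: le_lt_trans (ler_normD _ _) _; apply: ltrD => //.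
have -> : ps_rep a (ps_vec P) - ps_rep (ps_emb P B) (ps_vec P) = ps_rep (a - ps_emb P B) (ps_vec P).
  have := repP (-1) (ps_emb P B) a (ps_vec P); rewrite !scaleN1r.
  by rewrite ![- _ + _]addrC => ->.
apply: le_lt_trans (rep_contractive gns _ _) _.
apply: le_lt_trans (_ : e / 2 / (`|ps_vec P| + 1) * `|ps_vec P| < _).
  by rewrite ler_wpM2r // ltW.
by rewrite mulrAC ltr_pdivrMr // ltr_pM2l // ltrDl.
Qed.

Definition factor_tower : tower H :=
  Tower (@lev_splitK) (@lev_joinK) (wt_gt0 lam0) (wt1_gt0 lam0) (fun _ _ => erefl)
    gns_vecP gns_vec_inner gns_vec_lift gns_vec_dense.

Lemma fmulA (I : finType) (a b c : I -> I -> C) : fmul a (fmul b c) = fmul (fmul a b) c.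
Proof.
apply/funext => i; apply/funext => j; rewrite /fmul.
under eq_bigr => k _ do rewrite mulr_sumr.
rewrite exchange_big; apply: eq_bigr => l _; rewrite mulr_suml.
by apply: eq_bigr => k _; rewrite mulrA.
Qed.

Let emb_level m l (B : M m) : (m <= l)%N -> exists B' : M l, emb B' = emb B.
Proof.
move=> /subnK <-; elim: (l - m)%N => [|k [B' <-]]; first by exists B.
by exists (lift1 (@lev_split _) B'); rewrite emb_lift1.
Qed.

Lemma rep_bounded a : bounded_op (@ps_rep _ _ P a).
Proof.
split; first exact: (rep_op_linear gns).
by exists `|a| => u; exact: (rep_contractive gns).
Qed.

(** Left and right multiplications commute at every finite level; the inductive
    limit follows by density and contractivity of the representation. *)
Lemma right_mul_commutes n (f g : t_idx factor_tower n) F :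
  right_mul f g F -> commutant (range (@ps_rep _ _ P)) F.
Proof.
move=> [bF hF]; split => // _ [a _ <-].
have comm_emb m (B : M m) : F \o ps_rep (emb B) = ps_rep (emb B) \o F.
  apply: (@bounded_op_eq _ _ (\bigcup_k range (@gns_vec (k + m + n)))).
  - move=> O O0 oO; have [u [Ou [k _ ku]]] := @t_vec_dense_from _ _ factor_tower (m + n) O O0 oO.
    by exists u; split => //; exists k => //; rewrite -addnA.
  - by apply: bounded_op_comp => //; exact: rep_bounded.
  - by apply: bounded_op_comp => //; exact: rep_bounded.
  move=> _ [k _ [x _ <-]] /=.
  have [|B' eB] := @emb_level m (k + m + n) B; first by rewrite -addnA addnCA leq_addr.
  rewrite -eB rep_gns_vec; have hx := hF (k + m)%N; rewrite /= in hx.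
  by rewrite !hx rep_gns_vec fmulA.
apply/funext => u /=; apply/eqP; rewrite -subr_eq0 -normr_eq0; apply/eqP.
have [c c0 hc] := bounded_op_pos bF.
apply: (@small_eq0 _ _ (c * `|u| + `|F u|)).
- by [].
- by rewrite addr_ge0 ?mulr_ge0 // ltW.
move=> e e0.
have [_ [m _ [B _ <-]] aB] := dense_near (emb_dense lim) a e0.
have BE : ps_emb P B = emb (fun i j => B i j).
  by congr (ps_emb P _); apply/matrixP => i j; rewrite mxE.
have sub v : ps_rep a v = ps_rep (a - ps_emb P B) v + ps_rep (ps_emb P B) v.
  by have := repP 1 (a - ps_emb P B) (ps_emb P B) v; rewrite !scale1r subrK.
have -> : F (ps_rep a u) - ps_rep a (F u) =
    F (ps_rep (a - ps_emb P B) u) - ps_rep (a - ps_emb P B) (F u).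
  rewrite !sub (linD bF.1) BE.
  have := comm_emb _ (fun i j => B i j); move/(congr1 (@^~ u)) => /= ->.
  by rewrite opprD addrACA subrr addr0.
apply: le_trans (ler_normB _ _) _; rewrite mulrDl; apply: lerD.
  apply: le_trans (hc _) _; rewrite -mulrA ler_pM2l //.
  apply: le_trans (rep_contractive gns _ _) _.
  by rewrite mulrC ler_wpM2l // ltW.
apply: le_trans (rep_contractive gns _ _) _.
by rewrite mulrC ler_wpM2l // ltW.
Qed.

Lemma rep_in_factor a : powers_factor P (ps_rep a).
Proof.
split; first exact: rep_bounded.
by move=> F [_ hF]; rewrite hF //; exists a.
Qed.

(** The operator [haar P s j] is defined at the level [j]; the embeddings are
    compatible, so any level [n] with [j < 4 ^ n] gives the same one. *)
Lemma haar_gns_vec s j n (b : M n) : (j < 4 ^ n)%N ->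
  haar P s j (gns_vec b) = gns_vec (fmul (haar_mx s (lam / (lam + 1)) n j) b).
Proof.
move=> jn; rewrite -rep_gns_vec /haar; congr (ps_rep _ _).
have up m k : (j < 4 ^ m)%N -> ps_emb P (haar_mx s (lam / (lam + 1)) (k + m) j) =
    ps_emb P (haar_mx s (lam / (lam + 1)) m j).
  move=> jm; elim: k => [//|k ih]; rewrite addSn haar_mx_lift.
    by rewrite (emb_compat lim).
  by apply: leq_trans jm _; rewrite leq_exp2l // leq_addl.
have jj : (j < 4 ^ j)%N by exact: ltn_expl.
transitivity (ps_emb P (haar_mx s (lam / (lam + 1)) n j)).
  by rewrite -(up j n jj) -(up n j jn) addnC.
by congr (ps_emb P _); apply/matrixP => a c; rewrite mxE.
Qed.

End FactorTower.

(** * Tensor products of towers *)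

Section TensorTower.
Variables (R : realType) (H1 H2 K : hilbertType R[i]).
Variable t : {bilinear H1 -> H2 -> K}.
Hypothesis ht : is_hilbert_tensor t.
Variables (P1 : tower H1) (P2 : tower H2).
Local Notation C := R[i].
Local Notation I1 := (t_idx P1).
Local Notation I2 := (t_idx P2).
Local Notation T1 := (@t_vec _ _ P1 _).
Local Notation T2 := (@t_vec _ _ P2 _).

Lemma tensDl u u' v : t (u + u') v = t u v + t u' v.
Proof. by rewrite linearDl. Qed.
Lemma tensBl u u' v : t (u - u') v = t u v - t u' v.
Proof. by rewrite linearBl. Qed.
Lemma tensZl a u v : t (a *: u) v = a *: t u v.
Proof. by rewrite linearZl_LR. Qed.
Lemma tensBr u v v' : t u (v - v') = t u v - t u v'.
Proof. by rewrite linearBr. Qed.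
Lemma tensDr u v v' : t u (v + v') = t u v + t u v'.
Proof. by rewrite linearDr. Qed.
Lemma tensZr a u v : t u (a *: v) = a *: t u v.
Proof. by rewrite linearZr_LR. Qed.

Lemma tens_suml (X : Type) (r : seq X) (f : X -> H1) v :
  t (\sum_(x <- r) f x) v = \sum_(x <- r) t (f x) v.
Proof.
elim: r => [|x r ih]; first by rewrite !big_nil linear0l.
by rewrite !big_cons tensDl ih.
Qed.

Lemma tens_sumr (X : Type) (r : seq X) (f : X -> H2) u :
  t u (\sum_(x <- r) f x) = \sum_(x <- r) t u (f x).
Proof.
elim: r => [|x r ih]; first by rewrite !big_nil linear0r.
by rewrite !big_cons tensDr ih.
Qed.

Lemma norm_tens u v : `|t u v| = `|u| * `|v|.
Proof.
apply/eqP; rewrite -(@eqrXn2 _ 2) ?mulr_ge0 //.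
by rewrite exprMn !sqr_norm_inner tensor_inner.
Qed.

(** The point [v'] is chosen after [u'], with a precision relative to its norm,
    because [f] is not uniformly continuous. *)
Lemma biadditive_small (D : set H1) (E : set H2) (V : normedModType C)
    (f : H1 -> H2 -> V) (c : C) : dense D -> dense E -> 0 <= c ->
  (forall u u' v, f (u - u') v = f u v - f u' v) ->
  (forall u v v', f u (v - v') = f u v - f u v') ->
  (forall u v, `|f u v| <= c * (`|u| * `|v|)) ->
  forall u v (e : C), 0 < e ->
  exists u' v', [/\ D u', E v' & `|f u v - f u' v'| <= c * (e * (`|v| + 1))].
Proof.
move=> dD dE c0 fBl fBr fb u v e e0.
have [u' Du uu'] := dense_approx dD u e0.
have e1 : 0 < e / (`|u'| + 1) by rewrite divr_gt0 // ltr_wpDl.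
have [v' Ev vv'] := dense_approx dE v e1; exists u', v'; split => //.
have -> : f u v - f u' v' = f (u - u') v + f u' (v - v').
  by rewrite fBl fBr addrA subrK.
apply: le_trans (ler_normD _ _) _.
apply: le_trans (lerD (fb _ _) (fb _ _)) _.
rewrite -mulrDr ler_wpM2l // mulrDr mulr1; apply: lerD.
  by rewrite ler_wpM2r // ltW.
apply: le_trans (ler_wpM2l (normr_ge0 u') (ltW vv')) _.
by rewrite mulrCA -[leRHS]mulr1 ler_pM2l // ler_pdivrMr ?mul1r ?lerDl // ltr_wpDl.
Qed.

Let split n (p : I1 n.+1 * I2 n.+1) : (I1 n * I2 n) * (t_br P1 * t_br P2) :=
  (((t_split p.1).1, (t_split p.2).1), ((t_split p.1).2, (t_split p.2).2)).

Let join n (p : (I1 n * I2 n) * (t_br P1 * t_br P2)) : I1 n.+1 * I2 n.+1 :=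
  (t_join (p.1.1, p.2.1), t_join (p.1.2, p.2.2)).

Let splitK n : cancel (@split n) (@join n).
Proof.
by move=> [p q]; rewrite /split /join /= -!surjective_pairing !t_splitK.
Qed.

Let joinK n : cancel (@join n) (@split n).
Proof. by move=> [[p q] [r r']]; rewrite /split /join /= !t_joinK. Qed.

Let vec n (a : I1 n * I2 n -> I1 n * I2 n -> C) : K :=
  \sum_p \sum_q a p q *: t (T1 (unitf R p.1 q.1)) (T2 (unitf R p.2 q.2)).

Let vecP n c (a b : I1 n * I2 n -> I1 n * I2 n -> C) :
  vec (fun i j => c * a i j + b i j) = c *: vec a + vec b.
Proof.
rewrite /vec scaler_sumr -big_split; apply: eq_bigr => p _ /=.
rewrite scaler_sumr -big_split; apply: eq_bigr => q _ /=.
by rewrite scalerDl scalerA.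
Qed.

Let vec_prodf n (a : I1 n -> I1 n -> C) (b : I2 n -> I2 n -> C) :
  vec (prodf a b) = t (T1 a) (T2 b).
Proof.
rewrite [T1 a]t_vec_expand [T2 b]t_vec_expand tens_suml.
transitivity (\sum_i \sum_i' \sum_j \sum_j'
   (a i j * b i' j') *: t (T1 (unitf R i j)) (T2 (unitf R i' j'))).
  rewrite /vec [RHS]pair_bigA; apply: eq_bigr => p _; rewrite [RHS]pair_bigA.
  by apply: eq_bigr.
apply: eq_bigr => i _; rewrite tens_suml exchange_big; apply: eq_bigr => j _.
rewrite tens_sumr; apply: eq_bigr => i' _; rewrite tens_sumr.
by apply: eq_bigr => j' _; rewrite tensZl tensZr scalerA.
Qed.

Let inner_unit (H : hilbertType C) (P : tower H) n (i j k l : t_idx P n) :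
  inner (t_vec (unitf R i j)) (t_vec (unitf R k l)) =
  ((i == k) && (j == l))%:R * t_wt j :> C.
Proof.
rewrite t_vec_inner (bigD1 i) //= (bigD1 j) //=.
rewrite [X in _ + X + _]big1 ?addr0; last first.
  by move=> j' /negbTE nj; rewrite /unitf nj andbF !mul0r.
rewrite big1 ?addr0; last first.
  by move=> i' /negbTE ni; rewrite big1 // => j' _; rewrite /unitf ni !mul0r.
by rewrite /unitf !eqxx mul1r conjCn.
Qed.

Let vec_inner n (a b : I1 n * I2 n -> I1 n * I2 n -> C) :
  inner (vec a) (vec b) =
  \sum_p \sum_q a p q * Num.conj (b p q) * prodw (@t_wt _ _ P1 n) (@t_wt _ _ P2 n) q :> C.
Proof.
have innerr u : inner u (vec b) = \sum_p \sum_q Num.conj (b p q) *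
    inner u (t (T1 (unitf R p.1 q.1)) (T2 (unitf R p.2 q.2))) :> C.
  rewrite innerC inner_suml rmorph_sum; apply: eq_bigr => p _.
  rewrite inner_suml rmorph_sum; apply: eq_bigr => q _.
  by rewrite innerZl rmorphM /= -innerC.
rewrite /vec inner_suml; apply: eq_bigr => p _; rewrite inner_suml.
apply: eq_bigr => q _; rewrite innerZl -/(vec b) innerr -mulrA; congr (_ * _).
rewrite (bigD1 p) //= (bigD1 q) //= [X in _ + X + _]big1 ?addr0; last first.
  move=> q' nq; rewrite (tensor_inner ht) !inner_unit mulrACA -natrM mulnb.
  rewrite (_ : _ && _ = false) ?mul0r ?mulr0 //; apply: contraNF nq.
  by move=> /andP[/andP[_ /eqP e1] /andP[_ /eqP e2]]; apply/eqP;
    case: (q) (q') e1 e2 => ? ? [? ?] /= -> ->.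
rewrite [X in _ + X]big1 ?addr0; last first.
  move=> p' np; rewrite big1 // => q' _.
  rewrite (tensor_inner ht) !inner_unit mulrACA -natrM mulnb.
  rewrite (_ : _ && _ = false) ?mul0r ?mulr0 //; apply: contraNF np.
  by move=> /andP[/andP[/eqP e1 _] /andP[/eqP e2 _]]; apply/eqP;
    case: (p) (p') e1 e2 => ? ? [? ?] /= -> ->.
by rewrite (tensor_inner ht) !inner_unit !eqxx !mul1r.
Qed.

Let lift_prodf n (a : I1 n -> I1 n -> C) (b : I2 n -> I2 n -> C) :
  lift1 (@split n) (prodf a b) =
  prodf (lift1 (@t_split _ _ P1 n) a) (lift1 (@t_split _ _ P2 n) b).
Proof.
apply/funext => p; apply/funext => q; rewrite /lift1 /tensf /prodf /split /=.
by rewrite mulrACA -natrM mulnb.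
Qed.

Let vec_lift n (a : I1 n * I2 n -> I1 n * I2 n -> C) :
  vec (lift1 (@split n) a) = vec a.
Proof.
have unit_lift p q : vec (lift1 (@split n) (prodf (unitf R p.1 q.1) (unitf R p.2 q.2)))
    = t (T1 (unitf R p.1 q.1)) (T2 (unitf R p.2 q.2)).
  by rewrite lift_prodf vec_prodf !t_vec_lift.
rewrite [RHS]/vec; under [RHS]eq_bigr => p _.
  under eq_bigr => q _.
    rewrite -unit_lift /vec scaler_sumr.
    under eq_bigr => p' _ do rewrite scaler_sumr.
    over.
  rewrite exchange_big /=.
  under eq_bigr => p' _ do rewrite exchange_big /=.
  over.
rewrite exchange_big; apply: eq_bigr => p' _ /=.
rewrite exchange_big; apply: eq_bigr => q' _ /=.
under [RHS]eq_bigr => p _.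
  under eq_bigr => q _ do rewrite scalerA.
  rewrite -scaler_suml; over.
rewrite -scaler_suml; congr (_ *: _).
rewrite (bigD1 (split p').1) //= (bigD1 (split q').1) //=.
rewrite [X in _ = _ + X + _]big1 ?addr0; last first.
  move=> q nq; rewrite /lift1 /tensf /prodf /unitf.
  rewrite -natrM mulnb (_ : _ && (_ && _) = false) ?mul0r ?mulr0 //.
  apply: contraNF nq => /andP[/andP[_ /eqP e1] /andP[_ /eqP e2]].
  by apply/eqP; case: (q) e1 e2 => ? ? /= <- <-; case: (split q').1.
rewrite [X in _ = _ + X]big1 ?addr0; last first.
  move=> p np; rewrite big1 // => q _; rewrite /lift1 /tensf /prodf /unitf.
  rewrite -natrM mulnb (_ : _ && (_ && _) = false) ?mul0r ?mulr0 //.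
  apply: contraNF np => /andP[/andP[/eqP e1 _] /andP[/eqP e2 _]].
  by apply/eqP; case: (p) e1 e2 => ? ? /= <- <-; case: (split p').1.
by rewrite /lift1 /tensf /prodf /unitf /= !eqxx !mul1r.
Qed.

Let vecD n (a b : I1 n * I2 n -> I1 n * I2 n -> C) :
  vec (fun i j => a i j + b i j) = vec a + vec b.
Proof.
rewrite -[vec a]scale1r -vecP; congr (vec _).
by apply/funext => i; apply/funext => j; rewrite mul1r.
Qed.

Let range_vec_mono n m : (n <= m)%N -> range (@vec n) `<=` range (@vec m).
Proof.
move=> /subnK <-; elim: (m - n)%N => [//|k ih] u /ih[a _ <-].
by exists (lift1 (@split _) a) => //; rewrite vec_lift.
Qed.

Let range_mono (H : hilbertType C) (P : tower H) n m : (n <= m)%N ->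
  range (@t_vec _ _ P n) `<=` range (@t_vec _ _ P m).
Proof. by move=> /subnK <-; exact: range_t_vec_mono. Qed.

Let vec_dense : dense (\bigcup_n range (@vec n)).
Proof.
apply: near_dense => w e e0.
have e2 : 0 < e / 2 by rewrite divr_gt0.
have [_ [n [u [v ->]]] hw] := dense_approx (tensor_dense ht) w e2.
have tens1 x y : `|t x y| <= 1 * (`|x| * `|y|) by rewrite mul1r norm_tens.
have one x y (d : C) : 0 < d -> exists2 w', (\bigcup_n range (@vec n)) w' & `|t x y - w'| < d.
  move=> d0; have y1 : 0 < `|y| + 1 by rewrite ltr_wpDl.
  have d2 : 0 < d / 2 / (`|y| + 1) by rewrite !divr_gt0.
  have [x' [y' [[n1 _ h1] [n2 _ h2] h]]] := biadditive_small (@t_vec_dense _ _ P1)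
    (@t_vec_dense _ _ P2) ler01 tensBl tensBr tens1 x y d2.
  have [a _ ax] := range_mono (leq_maxl n1 n2) h1.
  have [b _ bx] := range_mono (leq_maxr n1 n2) h2.
  exists (t x' y').
    by exists (maxn n1 n2) => //; exists (prodf a b) => //; rewrite vec_prodf ax bx.
  apply: le_lt_trans h _; rewrite mul1r divfK ?gt_eqF //.
  by rewrite [ltRHS](splitr d) ltrDl divr_gt0.
have many (d : C) : 0 < d -> exists2 w', (\bigcup_n range (@vec n)) w' &
    `|\sum_k t (u k) (v k) - w'| < d.
  elim: n u v {hw} d => [|n ih] u v d d0.
    exists 0; last by rewrite big_ord0 subrr normr0.
    exists 0%N => //; exists (fun _ _ => 0) => //.
    by rewrite /vec big1 // => p _; rewrite big1 // => q _; rewrite scale0r.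
  have d2 : 0 < d / 2 by rewrite divr_gt0.
  have [w1 [n1 _ h1] hw1] := one (u ord0) (v ord0) _ d2.
  have [w2 [n2 _ h2] hw2] := ih (fun k => u (lift ord0 k)) (fun k => v (lift ord0 k)) _ d2.
  have [a _ ax] := range_vec_mono (leq_maxl n1 n2) h1.
  have [b _ bx] := range_vec_mono (leq_maxr n1 n2) h2.
  exists (vec (fun i j => a i j + b i j)); first by exists (maxn n1 n2).
  rewrite big_ord_recl vecD ax bx opprD addrACA (splitr d).
  by apply: le_lt_trans (ler_normD _ _) _; apply: ltrD.
have [w' Vw' hw'] := many _ e2; exists w' => //.
rewrite -(subrKA (\sum_k t (u k) (v k))) (splitr e).
by apply: le_lt_trans (ler_normD _ _) _; apply: ltrD.
Qed.

Definition tensor_tower : tower K :=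
  Tower splitK joinK
    (fun n p => mulr_gt0 (t_wt_gt0 (t := P1) p.1) (t_wt_gt0 (t := P2) p.2))
    (fun r => mulr_gt0 (t_bwt_gt0 (t := P1) r.1) (t_bwt_gt0 (t := P2) r.2))
    (fun n p => etrans (congr2 *%R (t_wtS (t := P1) p.1) (t_wtS (t := P2) p.2))
       (mulrACA _ _ _ _))
    vecP vec_inner vec_lift vec_dense.

Lemma tensor_vec_prodf n (a : I1 n -> I1 n -> C) (b : I2 n -> I2 n -> C) :
  @t_vec _ _ tensor_tower n (prodf a b) = t (T1 a) (T2 b).
Proof. exact: vec_prodf. Qed.

Lemma liftk_prodf k n (a : I1 n -> I1 n -> C) (b : I2 n -> I2 n -> C) :
  @liftk _ _ tensor_tower k n (prodf a b) = prodf (liftk k a) (liftk k b).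
Proof.
elim: k => [//|k /= ->]; exact: lift_prodf.
Qed.

Lemma fmul_prodf (X1 X2 : finType) (a c : X1 -> X1 -> C) (b d : X2 -> X2 -> C) :
  fmul (prodf a b) (prodf c d) = prodf (fmul a c) (fmul b d).
Proof.
apply/funext => p; apply/funext => q; rewrite /fmul /prodf mulr_suml.
under [RHS]eq_bigr => i _ do rewrite mulr_sumr.
by rewrite [RHS]pair_bigA; apply: eq_bigr => -[i j] _ /=; rewrite mulrACA.
Qed.

Lemma unitf_prodf (X1 X2 : finType) (f g : X1 * X2) :
  unitf R f g = prodf (unitf R f.1 g.1) (unitf R f.2 g.2).
Proof.
apply/funext => -[p p']; apply/funext => -[q q']; rewrite /unitf /prodf /=.
case: f g => [f f'] [g g'] /=; rewrite !xpair_eqE -natrM mulnb; congr (_%:R : C).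
by case: (p == f) (p' == f') (q == g) (q' == g') => [] [] [] [].
Qed.

Lemma tens_bounded_eq (D : set H1) (E : set H2) (F : K -> K) (A : H1 -> H1) (B : H2 -> H2) :
  dense D -> dense E -> bounded_op F -> bounded_op A -> bounded_op B ->
  (forall u v, D u -> E v -> F (t u v) = t (A u) (B v)) ->
  forall u v, F (t u v) = t (A u) (B v).
Proof.
move=> dD dE bF bA bB h u v; apply/eqP; rewrite -subr_eq0 -normr_eq0; apply/eqP.
have [a a0 hA] := bounded_op_pos bA; have [b b0 hB] := bounded_op_pos bB.
have [c c0 hF] := bounded_op_pos bF.
pose f u v := F (t u v) - t (A u) (B v).
have M0 : 0 <= c + a * b by rewrite addr_ge0 ?mulr_ge0 // ltW.
apply: (@small_eq0 _ _ ((c + a * b) * (`|v| + 1))).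
- by [].
- by rewrite (mulr_ge0 M0) // addr_ge0.
have fBl x x' y : f (x - x') y = f x y - f x' y.
  by rewrite /f tensBl (linB bF.1) (linB bA.1) tensBl !opprD addrACA.
have fBr x y y' : f x (y - y') = f x y - f x y'.
  by rewrite /f tensBr (linB bF.1) (linB bB.1) tensBr !opprD addrACA.
have fb x y : `|f x y| <= (c + a * b) * (`|x| * `|y|).
  apply: le_trans (ler_normB _ _) _; rewrite mulrDl; apply: lerD.
    by apply: le_trans (hF _) _; rewrite norm_tens.
  by rewrite norm_tens mulrACA ler_pM.
move=> e e0; have [u' [v' [Du Ev]]] := biadditive_small dD dE M0 fBl fBr fb u v e0.
by rewrite {2}/f (h _ _ Du Ev) subrr subr0 [e * _]mulrC mulrA.
Qed.

(** This makes the right multiplications of the tensor product commute with the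
    tensor products of operators that commute with the right multiplications of
    the factors. *)
Lemma right_mul_tens n (f g : I1 n * I2 n) F A B :
  right_mul (P := tensor_tower) (n := n) f g F ->
  right_mul f.1 g.1 A -> right_mul f.2 g.2 B ->
  forall u v, F (t u v) = t (A u) (B v).
Proof.
move=> [bF hF] [bA hA] [bB hB].
apply: (tens_bounded_eq (@t_vec_dense_from _ _ P1 n) (@t_vec_dense_from _ _ P2 n)) => //.
move=> u v [k _ ku] [k' _ kv].
have up m m' (H : hilbertType C) (P : tower H) : (m <= m')%N ->
    range (@t_vec _ _ P (m + n)) `<=` range (@t_vec _ _ P (m' + n)).
  by move=> mm; apply: range_mono; rewrite leq_add2r.
have [a _ <-] := up _ _ _ _ (leq_maxl k k') _ ku.
have [b _ <-] := up _ _ _ _ (leq_maxr k k') _ kv.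
rewrite -tensor_vec_prodf hF unitf_prodf liftk_prodf.
by rewrite fmul_prodf tensor_vec_prodf hA hB.
Qed.

End TensorTower.

(** * Sigma-weakly continuous functionals *)

Section Omega.
Variable R : realType.
Local Notation C := R[i].

Lemma rnormE (V : normedModType C) (v : V) : `|v| = (rnorm v)%:C.
Proof. by rewrite /rnorm RRe_real // normr_real. Qed.

Lemma real_cauchy_cvg (x : nat -> R) :
  (forall e, 0 < e -> exists n, forall m, (n <= m)%N -> `|x m - x n| <= e) ->
  cvgn x.
Proof.
move=> h; apply: cauchy_cvg; apply: cauchy_exP => e e0.
have [n hn] := h (e / 2) (divr_gt0 e0 (ltr0n _ 2)).
exists (x n); exists n => // m /= nm; rewrite -ball_normE /= distrC.
by apply: le_lt_trans (hn m nm) _; rewrite ltr_pdivrMr // mulr_natr mulr2n ltrDl.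
Qed.

(** Completeness of the scalars, by real and imaginary parts *)
Lemma complex_cauchy_cvg (x : nat -> C^o) :
  (forall e : R, 0 < e -> exists n, forall m, (n <= m)%N -> `|x m - x n| <= e%:C) ->
  cvgn x.
Proof.
move=> h.
have Ih (z : C) : `|complex.Im z|%:C <= `|z|.
  rewrite normc_def lecR -sqrtr_sqr ler_wsqrtr // lerDr sqr_ge0 //.
have cRe : cvgn (fun n => complex.Re (x n) : R).
  apply: real_cauchy_cvg => e e0; have [n hn] := h e e0; exists n => m nm.
  rewrite -lecR; apply: le_trans (hn m nm).
  by apply: le_trans (normc_ge_Re _); rewrite raddfB.
have cIm : cvgn (fun n => complex.Im (x n) : R).
  apply: real_cauchy_cvg => e e0; have [n hn] := h e e0; exists n => m nm.
  rewrite -lecR; apply: le_trans (hn m nm).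
  by apply: le_trans (Ih _); rewrite raddfB.
pose l : C := limn (fun n => complex.Re (x n)) +i* limn (fun n => complex.Im (x n)).
apply/cvg_ex; exists (l : C^o); apply/cvgrPdist_le => e e0.
have er : e = (complex.Re e)%:C by rewrite RRe_real // gtr0_real.
have e2 : 0 < complex.Re e / 2 by rewrite divr_gt0 // -ltcR -er.
have /cvgrPdist_le /(_ _ e2) hR := cRe; have /cvgrPdist_le /(_ _ e2) hI := cIm.
near=> n; rewrite er (splitr (complex.Re e)).
have hRn : `|limn (fun n => complex.Re (x n)) - complex.Re (x n)| <= complex.Re e / 2.
  by near: n.
have hIn : `|limn (fun n => complex.Im (x n)) - complex.Im (x n)| <= complex.Re e / 2.
  by near: n.
rewrite [l - x n]complexE; apply: le_trans (ler_normD _ _) _; rewrite rmorphD.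
have nR (a : R) : `|a%:C| = `|a|%:C.
  by rewrite normc_def /= expr0n addr0 sqrtr_sqr.
apply: lerD; last rewrite normrM; rewrite !nR.
  by rewrite lecR; apply: le_trans hRn; rewrite raddfB.
rewrite (_ : `|'i| = 1) ?mul1r; last by rewrite normc_def /= expr0n expr1n add0r sqrtr1.
by rewrite lecR; apply: le_trans hIn; rewrite raddfB.
Unshelve. all: end_near.
Qed.

Variable H : hilbertType C.

Lemma square_summable_tail (u : nat -> H) : square_summable u ->
  forall e : R, 0 < e -> exists n, forall m, (n <= m)%N ->
    \sum_(n <= i < m) rnorm (u i) ^+ 2 <= e.
Proof.
move=> su e e0.
have s0 i : true -> (0 <= (rnorm (u i) ^+ 2)%:E)%E by move=> _; rewrite lee_fin sqr_ge0.
have := nneseries_tail_cvg su s0.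
move=> /fine_cvgP[fin /cvgrPdist_le /(_ _ e0) hn].
have [n] : exists n, (\sum_(n <= k <oo) (rnorm (u k) ^+ 2)%:E \is a fin_num)%E /\
   `|0 - fine (\sum_(n <= k <oo) (rnorm (u k) ^+ 2)%:E)%E| <= e.
  have [n [h1 h2]] := filter_ex (filterI fin hn); exists n; split => //.
move=> [fn]; rewrite sub0r normrN => le_e; exists n => m nm.
rewrite -lee_fin -sumEFin; apply: le_trans (_ : _ <= \sum_(n <= k <oo) (rnorm (u k) ^+ 2)%:E)%E _.
  apply: nneseries_lim_ge => k _ _; rewrite lee_fin sqr_ge0 //.
rewrite -(fineK fn) lee_fin; exact: le_trans (ler_norm _) le_e.
Qed.

Let sqsum_tail_mono (w : nat -> H) n n' m : (n <= n')%N -> (n' <= m)%N ->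
  \sum_(n' <= i < m) rnorm (w i) ^+ 2 <= \sum_(n <= i < m) rnorm (w i) ^+ 2.
Proof.
move=> nn nm; rewrite [leRHS](big_cat_nat (n := n')) //= lerDr.
by apply: sumr_ge0 => i _; rewrite sqr_ge0.
Qed.

Section OmegaUV.
Variables u v : nat -> H.
Hypotheses (su : square_summable u) (sv : square_summable v).

Let term (x : H -> H) i : C := inner (x (u i)) (v i).

Let term_le x (c : C) : (forall w, `|x w| <= c * `|w|) -> 0 <= c -> forall n m,
  `|\sum_(n <= i < m) term x i| <=
   (c + 1) ^+ 2 * (\sum_(n <= i < m) rnorm (u i) ^+ 2 + \sum_(n <= i < m) rnorm (v i) ^+ 2)%:C.
Proof.
move=> hx c0 n m; rewrite -big_split rmorph_sum mulr_sumr.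
apply: le_trans (ler_norm_sum _ _ _) _; apply: ler_sum => i _ /=.
apply: le_trans (_ : `|term x i| *+ 2 <= _); first by rewrite mulr2n lerDl.
apply: le_trans (inner_amgm _ _) _; rewrite rmorphD !rmorphXn /= -!rnormE mulrDr.
have c1 : 1 <= (c + 1) ^+ 2 by rewrite exprn_ege1 // lerDr.
apply: lerD; last by rewrite ler_peMl // exprn_ge0.
apply: le_trans (_ : (c * `|u i|) ^+ 2 <= _).
  by rewrite ler_pXn2r ?nnegrE ?mulr_ge0.
rewrite exprMn ler_wpM2r ?exprn_ge0 // ler_pXn2r ?nnegrE ?addr_ge0 //.
by rewrite lerDl.
Qed.

Let term_tail x (c : C) : (forall w, `|x w| <= c * `|w|) -> 0 <= c ->
  forall e : R, 0 < e -> exists n, forall m, (n <= m)%N ->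
    `|\sum_(n <= i < m) term x i| <= (c + 1) ^+ 2 * e%:C.
Proof.
move=> hx c0 e e0.
have e2 : 0 < e / 2 by rewrite divr_gt0.
have [n1 h1] := square_summable_tail su e2.
have [n2 h2] := square_summable_tail sv e2.
exists (maxn n1 n2) => m; rewrite geq_max => /andP[m1 m2].
apply: le_trans (term_le hx c0 _ _) _; rewrite ler_wpM2l ?exprn_ge0 ?addr_ge0 //.
rewrite lecR (splitr e); apply: lerD.
  apply: le_trans (h1 m m1); apply: sqsum_tail_mono; rewrite ?leq_maxl // geq_max m1 //.
apply: le_trans (h2 m m2); apply: sqsum_tail_mono; rewrite ?leq_maxr // geq_max m1 //.
Qed.

Lemma omega_cvg x : bounded_op x ->
  series (fun i => inner (x (u i)) (v i) : C^o) @ \oo --> (omega u v x : C^o).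
Proof.
move=> /bounded_op_pos[c c0 hx].
suff : cvgn (series (fun i => inner (x (u i)) (v i) : C^o)) by [].
apply: complex_cauchy_cvg => e e0.
have M0 : 0 < (c + 1) ^+ 2 by rewrite exprn_gt0 // addr_gt0.
have Mr : (c + 1) ^+ 2 = (complex.Re ((c + 1) ^+ 2))%:C by rewrite RRe_real // gtr0_real.
set M := complex.Re ((c + 1) ^+ 2) in Mr.
have MR0 : 0 < M by rewrite -ltcR -Mr.
have [n hn] := term_tail hx (ltW c0) (divr_gt0 e0 MR0).
exists n => m nm; rewrite sub_series_geq //; apply: le_trans (hn m nm) _.
by rewrite Mr -rmorphM /= lecR mulrC divfK ?gt_eqF.
Qed.

Lemma omega_linear c x y : bounded_op x -> bounded_op y ->
  omega u v (c *: x + y) = c * omega u v x + omega u v y.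
Proof.
move=> bx by_; have cx := omega_cvg bx; have cy := omega_cvg by_.
apply: (@cvg_lim C^o); first exact: norm_hausdorff.
have e : series (fun i => inner ((c *: x + y) (u i)) (v i) : C^o) =
    (fun n => c *: series (fun i => inner (x (u i)) (v i) : C^o) n +
      series (fun i => inner (y (u i)) (v i) : C^o) n).
  apply/funext => n; rewrite /series /= scaler_sumr -big_split.
  by apply: eq_bigr => i _ /=; rewrite innerDl innerZl.
rewrite e; exact: (cvgD (cvgZr cx) cy).
Qed.

(** The tails of the two square summable sequences bound the error for all
    contractions at once, so this is an approximation in norm. *)
Lemma omega_approx (e : R) : 0 < e -> exists n, forall x, linear x ->
  (forall w, `|x w| <= `|w|) ->
  `|omega u v x - \sum_(0 <= i < n) inner (x (u i)) (v i) : C| <= e%:C.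
Proof.
move=> e0.
(* the bound of term_le for contractions has the factor (1 + 1) ^ 2 = 4 *)
have e4 : 0 < e / 4 / 2 by rewrite !divr_gt0.
have [n1 h1] := square_summable_tail su e4.
have [n2 h2] := square_summable_tail sv e4.
exists (maxn n1 n2) => x lx hx; set n := maxn n1 n2.
have bx : bounded_op x by split => //; exists 1 => w; rewrite mul1r.
have hx1 w : `|x w| <= 1 * `|w| by rewrite mul1r.
have tail m : (n <= m)%N -> `|\sum_(n <= i < m) term x i| <= e%:C.
  move=> nm; have m1 := leq_trans (leq_maxl n1 n2) nm; have m2 := leq_trans (leq_maxr n1 n2) nm.
  apply: le_trans (term_le hx1 ler01 _ _) _.
  apply: le_trans (_ : 4%:R * (e / 4)%:C <= _).
    rewrite (_ : (1 + 1) ^+ 2 = 4%:R); last by rewrite -(natrD _ 1 1) -natrX.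
    rewrite ler_pM2l ?ltr0n // lecR (splitr (e / 4)); apply: lerD.
      by apply: le_trans (h1 m m1); apply: sqsum_tail_mono => //; exact: leq_maxl.
    by apply: le_trans (h2 m m2); apply: sqsum_tail_mono => //; exact: leq_maxr.
  by rewrite -(rmorph_nat (real_complex R)) -rmorphM /= lecR mulrC divfK.
have := omega_cvg bx; set l := omega u v x => cl.
rewrite -subr_ge0; set d := _ - _.
have dr : d \is Num.real by rewrite rpredB ?normr_real //; apply/complex_realP; exists e.
case/real_ge0P: dr => // dn.
have : - d = 0; last by move/eqP; rewrite oppr_eq0 lt_eqF.
apply: (@small_eq0 _ _ 1) => //; first by rewrite oppr_ge0 ltW.
move=> k k0; rewrite mul1r.
move/cvgrPdist_le: cl => /(_ k k0) [N _ hN].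
have /= := hN (maxn n N) (leq_maxr _ _) => hm.
rewrite /d opprB lerBlDr.
have -> : l - \sum_(0 <= i < n) inner (x (u i)) (v i) =
  (l - \sum_(0 <= i < maxn n N) inner (x (u i)) (v i)) + \sum_(n <= i < maxn n N) term x i.
  rewrite [X in _ = _ - X + _](big_cat_nat (n := n)) ?leq_maxl //=.
  by rewrite opprD addrA subrK.
apply: le_trans (ler_normD _ _) _; apply: lerD; first exact: hm.
by apply: tail; exact: leq_maxl.
Qed.

End OmegaUV.

(** By induction on [n]: restricted to the kernel of the last functional, [phi] is
    a combination of the others, and the remainder is proportional to the last
    one. Applied to the finitely many seminorms that control a sigma-weakly
    continuous functional, this replaces a Hahn-Banach argument. *)
Lemma lincomb_of_kernel (V : lmodType C) (S : set V) n (w : 'I_n -> V -> C) (phi : V -> C) :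
  S 0 -> (forall c x y, S x -> S y -> S (c *: x + y)) ->
  (forall k c x y, S x -> S y -> w k (c *: x + y) = c * w k x + w k y) ->
  (forall c x y, S x -> S y -> phi (c *: x + y) = c * phi x + phi y) ->
  (forall x, S x -> (forall k, w k x = 0) -> phi x = 0) ->
  exists a : 'I_n -> C, forall x, S x -> phi x = \sum_k a k * w k x.
Proof.
elim: n S w phi => [|n ih] S w phi S0 SL wL phiL ker.
  by exists (fun=> 0) => x Sx; rewrite big_ord0 ker // => -[].
pose S' := [set x | S x /\ w ord_max x = 0].
have f0 (f : V -> C) : (forall c x y, S x -> S y -> f (c *: x + y) = c * f x + f y) -> f 0 = 0.
  move=> fL; have := fL 1 _ _ S0 S0; rewrite scaler0 addr0 mul1r => h.
  by apply: (addrI (f 0)); rewrite -h addr0.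
have [a ha] : exists a : 'I_n -> C, forall x, S' x ->
    phi x = \sum_k a k * w (widen_ord (leqnSn n) k) x.
  apply: ih.
  - by split => //; apply: f0; exact: wL.
  - by move=> c x y [Sx wx] [Sy wy]; split; [exact: SL|rewrite wL // wx wy mulr0 addr0].
  - by move=> k c x y [Sx _] [Sy _]; exact: wL.
  - by move=> c x y [Sx _] [Sy _]; exact: phiL.
  move=> x [Sx wx] h; apply: ker => // k.
  have [kn|] := ltnP k n.
    by have := h (Ordinal kn); congr (w _ x = 0); exact/val_inj.
  by move=> nk; rewrite (_ : k = ord_max) //; apply/val_inj/eqP; rewrite eqn_leq nk -ltnS ltn_ord.
pose psi x := phi x - \sum_(k < n) a k * w (widen_ord (leqnSn n) k) x.
have psi0 x : S' x -> psi x = 0 by move=> Sx; rewrite /psi (ha _ Sx) subrr.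
have psiL c x y : S x -> S y -> psi (c *: x + y) = c * psi x + psi y.
  move=> Sx Sy; rewrite /psi phiL // mulrBr addrACA -opprD; congr (_ - _).
  rewrite mulr_sumr -big_split; apply: eq_bigr => k _ /=.
  by rewrite wL //; ring.
have [b hb] : exists b, forall x, S x -> psi x = b * w ord_max x.
  case: (pselect (exists2 x0, S x0 & w ord_max x0 != 0)) => [[x0 Sx0 w0]|no].
    exists (psi x0 / w ord_max x0) => x Sx.
    have : psi ((- (w ord_max x / w ord_max x0)) *: x0 + x) = 0.
      by apply: psi0; split; [exact: SL|rewrite wL // mulNr divfK // addNr].
    rewrite psiL // mulNr addrC => /eqP; rewrite subr_eq0 => /eqP ->; ring.
  exists 0 => x Sx; rewrite mul0r; apply: psi0; split => //.
  by apply/eqP; apply: contra_notT no => w0; exists x.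
exists (fun k => if unlift ord_max k is Some k' then a k' else b) => x Sx.
rewrite big_ord_recr /= unlift_none -(hb _ Sx) /psi addrC.
rewrite [X in _ = _ + X](eq_bigr (fun k => a k * w (widen_ord (leqnSn n) k) x)) ?subrK //.
move=> k _; rewrite (_ : widen_ord _ k = lift ord_max k) ?liftK //.
by apply/val_inj; rewrite /= /bump leqNgt ltn_ord.
Qed.

End Omega.

(** * Generated von Neumann algebras *)

Section Commutant.
Variables (R : realType) (H : hilbertType R[i]) (S : set (H -> H)).
Local Notation C := R[i].

Lemma bounded_op_add c (x y : H -> H) :
  bounded_op x -> bounded_op y -> bounded_op (c *: x + y).
Proof.
move=> bx by_; have E w : (c *: x + y) w = c *: x w + y w by [].
split.
  by move=> a u v; rewrite !E bx.1 by_.1 !scalerDr !scalerA [c * a]mulrC addrACA.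
have [k k0 hk] := bounded_op_pos bx; have [k' k0' hk'] := bounded_op_pos by_.
exists (`|c| * k + k') => u; rewrite E; apply: le_trans (ler_normD _ _) _.
by rewrite normrZ mulrDl -mulrA; apply: lerD => //; rewrite ler_wpM2l.
Qed.

Lemma vN_generated_lin c x y :
  vN_generated S x -> vN_generated S y -> vN_generated S (c *: x + y).
Proof.
move=> [bx hx] [by_ hy]; split; first exact: bounded_op_add.
move=> w Sw; apply/funext => u; have lw := Sw.1.1.
rewrite -[LHS]/(c *: x (w u) + y (w u)) -[RHS]/(w (c *: x u + y u)) lw.
by have := congr1 (@^~ u) (hx w Sw); have := congr1 (@^~ u) (hy w Sw) => /= -> ->.
Qed.

Lemma vN_generated0 : vN_generated S 0.
Proof.
split; first by split; [move=> a u v; rewrite scaler0 addr0|exists 0 => u; rewrite normr0 mul0r].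
by move=> w Sw; apply/funext => u; rewrite -[RHS]/(w 0) (lin0 Sw.1.1).
Qed.

Lemma vN_generated_sum (X : Type) (r : seq X) (c : X -> C) (F : X -> H -> H) :
  (forall x, vN_generated S (F x)) ->
  vN_generated S (fun u => \sum_(x <- r) c x *: F x u).
Proof.
move=> h; elim: r => [|x r ih].
  rewrite (_ : (fun _ => _) = 0); first exact: vN_generated0.
  by apply/funext => u; rewrite big_nil.
rewrite (_ : (fun _ => _) = c x *: F x + (fun u => \sum_(x <- r) c x *: F x u)).
  exact: vN_generated_lin.
by apply/funext => u; rewrite big_cons.
Qed.

Lemma sub_vN_generated x : bounded_op x -> S x -> vN_generated S x.
Proof. by move=> bx Sx; split=> // w [_ hw]; rewrite hw. Qed.

End Commutant.

(** * Partial sums of the product Haar system *)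

Section Main.
Variables (R : realType) (lam1 lam2 : R).
Hypotheses (lam10 : 0 < lam1) (lam20 : 0 < lam2).
Variables (P1 : powers_system (lam1 / (lam1 + 1))).
Variables (P2 : powers_system (lam2 / (lam2 + 1))).
Variables (K : hilbertType R[i]) (t : {bilinear (ps_space P1) -> (ps_space P2) -> K}).
Hypothesis ht : is_hilbert_tensor t.
Variables (s : side) (z : nat -> K -> K).
Hypothesis hz : shell_product t (haar P1 s) (haar P2 s) z.
Local Notation C := R[i].

Let tow1 := factor_tower lam10 P1.
Let tow2 := factor_tower lam20 P2.
Let tow := tensor_tower ht tow1 tow2.
Let Om := t (ps_vec P1) (ps_vec P2).
Let M := vN_tensor t (powers_factor P1) (powers_factor P2).
Let e n := predual_embedding s (vector_state Om) (z n).

Let t_oneE1 (lam : R) (lam0 : 0 < lam) (P : powers_system (lam / (lam + 1))) :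
  t_one (factor_tower lam0 P) = ps_vec P.
Proof.
rewrite /t_one /= /gns_vec (_ : (\matrix_(i, j) _) = 1%:M).
  by rewrite (emb_one (ps_limit P)) (rep_one (ps_GNS P)).
by apply/matrixP => i j; rewrite !mxE.
Qed.

Let OmE : Om = t_one tow.
Proof.
rewrite /Om -(t_oneE1 lam10 P1) -(t_oneE1 lam20 P2) -tensor_vec_prodf.
congr (t_vec _); apply/funext => -[p p']; apply/funext => -[q q'].
by rewrite /prodf /idf /= xpair_eqE -natrM mulnb.
Qed.

Let M_linear y : M y -> linear y. Proof. by move=> My; exact: My.1.1. Qed.

(* The operators F of the statement lie in the commutant of the generators x1 (x)
   x2, because they are products of right multiplications of the factors. *)
Let M_commutes n (f g : t_idx tow n) F y : M y -> right_mul f g F ->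
  y \o F = F \o y.
Proof.
move=> [_ hy] rF; apply: hy; have bF := rF.1; split => // w [x1 [x2 [Mx1 Mx2 [bw hw]]]].
have [A rA] := @right_mul_exists _ _ tow1 n f.1 g.1.
have [B rB] := @right_mul_exists _ _ tow2 n f.2 g.2.
have FE := right_mul_tens rF rA rB.
have cA : A \o x1 = x1 \o A.
  by have [_ hx1] := Mx1; rewrite (hx1 A (right_mul_commutes rA)).
have cB : B \o x2 = x2 \o B.
  by have [_ hx2] := Mx2; rewrite (hx2 B (right_mul_commutes rB)).
apply: (bounded_op_eq (tensor_dense ht)); [exact: bounded_op_comp..|].
move=> _ [m [u [v ->]]] /=; rewrite !(lin_sum bw.1, lin_sum bF.1).
apply: eq_bigr => k _; rewrite hw !FE hw.
by have := congr1 (@^~ (u k)) cA; have := congr1 (@^~ (v k)) cB => /= -> ->.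
Qed.

Let lev n := (4 ^ n * 4 ^ n)%N.

Let lev_mono m n : (m <= n)%N -> (lev m <= lev n)%N.
Proof. by move=> mn; rewrite leq_mul // leq_exp2l. Qed.

Let lt_lev n : (n < lev n)%N.
Proof.
have h : (n < 4 ^ n)%N by exact: ltn_expl.
by apply: leq_trans h _; rewrite leq_pmulr // expn_gt0.
Qed.

Let tow_lift n (a : 'I_(2 ^ n) -> 'I_(2 ^ n) -> C) (b : 'I_(2 ^ n) -> 'I_(2 ^ n) -> C) :
  lift1 (@t_split _ _ tow n) (prodf a b) =
  prodf (lift1 (@lev_split n) a) (lift1 (@lev_split n) b).
Proof. exact: (@liftk_prodf _ _ _ _ _ ht tow1 tow2 1 n a b). Qed.

Let haar_lift (lam : R) n j : (j < 4 ^ n)%N ->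
  lift1 (@lev_split n) (haar_mx s (lam / (lam + 1)) n j) =
  haar_mx s (lam / (lam + 1)) n.+1 j.
Proof.
move=> jn; rewrite haar_mx_lift //; apply/funext => a; apply/funext => b.
by rewrite kron2E /lift1 /tensf mxE.
Qed.

Let dual_lift (lam : R) n j : (j < 4 ^ n)%N ->
  lift1 (@lev_split n) (dual_haar s lam n j) = dual_haar s lam n.+1 j.
Proof.
move=> jn; have := @dual_haar_block R s lam n 0 j jn; rewrite muln0 add0n => ->.
by apply/funext => a; apply/funext => b; rewrite /lift1 /tensf mxE eq_sym.
Qed.

Let zmx_lift n k : (k < lev n)%N ->
  lift1 (@t_split _ _ tow n) (zmx s lam1 lam2 n k) = zmx s lam1 lam2 n.+1 k.
Proof.
by move=> /unshell_lt[k1 k2]; rewrite /zmx tow_lift !haar_lift.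
Qed.

Let dual_zmx_lift n k : (k < lev n)%N ->
  lift1 (@t_split _ _ tow n) (dual_zmx s lam1 lam2 n k) = dual_zmx s lam1 lam2 n.+1 k.
Proof.
by move=> /unshell_lt[k1 k2]; rewrite /dual_zmx tow_lift !dual_lift.
Qed.

Let z_tensor k : tensor_op t (haar P1 s (unshell k).1) (haar P2 s (unshell k).2) (z k).
Proof. by have := hz (unshell k).1 (unshell k).2; rewrite -/(shell0 _ _) unshellK. Qed.

Let z_left_mul n k : (k < lev n)%N ->
  left_mul (P := tow) n (fun m => zmx s lam1 lam2 m k) (z k).
Proof.
move=> kn; have [bz zt] := z_tensor k; split => //.
  by move=> m nm; apply: zmx_lift; exact: leq_trans (lev_mono nm).
move=> m b nm; have [k1 k2] := unshell_lt (leq_trans kn (lev_mono nm)).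
have h1 (x : t_idx tow1 m -> t_idx tow1 m -> C) : haar P1 s (unshell k).1 (t_vec x) =
    t_vec (t := tow1) (fmul (haar_mx s (lam1 / (lam1 + 1)) m (unshell k).1) x).
  exact: haar_gns_vec.
have h2 (x : t_idx tow2 m -> t_idx tow2 m -> C) : haar P2 s (unshell k).2 (t_vec x) =
    t_vec (t := tow2) (fmul (haar_mx s (lam2 / (lam2 + 1)) m (unshell k).2) x).
  exact: haar_gns_vec.
have -> : t_vec b = \sum_p \sum_q b p q *:
    t_vec (t := tow) (prodf (unitf R p.1 q.1) (unitf R p.2 q.2)).
  rewrite [LHS]t_vec_expand; apply: eq_bigr => p _; apply: eq_bigr => q _.
  by rewrite unitf_prodf.
rewrite (lin_sum bz.1).
have -> : fmul (zmx s lam1 lam2 m k) b = fun i j => \sum_p \sum_q b p q *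
    fmul (zmx s lam1 lam2 m k) (unitf R p q) i j.
  apply/funext => i; apply/funext => j; rewrite /fmul.
  under [RHS]eq_bigr => p _.
    under eq_bigr => q _ do rewrite mulr_sumr.
    rewrite exchange_big /=; over.
  rewrite exchange_big; apply: eq_bigr => l _ /=.
  rewrite (bigD1 l) //= (bigD1 j) //= /unitf !eqxx mulr1.
  rewrite big1 ?addr0 => [|q /negbTE nq]; last by rewrite [j == q]eq_sym nq andbF !mulr0.
  rewrite big1 ?addr0 1?mulrC // => p /negbTE np; rewrite big1 // => q _.
  by rewrite [l == p]eq_sym np !mulr0.
rewrite t_vec_sum; apply: eq_bigr => p _; rewrite (lin_sum bz.1) t_vec_sum.
apply: eq_bigr => q _; rewrite (linZ bz.1) t_vecZ; congr (_ *: _).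
rewrite tensor_vec_prodf zt h1 h2 unitf_prodf.
by rewrite fmul_prodf tensor_vec_prodf.
Qed.

Let z_in_M k : M (z k).
Proof.
apply: sub_vN_generated; first exact: (z_tensor k).1.
exists (haar P1 s (unshell k).1), (haar P2 s (unshell k).2); split; last exact: z_tensor.
  exact: rep_in_factor.
exact: rep_in_factor.
Qed.

Let wcoef k (j : nat) : C := pairing s (@wtK R lam1 lam2 k)
  (dual_zmx s lam1 lam2 k j) (dual_zmx s lam1 lam2 k k).

(** The dual matrices as operators: written as combinations of the system they lie
    in the algebra, and no further operators on [K] have to be constructed. *)
Let dual_z k (u : K) : K := \sum_(j < lev k) wcoef k j *: z j u.

Let dual_z_in_M k : M (dual_z k).
Proof. by apply: (vN_generated_sum _ (fun j : 'I_(lev k) => wcoef k j)) => j; exact: z_in_M. Qed.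

Let dual_z_left_mul k : left_mul (P := tow) k (fun m => dual_zmx s lam1 lam2 m k) (dual_z k).
Proof.
have LW := left_mul_lincomb (index_enum 'I_(lev k)) (fun j : 'I_(lev k) => wcoef k j)
  (fun j => z_left_mul (ltn_ord j)).
apply: (left_mul_ext _ LW) => m /subnK <-; elim: (m - k)%N => [|d ih].
  apply/funext => i; apply/funext => j.
  rewrite -(zmx_expansion s lam10 lam20 (dual_zmx s lam1 lam2 k k)) big_mkord.
  by apply: eq_bigr => l _; rewrite /wcoef.
rewrite -(left_mul_lift LW) ?leq_addl // ih dual_zmx_lift //.
by apply: leq_trans (lt_lev k) (lev_mono (leq_addl d k)).
Qed.

Let compr (y : K -> K) n : t_idx tow n -> t_idx tow n -> C := compression y (n := n).

Let eE n k y : M y -> (k < lev n)%N ->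
  e k y = pairing s (@wtK R lam1 lam2 n) (@compr y n) (zmx s lam1 lam2 n k).
Proof.
move=> My kn; rewrite /e OmE.
apply: (predual_embedding_pairing s (z_left_mul kn) (M_linear My)).
by move=> f g E; exact: M_commutes.
Qed.

Let e_dual_z j k : e j (dual_z k) = (j == k)%:R.
Proof.
have jm : (j < lev (maxn j k))%N by exact: leq_trans (lt_lev j) (lev_mono (leq_maxl _ _)).
have km : (k < lev (maxn j k))%N by exact: leq_trans (lt_lev k) (lev_mono (leq_maxr _ _)).
rewrite (eE (dual_z_in_M k) jm) /compr.
rewrite (compression_left_mul (left_mul_mono (leq_maxr j k) (dual_z_left_mul k))).
by rewrite dual_zmx_pairing // eq_sym.
Qed.

(** The adjoint of the [N]-th partial sum projection *)
Let proj N (y : K -> K) (u : K) : K := \sum_(0 <= k < N) e k y *: dual_z k u.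

Let proj_in_M N y : M (proj N y).
Proof. by apply: vN_generated_sum => k; exact: dual_z_in_M. Qed.

Let proj_bound : exists2 c : C, 0 < c & forall N y, M y ->
  (forall u, `|y u| <= `|u|) -> forall u, `|proj N y u| <= c * `|u|.
Proof.
have [c c0 hc] := prod_trunc_cbounded s lam10 lam20.
exists (c + 1); first by rewrite ltr_wpDl.
move=> N y My y1.
have LP : left_mul (P := tow) N (fun m i j => \sum_(k < N) e k y * dual_zmx s lam1 lam2 m k i j)
   (fun u => \sum_(k < N) e k y *: dual_z k u).
  apply: (left_mul_lincomb _ (fun k : 'I_N => e k y)) => k.
  exact: left_mul_mono (ltnW (ltn_ord k)) (dual_z_left_mul k).
have PE : proj N y = fun u => \sum_(k < N) e k y *: dual_z k u.
  by apply/funext => u; rewrite /proj big_mkord.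
rewrite PE; apply: (left_mul_le LP); first by rewrite ltr_wpDl.
move=> n Nn; apply: (op_leW (c := c * 1)); first by rewrite mulr1 lerDl.
have lvN : (N <= lev n)%N by exact: leq_trans (ltnW (lt_lev N)) (lev_mono Nn).
have cn : op_le 1 (@compr y n).
  by apply: compression_op_le => //; [exact: M_linear|move=> f g E; exact: M_commutes].
apply: eq_op_le (hc n N 1 _ lvN ler01 cn) => i j.
rewrite /prod_trunc big_mkord; apply: eq_bigr => k _.
by rewrite (@eE n) // (leq_trans (ltn_ord k)).
Qed.

(** In the right case the operator [z k] is moved to the other side of the inner
    product. As vector functionals the [e k] are sigma-weakly continuous. *)
Let e_vector k : exists u0 v0 : K, forall y, e k y = inner (y u0) v0.
Proof.
rewrite /e /predual_embedding /vector_state; case: s hz z_left_mul => hz' zl /=.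
  by exists (z k Om), Om.
exists Om, (t_vec (@adjf _ _ tow k (zmx Right lam1 lam2 k k))) => y.
by rewrite -(left_mul_adjoint _ (zl _ _ (lt_lev k))) -OmE.
Qed.

Let e_linear k c (x y : K -> K) : e k (c *: x + y) = c * e k x + e k y.
Proof.
have [u0 [v0 h]] := e_vector k.
by rewrite !h -innerZl -innerDl.
Qed.

Let lim_single (T : ptopologicalType) (x : nat -> T) l : hausdorff_space T ->
  (forall n, x n.+1 = l) -> lim (x @ \oo) = l.
Proof.
move=> hT h; apply: (cvg_lim hT); apply: (@cvg_near_cst _ _ l).
by exists 1%N => // -[|n] //= _; rewrite h.
Qed.

Let single (u0 : K) (i : nat) : K := if i == 0%N then u0 else 0.

Let single_summable u0 : square_summable (single u0).
Proof.
rewrite /square_summable (_ : (\sum_(0 <= i <oo) _)%E = (rnorm u0 ^+ 2)%:E) ?ltry //.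
apply: lim_single; first exact: ereal_hausdorff.
move=> n; rewrite big_ltn // big1_seq ?adde0 // => i /andP[_].
rewrite mem_index_iota => /andP[i0 _]; rewrite /single gtn_eqF //.
by rewrite /rnorm normr0 /= expr0n.
Qed.

Let omega_single u0 v0 x : omega (single u0) (single v0) x = inner (x u0) v0.
Proof.
apply: (@lim_single C^o); first exact: norm_hausdorff.
move=> n; rewrite /series /= big_ltn // big1_seq ?addr0 // => i /andP[_].
by rewrite mem_index_iota => /andP[i0 _]; rewrite /single gtn_eqF // linear0r.
Qed.

Let e_predual k : predual M (e k).
Proof.
split; first by move=> c x y _ _; exact: e_linear.
have [u0 [v0 h]] := e_vector k.
move=> x Mx eps eps0; exists 1%N, (fun=> single u0), (fun=> single v0), eps.
split => [_||y My /(_ ord0)]; [by split; exact: single_summable|by []|rewrite omega_single !h].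
by rewrite -[(y - x) u0]/(y u0 - x u0) innerBl.
Qed.

(** ** Density of the system *)

Let approximable (phi : (K -> K) -> C) := forall d : C, 0 < d ->
  exists m (a : nat -> C), forall y, M y -> (forall u, `|y u| <= `|u|) ->
    `|phi y - \sum_(0 <= k < m) a k * e k y| <= d.

Let approximableD phi psi : approximable phi -> approximable psi ->
  approximable (fun y => phi y + psi y).
Proof.
move=> hphi hpsi d d0; have d2 : 0 < d / 2 by rewrite divr_gt0.
have [m [a ha]] := hphi _ d2; have [m' [a' ha']] := hpsi _ d2.
exists (maxn m m'), (fun k => (if (k < m)%N then a k else 0) + (if (k < m')%N then a' k else 0)).
move=> y My y1.
have cut (n n' : nat) (b : nat -> C) : (n <= n')%N ->
    \sum_(0 <= k < n') (if (k < n)%N then b k else 0) * e k y = \sum_(0 <= k < n) b k * e k y.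
  move=> nn; rewrite !big_mkord (big_ord_widen _ (fun k => b k * e k y) nn) [RHS]big_mkcond.
  by apply: eq_bigr => k _; case: ifP; rewrite ?mul0r.
under eq_bigr => k _ do rewrite mulrDl.
rewrite big_split /= !cut ?leq_maxl ?leq_maxr // opprD addrACA (splitr d).
by apply: le_trans (ler_normD _ _) _; apply: lerD; [exact: ha|exact: ha'].
Qed.

Let approximableZ c phi : approximable phi -> approximable (fun y => c * phi y).
Proof.
move=> hphi d d0; have c1 : 0 < `|c| + 1 by rewrite ltr_wpDl.
have [m [a ha]] := hphi (d / (`|c| + 1)) (divr_gt0 d0 c1).
exists m, (fun k => c * a k) => y My y1.
under eq_bigr => k _ do rewrite -mulrA.
rewrite -mulr_sumr -mulrBr normrM; apply: le_trans (ler_wpM2l _ (ha _ My y1)) _ => //.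
rewrite mulrCA -[leRHS]mulr1 ler_pM2l // ler_pdivrMr // mul1r lerDl //.
Qed.

Let approximable0 : approximable (fun=> 0).
Proof.
by move=> d d0; exists 0%N, (fun=> 0) => y _ _; rewrite big_nil subrr normr0 ltW.
Qed.

Let approximable_sum (X : Type) (r : seq X) (F : X -> (K -> K) -> C) :
  (forall x, approximable (F x)) -> approximable (fun y => \sum_(x <- r) F x y).
Proof.
move=> h; elim: r => [|x r ih].
  by move=> d d0; have [m [a ha]] := approximable0 d0; exists m, a => y; rewrite big_nil; exact: ha.
move=> d d0; have [m [a ha]] := approximableD (h x) ih d0.
by exists m, a => y; rewrite big_cons; exact: ha.
Qed.

Let approximable_lim phi : (forall d : C, 0 < d -> exists2 psi, approximable psi &
    forall y, M y -> (forall u, `|y u| <= `|u|) -> `|phi y - psi y| <= d) ->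
  approximable phi.
Proof.
move=> h d d0; have d2 : 0 < d / 2 by rewrite divr_gt0.
have [psi hpsi close] := h _ d2; have [m [a ha]] := hpsi _ d2.
exists m, a => y My y1; rewrite -(subrKA (psi y)) (splitr d).
by apply: le_trans (ler_normD _ _) _; apply: lerD; [exact: close|exact: ha].
Qed.

(** At a finite level a matrix coefficient of [y] is a linear functional of the
    compression of [y], hence a combination of the pairings with the system. *)
Let approximable_level n (a b : t_idx tow n -> t_idx tow n -> C) :
  approximable (fun y => inner (y (t_vec a)) (t_vec b)).
Proof.
move=> d d0.
pose w := @wtK R lam1 lam2 n.
pose x k i := (\sum_j a k j * Num.conj (b i j) * w j) / swt s w i k.
pose cf l := pairing s w (dual_zmx s lam1 lam2 n l) x.
exists (lev n), cf => y My y1.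
rewrite (_ : _ - _ = 0) ?normr0 ?ltW //; apply/eqP; rewrite subr_eq0; apply/eqP.
have yF (f g : t_idx tow n) F : right_mul f g F -> y \o F = F \o y by exact: M_commutes.
rewrite (compressionP _ _ (M_linear My) yF).
transitivity (pairing s w (@compr y n) x).
  rewrite t_vec_inner; apply: eq_bigr => i _.
  under eq_bigr => j _ do rewrite /fmul !mulr_suml.
  rewrite exchange_big; apply: eq_bigr => k _ /=; rewrite /x.
  have sw0 : swt s w i k != 0 by rewrite gt_eqF // swt_gt0 // => p; exact: wtK_gt0.
  rewrite -mulrA divfK // mulr_sumr; apply: eq_bigr => j _.
  by rewrite !mulrA.
transitivity (\sum_(0 <= l < lev n) cf l * pairing s w (@compr y n) (zmx s lam1 lam2 n l)); last first.
  by apply: eq_big_nat => l /andP[_ ln]; rewrite (@eE n).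
transitivity (pairing s w (@compr y n) (fun i j => \sum_(0 <= l < lev n) cf l * zmx s lam1 lam2 n l i j)).
  apply: eq_pairing => // i j; exact/esym/zmx_expansion.
under [RHS]eq_bigr => l _ do rewrite mulr_sumr.
rewrite exchange_big; apply: eq_bigr => i _ /=.
under [RHS]eq_bigr => l _ do rewrite mulr_sumr.
rewrite exchange_big; apply: eq_bigr => j _ /=.
by rewrite mulr_sumr mulr_suml; apply: eq_bigr => l _; ring.
Qed.

Let approximable_vector u v : approximable (fun y => inner (y u) v).
Proof.
apply: approximable_lim => d d0.
have e1 : 0 < d / 2 / (`|v| + 1) by rewrite !divr_gt0 // ltr_wpDl.
have [u' [n1 _ h1] uu'] := dense_approx (t_vec_dense tow) u e1.
have e2 : 0 < d / 2 / (`|u'| + 1) by rewrite !divr_gt0 // ltr_wpDl.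
have [v' [n2 _ h2] vv'] := dense_approx (t_vec_dense tow) v e2.
have up n n' : (n <= n')%N -> range (@t_vec _ _ tow n) `<=` range (@t_vec _ _ tow n').
  by move=> /subnK <-; exact: range_t_vec_mono.
have [a _ au] := up _ _ (leq_maxl n1 n2) _ h1.
have [b _ bv] := up _ _ (leq_maxr n1 n2) _ h2.
exists (fun y => inner (y u') v'); first by rewrite -au -bv; exact: approximable_level.
move=> y My y1.
have -> : inner (y u) v - inner (y u') v' = inner (y (u - u')) v + inner (y u') (v - v') :> C.
  by rewrite (linB (M_linear My)) innerBl innerBr addrA subrK.
have small (p q : K) : `|p| <= d / 2 / (`|q| + 1) -> `|p| * `|q| <= d / 2.
  move=> h; apply: le_trans (ler_wpM2r (normr_ge0 q) h) _.
  have q1 : 0 < `|q| + 1 by rewrite ltr_wpDl.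
  by rewrite mulrAC ler_pdivrMr // ler_pM2l ?divr_gt0 // lerDl.
rewrite (splitr d); apply: le_trans (ler_normD _ _) _; apply: lerD.
  apply: le_trans (cauchy_schwarz _ _) _.
  apply: le_trans (small _ _ (ltW uu')); exact: ler_wpM2r.
apply: le_trans (cauchy_schwarz _ _) _; rewrite mulrC.
apply: le_trans (small _ _ (ltW vv')); exact: ler_wpM2l.
Qed.

Let functional0 phi : functional_on M phi -> phi 0 = 0.
Proof.
move=> L; have M0 := @vN_generated0 R K _ : M 0.
have := L 1 _ _ M0 M0; rewrite scaler0 addr0 scale1r => h.
by apply: (addrI (phi 0)); rewrite -h addr0.
Qed.

Let functionalZ phi c x : functional_on M phi -> M x -> phi (c *: x) = c * phi x.
Proof.
move=> L Mx; have M0 := @vN_generated0 R K _ : M 0.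
by have := L c _ _ Mx M0; rewrite (functional0 L) !addr0.
Qed.

(** The kernel condition of [lincomb_of_kernel] holds because [phi] is bounded on
    all multiples of an element on which the [omega (u k) (v k)] vanish. *)
Let predual_approximable phi : predual M phi -> approximable phi.
Proof.
move=> [L cont]; have M0 := @vN_generated0 R K _ : M 0.
have [n [u [v [d [uv d0 hd]]]]] := cont 0 M0 1 ltr01.
have bM y : M y -> bounded_op y by case.
have wL k c x y : M x -> M y -> omega (u k) (v k) (c *: x + y) =
    c * omega (u k) (v k) x + omega (u k) (v k) y.
  by move=> Mx My; apply: omega_linear (uv k).1 (uv k).2 _ _ _ (bM _ Mx) (bM _ My).
have [a ha] : exists a : 'I_n -> C, forall x, M x -> phi x = \sum_k a k * omega (u k) (v k) x.
  apply: (@lincomb_of_kernel R _ M n (fun k => omega (u k) (v k)) phi) => //.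
    by move=> c x y; exact: vN_generated_lin.
  move=> x Mx wx; apply/eqP; rewrite -normr_eq0; apply/eqP.
  apply: (@small_eq0 _ _ 1) => // eps eps0; rewrite mul1r.
  have Mx' : M (eps^-1 *: x) by rewrite -[_ *: x]addr0; exact: vN_generated_lin.
  have w0 k : omega (u k) (v k) 0 = 0.
    have := wL k 1 _ _ M0 M0; rewrite scaler0 addr0 mul1r => h.
    by apply: (addrI (omega (u k) (v k) 0)); rewrite -h addr0.
  have := hd _ Mx'; rewrite (functional0 L) !subr0 => h.
  have /h : forall k, rnorm (omega (u k) (v k) (eps^-1 *: x) : C^o) < d.
    move=> k; rewrite -[_ *: x]addr0 wL // wx mulr0 w0 addr0.
    by rewrite /rnorm normr0.
  rewrite (functionalZ _ L Mx) -ltcR -rnormE normrM gtr0_norm ?invr_gt0 //.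
  by rewrite mulrC ltr_pdivrMr // mul1r => /ltW.
move=> dl dl0; have [m [cf hcf]] : exists m (cf : nat -> C), forall y, M y -> (forall w, `|y w| <= `|w|) ->
    `|\sum_(k <- index_enum 'I_n) a k * omega (u k) (v k) y - \sum_(0 <= k < m) cf k * e k y| <= dl.
  move: dl dl0; apply: approximable_sum => k; apply: approximableZ.
  apply: approximable_lim => dl dl0.
  have dlR : 0 < complex.Re dl by move: dl0; rewrite ltcE /= => /andP[].
  have [N hN] := omega_approx (uv k).1 (uv k).2 dlR.
  exists (fun y => \sum_(0 <= i < N) inner (y (u k i)) (v k i)).
    by apply: approximable_sum => i; exact: approximable_vector.
  move=> y My y1; rewrite -[dl]RRe_real ?gtr0_real //; apply: hN => //.
  exact: M_linear.
by exists m, cf => y My y1; rewrite ha //; exact: hcf.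
Qed.

(** ** The basis property *)

Let sum_app (c : nat -> C) n (y : K -> K) :
  (\sum_(0 <= k < n) c k *: (e k : (K -> K) -> C^o)) y = \sum_(0 <= k < n) c k * e k y.
Proof.
elim: n => [|n ih]; first by rewrite !big_nil.
by rewrite !big_nat_recr //= -ih.
Qed.

Let functional_sum phi (X : Type) (r : seq X) (c : X -> C) (F : X -> K -> K) :
  functional_on M phi -> (forall x, M (F x)) ->
  phi (fun u => \sum_(x <- r) c x *: F x u) = \sum_(x <- r) c x * phi (F x).
Proof.
move=> L MF; elim: r => [|x r ih].
  rewrite big_nil -(functional0 L); congr (phi _).
  by apply/funext => u; rewrite big_nil.
rewrite big_cons -ih -[c x * _]/(c x *: phi (F x)) -L //; last exact: vN_generated_sum.
by congr (phi _); apply/funext => u; rewrite big_cons.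
Qed.

Let ereal_cvg0 (x : nat -> \bar R) : (forall n, 0 <= x n)%E ->
  (forall d : R, 0 < d -> exists n0, forall n, (n0 <= n)%N -> (x n <= d%:E)%E) ->
  x @ \oo --> 0%E.
Proof.
move=> x0 h; apply/fine_cvgP.
have fin n (d : R) : (x n <= d%:E)%E -> x n \is a fin_num.
  by move=> le; rewrite ge0_fin_numE //; exact: le_lt_trans le (ltry _).
split.
  have [n0 hn] := h 1 ltr01; exists n0 => // n /= nn.
  exact: fin (hn n nn).
apply/cvgrPdist_le => d d0; have [n0 hn] := h d d0; exists n0 => // n /= nn.
rewrite sub0r normrN ger0_norm ?fine_ge0 // -lee_fin fineK ?hn //.
exact: fin (hn n nn).
Qed.

Lemma functional_norm_ge0 phi : (0 <= functional_norm M phi)%E.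
Proof.
apply: (@le_trans _ _ (rnorm (phi 0 : C^o))%:E).
  rewrite lee_fin -lecR -rnormE; exact: normr_ge0.
apply: ereal_sup_ubound; exists 0 => //; split; first exact: vN_generated0.
by move=> u; rewrite normr0.
Qed.

(** If [psi] is a combination of the first [m] functionals, [psi] is fixed by the
    partial sums from [m] on, and [phi - phi \o proj n] is the difference of
    [phi - psi] and of its composition with [proj n]; both are small when [psi] is
    close to [phi]. Conversely, evaluation at the dual elements recovers the
    coefficients of any expansion. *)
Lemma haar_tensor_schauder : schauder_basis (predual M) (functional_norm M) e.
Proof.
split; first exact: e_predual.
move=> phi Pphi; have L := Pphi.1.
have [c c0 hc] := proj_bound.
have subE (f : (K -> K) -> C^o) (a : nat -> C) n y :
    (f - \sum_(0 <= k < n) a k *: (e k : (K -> K) -> C^o)) y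
    = f y - \sum_(0 <= k < n) a k * e k y.
  by rewrite -sum_app.
have diff_functional a n : functional_on M
    (fun y => phi y - \sum_(0 <= k < n) a k * e k y).
  move=> b x y Mx My; rewrite L // scalerBr addrACA -opprD; congr (_ - _).
  rewrite scaler_sumr -big_split; apply: eq_bigr => k _ /=.
  by rewrite e_linear -[b *: _]/(b * _); ring.
exists (fun k => phi (dual_z k)); split.
  apply: ereal_cvg0 => [n|d d0]; first exact: functional_norm_ge0.
  have c1 : 0 < 1 + c by rewrite addr_gt0.
  have d1 : 0 < d%:C / (1 + c) by rewrite divr_gt0 // ltcR.
  have [m [a ha]] := predual_approximable Pphi d1.
  exists m => n mn; apply: ge_ereal_sup => _ [y [My y1] <-].
  rewrite lee_fin -lecR -rnormE subE.
  pose psi x := \sum_(0 <= k < m) a k * e k x.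
  have projE : psi (proj n y) = psi y.
    apply: eq_big_nat => k /andP[_ km]; congr (_ * _).
    rewrite (functional_sum _ (fun l => e l y) (fun b x y' _ _ => e_linear k b x y') dual_z_in_M).
    rewrite (bigD1_seq k) ?iota_uniq ?mem_index_iota ?(leq_trans km) //=.
    by rewrite e_dual_z eqxx mulr1 big1 ?addr0 // => l /negbTE nl; rewrite e_dual_z eq_sym nl mulr0.
  have -> : \sum_(0 <= k < n) phi (dual_z k) * e k y = phi (proj n y).
    rewrite (functional_sum _ (fun l => e l y) L dual_z_in_M).
    by apply: eq_bigr => k _; rewrite mulrC.
  have -> : phi y - phi (proj n y) = (phi y - psi y) - (phi (proj n y) - psi (proj n y)).
    by rewrite projE opprB addrA subrK.
  have -> : d%:C = d%:C / (1 + c) + c * (d%:C / (1 + c)).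
    by rewrite -[X in X + _]mul1r -mulrDl mulrC divfK // gt_eqF.
  apply: le_trans (ler_normB _ _) _; apply: lerD; first exact: ha.
  have Mp := proj_in_M n y.
  have Mcp : M (c^-1 *: proj n y).
    by rewrite -[_ *: _]addr0; apply: vN_generated_lin => //; exact: vN_generated0.
  have := ha _ Mcp; rewrite (functionalZ (phi := fun y => phi y - psi y) _ (diff_functional a m) Mp).
  rewrite normrM gtr0_norm ?invr_gt0 // ler_pdivrMl //; apply => u.
  rewrite -[(_ *: _) u]/(c^-1 *: proj n y u) normrZ gtr0_norm ?invr_gt0 //.
  by rewrite ler_pdivrMl //; exact: hc.
move=> c' cv; apply/funext => j; apply/eqP; rewrite -subr_eq0 -normr_eq0; apply/eqP.
have [b b0 hb] := bounded_op_pos (dual_z_in_M j).1.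
apply: (@small_eq0 _ _ b); rewrite ?(ltW b0) // => d d0.
have dR : 0 < complex.Re d by move: d0; rewrite ltcE /= => /andP[].
move/fine_cvgP: cv => [fin /cvgrPdist_le /(_ _ dR) small].
have [n [[fn sn] jn]] := filter_ex (filterI (filterI fin small) (nbhs_infty_gt j)).
have Nn : (functional_norm M (phi - \sum_(0 <= k < n) c' k *: e k)%R <= (complex.Re d)%:E)%E.
  rewrite -(fineK fn) lee_fin; move: sn; rewrite /= sub0r normrN.
  exact: le_trans (ler_norm _).
have MW : M (b^-1 *: dual_z j).
  by rewrite -[_ *: _]addr0; apply: vN_generated_lin; [exact: dual_z_in_M|exact: vN_generated0].
have W1 u : `|(b^-1 *: dual_z j) u| <= `|u|.
  rewrite -[(_ *: _) u]/(b^-1 *: dual_z j u) normrZ gtr0_norm ?invr_gt0 //.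
  by rewrite ler_pdivrMl.
have : ((rnorm ((phi - \sum_(0 <= k < n) c' k *: e k)%R (b^-1 *: dual_z j)))%:E <= (complex.Re d)%:E)%E.
  by apply: le_trans Nn; apply: ereal_sup_ubound; exists (b^-1 *: dual_z j).
rewrite lee_fin -lecR -rnormE subE.
pose th y := phi y - \sum_(0 <= k < n) c' k * e k y.
rewrite -[phi _ - _]/(th (b^-1 *: dual_z j)).
rewrite (functionalZ (phi := th) _ (diff_functional c' n) (dual_z_in_M j)) /th.
rewrite (bigD1_seq j) ?iota_uniq ?mem_index_iota //=.
rewrite e_dual_z eqxx mulr1 big1 ?addr0; last by move=> k /negbTE nk; rewrite e_dual_z nk mulr0.
by rewrite normrM gtr0_norm ?invr_gt0 // ler_pdivrMl // RRe_real ?gtr0_real.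
Qed.

End Main.

Theorem corollary21 (R : realType) (lambda1 lambda2 : R)
    (hlambda1 : 0 < lambda1 < 1) (hlambda2 : 0 < lambda2 < 1)
    (hirr : irrational (ln lambda1 / ln lambda2))
    (P1 : powers_system (lambda1 / (lambda1 + 1)))
    (P2 : powers_system (lambda2 / (lambda2 + 1)))
    (K : hilbertType R[i])
    (t : {bilinear (ps_space P1) -> (ps_space P2) -> K})
    (ht : is_hilbert_tensor t)
    (s : side) (z : nat -> K -> K)
    (hz : shell_product t (haar P1 s) (haar P2 s) z) :
  let M := vN_tensor t (powers_factor P1) (powers_factor P2) in
  let rho := vector_state (t (ps_vec P1) (ps_vec P2)) in
  schauder_basis (predual M) (functional_norm M)
    (fun n => predual_embedding s rho (z n)).
Proof.
case/andP: hlambda1 => l10 _; case/andP: hlambda2 => l20 _.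
exact: (haar_tensor_schauder l10 l20 ht hz).
Qed.
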